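(* Let $k\ge0$ and $c>0$ be fixed, and for each $n$ let $X_n$ be a homogeneous and spatially independent random subcomplex of $\triangle_n$ with $n^{k+1}q_k\to\infty$ and $nr_k\sim c$. Then there exists a deterministic Borel probability measure $\mu$ on $\mathbb{R}$ such that for every open set $U$ of the space $\mathcal{P}_{\mathbb{R}}$ of Borel probability measures on $\mathbb{R}$ (with the topology of weak convergence) with $\mu\in U$, \[ \lim_{n\to\infty}\mathbb{P}\bigl(\mu_{L_k^{\mathrm{up}}(X_n)}\in U\ \big|\ \dim X_n\ge k\bigr)=1, \] i.e. the empirical spectral distribution of $L_k^{\mathrm{up}}(X_n)$ under $\mathbb{P}(\cdot\mid\dim X_n\ge k)$ converges weakly to $\mu$ in distribution.
   Context: $\triangle_n=2^{[n]}$, subcomplexes (families $Y\subset2^{[n]}$ closed under subsets), random subcomplexes, homogeneity ($X$ and $gX$ equal in law for all permutations $g$ of $[n]$), spatial independence ($\mathbb{P}(Y_1\cup Y_2\subset X)\mathbb{P}(Y_1\cap Y_2\subset X)=\mathbb{P}(Y_1\subset X)\mathbb{P}(Y_2\subset X)$ for all subcomplexes $Y_1,Y_2$), and $q_k=\mathbb{P}(\tau\in X)$, $r_k=\mathbb{P}(\sigma\in X\mid\tau\in X)$ (or $0$ if $q_k=0$) for $k$-simplex $\tau\subset(k+1)$-simplex $\sigma$, are as usual; $\dim X$ is the maximal dimension of a simplex of $X$. For a finite simplicial complex $X$ and $k\ge0$: $C^k(X)$ is the real vector space of alternating functions on ordered $k$-simplices $(v_0,\dots,v_k)$, with inner product $(\varphi,\psi)_k=\frac{1}{(k+1)!}\sum_{\sigma}\varphi(\sigma)\psi(\sigma)$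 over ordered $k$-simplices; $d_k:C^k\to C^{k+1}$ is $d_k\varphi(v_0,\dots,v_{k+1})=\sum_{i}(-1)^i\varphi(v_0,\dots,\hat v_i,\dots,v_{k+1})$; the up Laplacian is $L_k^{\mathrm{up}}(X)=d_k^*d_k$, the adjoint taken with respect to $(\cdot,\cdot)_k$ and $(\cdot,\cdot)_{k+1}$. Its empirical spectral distribution is $\mu_{L_k^{\mathrm{up}}(X)}=\frac{1}{f_k(X)}\sum_{i=1}^{f_k(X)}\delta_{\lambda_i}$ over its eigenvalues $\lambda_i$ with multiplicity, $f_k(X)$ being the number of $k$-simplices. *)

(* Defs.v *)
From Stdlib Require Import Reals Rtopology Classical ClassicalEpsilon.
From mathcomp Require Import all_boot all_fingroup.
Set Implicit Arguments. Unset Strict Implicit. Unset Printing Implicit Defensive.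
Local Open Scope R_scope.

(* A (set-)function on subsets of R; only its values on Borel sets matter. *)
Definition Rmeasure := (R -> Prop) -> R.

Definition sigma_algebra (S : (R -> Prop) -> Prop) : Prop :=
  S (fun _ => True) /\
  (forall A, S A -> S (fun x => ~ A x)) /\
  (forall A : nat -> (R -> Prop), (forall i, S (A i)) ->
      S (fun x => exists i, A i x)).

Definition Borel (A : R -> Prop) : Prop :=
  forall S, sigma_algebra S -> (forall O, open_set O -> S O) -> S A.

Definition is_prob_measure (m : Rmeasure) : Prop :=
  (forall A, Borel A -> 0 <= m A) /\
  m (fun _ => True) = 1 /\
  (forall A : nat -> (R -> Prop),
      (forall i, Borel (A i)) ->
      (forall i j x, i <> j -> A i x -> A j x -> False) ->
      infinite_sum (fun i => m (A i)) (m (fun x => exists i, A i x))).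

(* Lebesgue integral of a nonnegative function g: limit of the integrals of the
   increasing simple approximations s_n = min(n, floor(2^n g)/2^n). *)
Definition approx_integral (m : Rmeasure) (g : R -> R) (n : nat) : R :=
  \big[Rplus/0]_(1 <= j < (n * 2 ^ n).+1)
     (/ 2 ^ n * m (fun x => INR j / 2 ^ n <= g x)).

Definition nonneg_integral (m : Rmeasure) (g : R -> R) (I : R) : Prop :=
  Un_cv (approx_integral m g) I.

Definition integrates (m : Rmeasure) (f : R -> R) (I : R) : Prop :=
  exists I1 I2,
    nonneg_integral m (fun x => Rmax (f x) 0) I1 /\
    nonneg_integral m (fun x => Rmax (- f x) 0) I2 /\ I = I1 - I2.

Definition bounded_continuous (f : R -> R) : Prop :=
  continuity f /\ exists M, forall x, Rabs (f x) <= M.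

(* U is open in the space P_R of Borel probability measures with the topology
   of weak convergence (initial topology of m |-> \int f dm, f bounded
   continuous): every point of U has a basic neighbourhood inside U. *)
Definition weak_open (U : Rmeasure -> Prop) : Prop :=
  forall m, is_prob_measure m -> U m ->
    exists (fs : list (R -> R)) (eps : R), 0 < eps /\
      (forall f, List.In f fs -> bounded_continuous f) /\
      (forall m', is_prob_measure m' ->
         (forall f, List.In f fs -> forall I I',
             integrates m f I -> integrates m' f I' -> Rabs (I - I') < eps) ->
         U m').

Definition indic (P : Prop) : R :=
  if ClassicalEpsilon.excluded_middle_informative P then 1 else 0.

Definition is_subcomplex n (Y : {set {set 'I_n}}) : Prop :=
  forall s t : {set 'I_n}, s \in Y -> t \subset s -> t \in Y.

(* A random subcomplex of the simplex on [n] is given by its law p. *)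
Definition is_random_subcomplex n (p : {set {set 'I_n}} -> R) : Prop :=
  (forall Y, 0 <= p Y) /\
  \big[Rplus/0]_(Y : {set {set 'I_n}}) p Y = 1 /\
  (forall Y, ~ is_subcomplex Y -> p Y = 0).

Definition Pr n (p : {set {set 'I_n}} -> R) (E : {set {set 'I_n}} -> Prop) : R :=
  \big[Rplus/0]_(Y : {set {set 'I_n}}) (indic (E Y) * p Y).

Definition cond_Pr n (p : {set {set 'I_n}} -> R)
  (E D : {set {set 'I_n}} -> Prop) : R :=
  Pr p (fun Y => E Y /\ D Y) / Pr p D.

Definition act_cx n (g : {perm 'I_n}) (Y : {set {set 'I_n}}) : {set {set 'I_n}} :=
  [set [set g x | x in s] | s : {set 'I_n} in Y].

Definition homogeneous n (p : {set {set 'I_n}} -> R) : Prop :=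
  forall (g : {perm 'I_n}) (Y : {set {set 'I_n}}),
    Pr p (fun Z => act_cx g Z = Y) = p Y.

Definition spatially_independent n (p : {set {set 'I_n}} -> R) : Prop :=
  forall Y1 Y2 : {set {set 'I_n}}, is_subcomplex Y1 -> is_subcomplex Y2 ->
    Pr p (fun X => Y1 :|: Y2 \subset X) * Pr p (fun X => Y1 :&: Y2 \subset X)
    = Pr p (fun X => Y1 \subset X) * Pr p (fun X => Y2 \subset X).

Definition std_simplex n (j : nat) : {set 'I_n} := [set i : 'I_n | (i <= j)%N].

Definition q_k n (p : {set {set 'I_n}} -> R) (k : nat) : R :=
  Pr p (fun X => std_simplex n k \in X).

Definition r_k n (p : {set {set 'I_n}} -> R) (k : nat) : R :=
  let q := q_k p k in
  if ClassicalEpsilon.excluded_middle_informative (q = 0) then 0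
  else Pr p (fun X => std_simplex n k.+1 \in X /\ std_simplex n k \in X) / q.

Definition dim_ge n (k : nat) (X : {set {set 'I_n}}) : Prop :=
  exists s, s \in X /\ (k.+1 <= #|s|)%N.

(* k-simplices of X: index set of the orthonormal basis of C^k(X)
   (basis vector e_s = alternating function with value 1 on the
   increasing ordering of s; (e_s, e_s)_k = 1). *)
Definition kface n (X : {set {set 'I_n}}) (k : nat) :=
  {s : {set 'I_n} | (s \in X) && (#|s| == k.+1)}.

(* Matrix coefficient of d_k: (d_k e_s)(t) for a (k+1)-simplex t with its
   increasing ordering (v_0 < ... < v_{k+1}); equals (-1)^i if s = t minus v_i. *)
Definition cobd n (t s : {set 'I_n}) : R :=
  if s \subset t then
    (-1) ^ (\sum_(v in t :\: s) #|[set u in t | (u < v)%N]|)%N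
  else 0.

(* Matrix of L_k^up(X) = d_k^* d_k in the orthonormal basis (e_s). *)
Definition Lup n (X : {set {set 'I_n}}) (k : nat) (s s' : kface X k) : R :=
  \big[Rplus/0]_(t : {set 'I_n} | (t \in X) && (#|t| == k.+2))
     (cobd t (val s) * cobd t (val s')).

Definition detR (T : finType) (M : T -> T -> R) : R :=
  \big[Rplus/0]_(g : {perm T})
     ((-1) ^ (odd_perm g) * \big[Rmult/1]_(i : T) M i (g i)).

Definition charpolyR (T : finType) (M : T -> T -> R) (x : R) : R :=
  detR (fun i j => (if i == j then x else 0) - M i j).

Definition is_spectrum (T : finType) (M : T -> T -> R) (ls : seq R) : Prop :=
  size ls = #|T| /\
  forall x, charpolyR M x = \big[Rmult/1]_(l <- ls) (x - l).

Definition esd (ls : seq R) : Rmeasure :=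
  fun A => / INR (size ls) * \big[Rplus/0]_(l <- ls) indic (A l).

Definition esd_in n (k : nat) (U : Rmeasure -> Prop) (X : {set {set 'I_n}}) : Prop :=
  exists ls, is_spectrum (@Lup n X k) ls /\ U (esd ls).

(* Main.v *)
(** Moment method. Normalise the law so that the empty simplex has probability 1
    and let Q j be the probability of a simplex on j vertices. Spatial independence
    gives P(Y and <s, v> in X) = r P(Y in X), with r = Q (k+2) / Q (k+1), if the
    k-simplex s lies in Y and v is a new vertex, and at most eps P(Y in X), with
    eps = Q (k+2) Q k / Q (k+1)^2, if v is a vertex of Y not joined to all of s. The
    ratios Q (j+1) Q (j-1) / Q j ^2 are nonincreasing in j, whence
    n^(k+1) Q (k+1) eps^((k+1)^2) <= (n r)^(k+1) and eps tends to 0. So the closed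
    walks counted by the trace of the m-th power of the up-Laplacian are essentially
    those tracing out tree-like complexes, on which the incidence signs cancel:
    the expected trace is asymptotic to beta_m E f_k, where beta_m depends only on
    k, c and m, and its variance is o((E f_k)^2).

    Since |beta_m| <= C^m m!, lists of nonnegative reals whose first moments are close
    to beta have converging averages of exp(-t x) for small t (Taylor), hence, along
    integer multiples of t, of exp(-i t x), hence (Bernstein polynomials in exp(-t x))
    of every bounded continuous function. The limits on piecewise linear ramps give
    the distribution function of mu. *)

Require Import Defs.
From Stdlib Require Import Reals Rtopology Classical ClassicalEpsilon.
From HB Require Import structures.
From mathcomp Require Import all_boot all_order all_fingroup all_algebra.
From mathcomp Require Import Rstruct.
From mathcomp Require Import ring lra zify.
Set Implicit Arguments. Unset Strict Implicit. Unset Printing Implicit Defensive.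
Import Order.TTheory GRing.Theory Num.Theory.
Local Open Scope ring_scope.

Notation RR := Rdefinitions.R.

(** Closed walks are never enumerated. The state of the induction is the complex [Y] already
    required to lie in [X], and every step multiplies its probability by a factor that spatial
    independence controls. Two properties must travel with [Y]: flagness, because the small factor
    is available only when an edge is missing, not merely a simplex; and a gauge, which makes the
    signs of a returning walk multiply to 1. The variance needs no pair of walks: one exploration is
    run with the centred trace as weight.

    Nothing shows in advance that the recursively defined [moment] is the moment sequence of a
    measure. Lists with nearly these moments are supplied by the random complexes themselves, since
    an event of probability close to 1 is nonempty; this is what makes limits of averages unique and
    monotone. A growth of order C^m m! leaves only a finite radius of convergence, so a single
    factor exp(-t x) is expanded at a time, for one fixed small t. *)

Lemma sumr_const_seq (V : zmodType) (I : Type) (s : seq I) (x : V) :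
  \sum_(i <- s) x = x *+ size s.
Proof. by rewrite big_const_seq count_predT iter_addr_0. Qed.

(** * The limiting moments *)

Section LimitMoments.
Variables (R : realFieldType) (k : nat) (c : R).
Implicit Types (F : seq (seq nat)) (a : seq nat).

(* Weighted number of ways to close up a walk which has so far visited the
   simplices F on vertex labels 0, ..., V-1 and stands at the k-face a: a step
   reuses a simplex of F, or opens a new one at a new vertex (weight c). *)
Fixpoint tree_walk m F V a a0 : R :=
  if m is m'.+1 then
    \sum_(i <- iota 0 V | (i \notin a) && has (fun f => all (mem f) (i :: a)) F)
      \sum_(j <- i :: a) tree_walk m' F V [seq x <- i :: a | x != j] a0
    + c * \sum_(j <- V :: a)
        tree_walk m' ((V :: a) :: F) V.+1 [seq x <- V :: a | x != j] a0
  else (all (mem a0) a)%:R.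

Definition moment m : R :=
  tree_walk m [:: iota 0 k.+1] k.+1 (iota 0 k.+1) (iota 0 k.+1).

(** A step has at most V known vertices and new ones of total weight at most C, and then k+2 facets
    to leave by. The same product bounds the limit walks and, later, the walks in the random
    complex. *)
Fixpoint walk_bound (C : R) m V : R :=
  if m is m'.+1 then k.+2%:R * (V%:R + C) * walk_bound C m' V.+1 else 1.

Lemma walk_bound_ge0 C m V : 0 <= C -> 0 <= walk_bound C m V.
Proof. by move=> C0; elim: m V => //= m IH V; rewrite mulr_ge0 // mulr_ge0 // addr_ge0. Qed.

Lemma size_del i a j : uniq (i :: a) -> j \in i :: a ->
  size [seq x <- i :: a | x != j] = size a.
Proof.
move=> ua ja; rewrite size_filter.
have := count_predC (pred1 j) (i :: a); rewrite (count_uniq_mem _ ua) ja add1n.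
by case.
Qed.

Lemma tree_walk_bound C m F V a a0 : 0 <= c <= C -> uniq a -> size a = k.+1 ->
  all (gtn V) a -> `|tree_walk m F V a a0| <= walk_bound C m V.
Proof.
move=> /andP[c0 cC]; have C0 := le_trans c0 cC.
elim: m F V a => [|m IH] F V a ua sa aV /=.
  by rewrite normr_nat; case: all; rewrite ?lexx.
have step F' V' i : (V' <= V.+1)%N -> all (gtn V') (i :: a) -> i \notin a ->
    `|\sum_(j <- i :: a) tree_walk m F' V' [seq x <- i :: a | x != j] a0|
      <= k.+2%:R * walk_bound C m V'.
  move=> V'V iaV ia; have uia : uniq (i :: a) by rewrite /= ia.
  apply: le_trans (ler_norm_sum _ _ _) _.
  rewrite -sa -[(size a).+1]/(size (i :: a)) mulr_natl -sumr_const_seq.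
  rewrite big_seq [leRHS]big_seq; apply: ler_sum => j ja.
  apply: IH; rewrite ?filter_uniq ?size_del //.
  by apply/allP => x; rewrite mem_filter => /andP[_ /(allP iaV)].
(* Monotonicity in V allows steps that reuse a known simplex, and so keep V, to be charged with
   V+1. *)
have bm V1 : walk_bound C m V1 <= walk_bound C m V1.+1.
  elim: m {IH step} V1 => //= m IH V1; apply: ler_pM (IH _); rewrite ?walk_bound_ge0 //.
    exact: mulr_ge0 (ler0n _ _) (addr_ge0 (ler0n _ _) C0).
  by rewrite ler_wpM2l // lerD2r ler_nat.
have aV1 : all (gtn V.+1) (V :: a).
  by rewrite /= ltnSn; apply: sub_all aV => x /= /leqW.
have Va : V \notin a by apply/negP => /(allP aV); rewrite /= ltnn.
apply: le_trans (ler_normD _ _) _.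
rewrite [leRHS](_ : _ = V%:R * (k.+2%:R * walk_bound C m V.+1) + C * (k.+2%:R * walk_bound C m V.+1)); last by ring.
apply: lerD; last first.
  by rewrite normrM (ger0_norm c0); apply: ler_pM; rewrite ?step.
apply: le_trans (ler_norm_sum _ _ _) _.
rewrite [V%:R * _](_ : _ = \sum_(i <- iota 0 V) (k.+2%:R * walk_bound C m V.+1)); last first.
  by rewrite sumr_const_seq size_iota mulr_natl.
rewrite big_mkcond /=.
rewrite big_seq [leRHS]big_seq; apply: ler_sum => i; rewrite mem_iota add0n /= => iV.
case: ifP => [/andP[ia _]|_]; last by rewrite mulr_ge0 ?walk_bound_ge0.
apply: le_trans (step _ _ _ _ _ ia) _; rewrite /= ?iV //.
by rewrite ler_wpM2l.
Qed.

(** The factors (k+2)(k+1+V+A) grow linearly in V; bounding each by (k+2)(k+2+A)(V+1) turns their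
    product into a geometric term times m!. *)
Lemma moment_bound (A : nat) m : 0 <= c <= A%:R ->
  `|moment m| <= (k.+2 * (k.+1 + A).+1)%:R ^+ m * m`!%:R.
Proof.
move=> cA; apply: le_trans (tree_walk_bound m _ _ cA _ _ _) _;
  rewrite ?iota_uniq ?size_iota //.
  by apply/allP => x; rewrite mem_iota add0n.
rewrite -natrX -natrM.
suff H V : walk_bound A%:R m (k.+1 + V) <=
   (\prod_(V <= i < V + m) (k.+2 * (k.+1 + A).+1 * i.+1))%:R.
  have := H 0%N; rewrite addn0 => /le_trans; apply; rewrite ler_nat.
  rewrite big_split /= prod_nat_const_nat subn0 leq_mul //.
  by rewrite add0n fact_prod big_add1.
elim: m V => [|m IH] V /=; first by rewrite addn0 big_geq.
rewrite addnS big_ltn ?ltnS ?leq_addr // natrM -addnS.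
apply: ler_pM; rewrite ?walk_bound_ge0 //.
    exact: mulr_ge0 (ler0n _ _) (addr_ge0 (ler0n _ _) (ler0n _ _)).
  rewrite -natrD -natrM ler_nat -mulnA leq_mul2l /=.
  by rewrite mulnS mulSn; nia.
Qed.
End LimitMoments.

(** * Random complexes and walks *)

Section Complexes.
Variable T : finType.
Implicit Types (X Y : {set {set T}}) (s t : {set T}).

(** Unlike [is_subcomplex], this demands the empty simplex: vertex-disjoint complexes then meet
    exactly in [[set set0]], whose presence has probability 1 under the normalised law. *)
Definition cplx Y := (set0 \in Y) && [forall s in Y, powerset s \subset Y].

Lemma cplxP Y :
  reflect (set0 \in Y /\ forall s t, s \in Y -> t \subset s -> t \in Y) (cplx Y).
Proof.
apply: (iffP andP) => -[Y0 HY]; split=> //.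
  move=> s t sY ts; have /forall_inP /(_ _ sY) /subsetP := HY.
  by apply; rewrite powersetE.
by apply/forall_inP => s sY; apply/subsetP => t; rewrite powersetE; apply: HY.
Qed.

Lemma cplx0 Y : cplx Y -> set0 \in Y. Proof. by case/andP. Qed.

Lemma cplxS Y s t : cplx Y -> s \in Y -> t \subset s -> t \in Y.
Proof. by case/cplxP => _; apply. Qed.

Lemma cplx_powerset s : cplx (powerset s).
Proof.
apply/cplxP; rewrite powersetE sub0set; split=> // t u.
by rewrite !powersetE => ts /subset_trans; apply.
Qed.

Lemma cplxU Y1 Y2 : cplx Y1 -> cplx Y2 -> cplx (Y1 :|: Y2).
Proof.
move=> c1 c2; apply/cplxP; rewrite inE (cplx0 c1); split=> // s t.
by rewrite !inE => /orP[] H ts; rewrite ?(cplxS c1 H ts) ?(cplxS c2 H ts) ?orbT.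
Qed.

Lemma cplxI Y1 Y2 : cplx Y1 -> cplx Y2 -> cplx (Y1 :&: Y2).
Proof.
move=> c1 c2; apply/cplxP; rewrite inE (cplx0 c1) (cplx0 c2); split=> // s t.
by rewrite !inE => /andP[] H1 H2 ts; rewrite (cplxS c1 H1 ts) (cplxS c2 H2 ts).
Qed.

Lemma powerset_subP Y s : cplx Y -> (powerset s \subset Y) = (s \in Y).
Proof.
move=> cY; apply/subsetP/idP => [|sY t]; first by apply; rewrite powersetE.
by rewrite powersetE; apply: cplxS.
Qed.

Definition vert Y := [set v | [set v] \in Y].

Lemma vertU Y1 Y2 : vert (Y1 :|: Y2) = vert Y1 :|: vert Y2.
Proof. by apply/setP => v; rewrite !inE. Qed.

Lemma vert_powerset s : vert (powerset s) = s.
Proof. by apply/setP => v; rewrite !inE sub1set. Qed.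

Lemma sub_vert Y s : cplx Y -> s \in Y -> s \subset vert Y.
Proof.
by move=> cY sY; apply/subsetP => v vs; rewrite inE (cplxS cY sY) ?sub1set.
Qed.

Lemma powersetI s t : powerset (s :&: t) = powerset s :&: powerset t.
Proof. by apply/setP => u; rewrite !inE subsetI. Qed.
End Complexes.

(** * Probabilities of complexes under a spatially independent law *)

Section Weights.
Variables (R : realFieldType) (T : finType) (w : {set {set T}} -> R) (Q : nat -> R).
Implicit Types (X Y : {set {set T}}) (s t : {set T}).
Hypothesis w_ge0 : forall X, 0 <= w X.
Hypothesis w_cplx : forall X, ~~ cplx X -> w X = 0.

Definition Ex (f : {set {set T}} -> R) := \sum_X w X * f X.
Definition pr Y := Ex (fun X => (Y \subset X)%:R).

Hypothesis pr_indep : forall Y1 Y2, cplx Y1 -> cplx Y2 ->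
  pr (Y1 :|: Y2) * pr (Y1 :&: Y2) = pr Y1 * pr Y2.
Hypothesis pr_hom : forall s, pr (powerset s) = Q #|s|.
Hypothesis Q0 : Q 0 = 1.

Lemma eq_Ex f g : (forall X, cplx X -> f X = g X) -> Ex f = Ex g.
Proof.
move=> fg; apply: eq_bigr => X _; case: (boolP (cplx X)) => [/fg -> //|/w_cplx ->].
by rewrite !mul0r.
Qed.

Lemma le_Ex f g : (forall X, cplx X -> f X <= g X) -> Ex f <= Ex g.
Proof.
move=> fg; apply: ler_sum => X _; case: (boolP (cplx X)) => [/fg ?|/w_cplx ->].
  by rewrite ler_wpM2l.
by rewrite !mul0r.
Qed.

Lemma ExD f g : Ex (fun X => f X + g X) = Ex f + Ex g.
Proof. by rewrite -big_split; apply: eq_bigr => X _; rewrite mulrDr. Qed.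

Lemma ExZ a f : Ex (fun X => a * f X) = a * Ex f.
Proof. by rewrite mulr_sumr; apply: eq_bigr => X _; rewrite mulrCA. Qed.

Lemma Ex_sum (I : Type) (r : seq I) (P : pred I) (F : I -> {set {set T}} -> R) :
  Ex (fun X => \sum_(i <- r | P i) F i X) = \sum_(i <- r | P i) Ex (F i).
Proof.
rewrite exchange_big; apply: eq_bigr => X _; exact: mulr_sumr.
Qed.

Lemma pr_mono Y1 Y2 : Y1 \subset Y2 -> pr Y2 <= pr Y1.
Proof.
move=> sY; apply: le_Ex => X _; rewrite ler_nat.
by case: (boolP (Y2 \subset X)) => // H; rewrite (subset_trans sY H).
Qed.

Lemma pr_ge0 Y : 0 <= pr Y.
Proof. by apply: sumr_ge0 => X _; rewrite mulr_ge0. Qed.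

Lemma pr_set0 : pr [set set0] = 1.
Proof. by rewrite -powerset0 pr_hom cards0. Qed.

Lemma pr_le1 Y : cplx Y -> pr Y <= 1.
Proof. by move=> cY; rewrite -pr_set0 pr_mono // sub1set cplx0. Qed.

Lemma Ex1 : Ex (fun=> 1) = 1.
Proof.
by rewrite -[RHS]pr_set0; apply: eq_Ex => X cX; rewrite sub1set cplx0.
Qed.

Lemma pr_disj Y1 Y2 : cplx Y1 -> cplx Y2 -> [disjoint vert Y1 & vert Y2] ->
  pr (Y1 :|: Y2) = pr Y1 * pr Y2.
Proof.
move=> c1 c2 dis; rewrite -pr_indep //.
suff -> : Y1 :&: Y2 = [set set0] by rewrite pr_set0 mulr1.
apply/setP => s; rewrite !inE; apply/andP/eqP => [[s1 s2]|->]; last by rewrite !cplx0.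
apply/setP => v; rewrite inE; apply/negP => vs.
have := disjointFr dis (subsetP (sub_vert c1 s1) _ vs).
by rewrite (subsetP (sub_vert c2 s2) _ vs).
Qed.

Variable k : nat.
Hypothesis Qpos : 0 < Q k.+2.

Lemma Q_antimono i j : (i <= j <= k.+2)%N -> (k.+2 <= #|T|)%N -> Q j <= Q i.
Proof.
move=> /andP[ij jk] kT.
have jT : (j <= #|T|)%N by apply: leq_trans jk kT.
have : (0 < #|[set s : {set T} | (s \subset setT) && (#|s| == j)]|)%N.
  by rewrite cards_draws bin_gt0 cardsT.
case/card_gt0P => t; rewrite inE => /andP[_ /eqP tj].
have : (0 < #|[set s : {set T} | (s \subset t) && (#|s| == i)]|)%N.
  by rewrite cards_draws bin_gt0 tj.
case/card_gt0P => s; rewrite inE => /andP[st /eqP si].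
by rewrite -si -tj -!pr_hom pr_mono // powersetS.
Qed.

Hypothesis kT : (k.+2 <= #|T|)%N.

Lemma Q_gt0 i : (i <= k.+2)%N -> 0 < Q i.
Proof. by move=> ik; apply: lt_le_trans Qpos (Q_antimono _ kT); rewrite ik /=. Qed.

(* [eps] is the conditional probability of a (k+1)-simplex given two of its k-faces. *)
Definition ext_pr := Q k.+2 / Q k.+1.
Definition eps := Q k.+2 * Q k / Q k.+1 ^+ 2.

Lemma ext_pr_gt0 : 0 < ext_pr.
Proof. by rewrite divr_gt0 // Q_gt0. Qed.

Lemma ext_pr_le_eps : ext_pr <= eps.
Proof.
have q1 : 0 < Q k.+1 by rewrite Q_gt0.
have q01 : Q k.+1 <= Q k by rewrite Q_antimono // !leqnSn.
rewrite /ext_pr /eps ler_pdivrMr // -[_ * _ / _ * _]mulrA -mulrA ler_pMr //.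
by rewrite expr2 invfM divfK ?gt_eqF // ler_pdivlMr // mul1r.
Qed.

Section Step.
Variables (Y : {set {set T}}) (s : {set T}) (v : T).
Hypotheses (cY : cplx Y) (sY : s \in Y) (sk : #|s| = k.+1) (vs : v \notin s).

Lemma card_vs : #|v |: s| = k.+2. Proof. by rewrite cardsU1 vs sk. Qed.

Lemma step_le : pr (Y :|: powerset (v |: s)) <= pr Y.
Proof. by rewrite pr_mono // subsetUl. Qed.

(** Allows [step_cross] to cancel the probability of the intersection in the independence
    identity. *)
Lemma prI_gt0 : 0 < pr (Y :&: powerset (v |: s)).
Proof.
apply: lt_le_trans Qpos _; rewrite -card_vs -pr_hom pr_mono //.
exact: subsetIr.
Qed.

(** The faces of the new simplex that avoid [v] are those of [s], so it meets [Y] exactly in the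
    simplex on [s] and independence gives an equality. *)
Lemma step_new : v \notin vert Y -> pr (Y :|: powerset (v |: s)) = ext_pr * pr Y.
Proof.
move=> vY; have := pr_indep cY (cplx_powerset (v |: s)).
have -> : Y :&: powerset (v |: s) = powerset s.
  apply/setP => t; rewrite !inE; apply/andP/idP => [[tY ts]|ts].
    apply/subsetP => x xt; have := subsetP ts _ xt; rewrite !inE => /orP[/eqP xv|//].
    by case/negP: vY; rewrite inE; apply: (cplxS cY tY); rewrite sub1set -xv.
  by split; [apply: (cplxS cY sY)|apply: subset_trans ts (subsetUr _ _)].
rewrite !pr_hom card_vs sk /ext_pr => H; have q1 : 0 < Q k.+1 by rewrite Q_gt0.
by apply: (mulIf (lt0r_neq0 q1)); rewrite H mulrAC divfK ?gt_eqF // mulrC.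
Qed.

(* The intersection of Y with the simplex on v |: s omits the edge {v, x}, hence
   lies in the union of two k-simplices meeting in a (k-1)-simplex. *)
Lemma step_cross x : x \in s -> [set v; x] \notin Y ->
  pr (Y :|: powerset (v |: s)) <= eps * pr Y.
Proof.
move=> xs xY; have := pr_indep cY (cplx_powerset (v |: s)).
set I := Y :&: _; rewrite pr_hom card_vs => H.
have I0 : 0 < pr I := prI_gt0.
have q1 : 0 < Q k.+1 by rewrite Q_gt0.
have q0 : 0 < Q k by rewrite Q_gt0 // ltnW.
pose s' := v |: (s :\ x).
have s'I : s' :&: s = s :\ x.
  apply/setP => y; rewrite !inE; case: (eqVneq y v) => [->|_] /=.
    by rewrite (negPf vs) andbF.
  by rewrite -andbA andbb.
have cs1 : #|s :\ x| = k by move: (cardsD1 x s); rewrite xs sk => -[].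
have cs' : #|s'| = k.+1.
  by rewrite cardsU1 cs1 !inE (negPf vs) andbF.
have IU : I \subset powerset s' :|: powerset s.
  apply/subsetP => t; rewrite !inE => /andP[tY tvs].
  case: (boolP (v \in t)) => vt; last first.
    apply/orP; right; apply/subsetP => y yt; have := subsetP tvs _ yt.
    by rewrite !inE => /orP[/eqP yv|//]; rewrite -yv yt in vt.
  apply/orP; left; apply/subsetP => y yt; have := subsetP tvs _ yt.
  rewrite !inE; case: eqP => //= _ ys; rewrite ys andbT.
  apply: contra xY => /eqP yx; apply: (cplxS cY tY).
  by apply/subsetP => u; rewrite !inE => /orP[]/eqP ->; rewrite // -yx.
have := pr_indep (cplx_powerset s') (cplx_powerset s).
rewrite -powersetI s'I !pr_hom cs' sk cs1 => H2.
have := pr_mono IU.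
rewrite -(ler_pM2r q0) H2 => le.
rewrite -(ler_pM2r I0) H /eps.
have -> : Q k.+2 * Q k / Q k.+1 ^+ 2 * pr Y * pr I =
  pr Y * Q k.+2 * (pr I * Q k / Q k.+1 ^+ 2) by ring.
apply: ler_peMr; first by rewrite mulr_ge0 ?pr_ge0 // ltW.
by rewrite ler_pdivlMr ?exprn_gt0 // mul1r expr2.
Qed.
End Step.

(** The simplex on [s] meets [Y] within the simplex on [s :&: vert Y], so [Y] favours [s] by at most
    the inverse of the corresponding Q. Used for starting simplices that touch an explored
    complex. *)
Lemma pr_add_simplex Y s : cplx Y -> #|s| = k.+1 ->
  pr (Y :|: powerset s) <= pr Y * Q k.+1 / Q #|s :&: vert Y|.
Proof.
move=> cY sk; have := pr_indep cY (cplx_powerset s); rewrite pr_hom sk => <-.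
have le : Q #|s :&: vert Y| <= pr (Y :&: powerset s).
  rewrite -pr_hom pr_mono //; apply/subsetP => t; rewrite !inE => /andP[tY ts].
  by rewrite subsetI ts sub_vert.
have cle : (#|s :&: vert Y| <= k.+2)%N.
  by apply: leq_trans (subset_leq_card (subsetIl _ _)) _; rewrite sk.
by rewrite ler_pdivlMr ?Q_gt0 // ler_wpM2l // pr_ge0.
Qed.

Variable inc : {set T} -> {set T} -> R.
Hypothesis inc_sqr : forall t s, s \subset t -> inc t s * inc t s = 1.

Lemma inc_norm t s : s \subset t -> `|inc t s| = 1.
Proof.
move=> /inc_sqr H; apply/eqP.
by rewrite -(@pexpr_eq1 _ `|inc t s| 2) // -normrX expr2 H normr1.
Qed.

(** Orientation enters only through signs whose square is 1. This is the contribution to the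
    up-Laplacian of passing from [s] through [v |: s] to the facet omitting [u]; the choice u = v
    gives the diagonal. *)
Definition incs v s u := inc (v |: s) s * inc (v |: s) ((v |: s) :\ u).

Lemma incs_norm v s u : `|incs v s u| = 1.
Proof. by rewrite normrM !inc_norm ?mulr1 ?subsetUr ?subsetDl. Qed.

(* [walk m X s s0] is the [(s, s0)] entry of the m-th power of [d_k^* d_k]. *)
Fixpoint walk m X s s0 : R :=
  if m is m'.+1 then
    \sum_(v | v \notin s) (v |: s \in X)%:R *
      \sum_(u in v |: s) incs v s u * walk m' X ((v |: s) :\ u) s0
  else (s == s0)%:R.

(* [walk m X s s0 * H X] averaged over the event that [Y], the part of [X]
   explored so far, is present; a step of the walk enlarges [Y]. *)
Definition Phi H m Y s s0 := Ex (fun X => (Y \subset X)%:R * (walk m X s s0 * H X)).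

(** Since [X] is a complex, the test that [v |: s] lies in [X] is absorbed into [Y] as the presence
    of all faces of [v |: s]. *)
Lemma Phi_rec H m Y s s0 : Phi H m.+1 Y s s0 =
  \sum_(v | v \notin s) \sum_(u in v |: s)
     incs v s u * Phi H m (Y :|: powerset (v |: s)) ((v |: s) :\ u) s0.
Proof.
rewrite /Phi [LHS](_ : _ = Ex (fun X => \sum_(v | v \notin s) \sum_(u in v |: s)
  incs v s u * ((Y :|: powerset (v |: s) \subset X)%:R *
    (walk m X ((v |: s) :\ u) s0 * H X)))).
  rewrite Ex_sum; apply: eq_bigr => v _; rewrite Ex_sum; apply: eq_bigr => u _.
  by rewrite ExZ.
apply: eq_Ex => X cX /=; rewrite mulr_suml mulr_sumr; apply: eq_bigr => v _.
rewrite subUset powerset_subP // -mulrA mulrA -natrM mulnb mulr_suml mulr_sumr.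
by apply: eq_bigr => u _; rewrite -mulrA mulrCA.
Qed.

Lemma card_step v s u : v \notin s -> #|s| = k.+1 -> u \in v |: s ->
  #|(v |: s) :\ u| = k.+1.
Proof. by move=> vs sk uvs; move: (cardsD1 u (v |: s)); rewrite uvs card_vs // => -[]. Qed.

Lemma mem_step Y v s u : (v |: s) :\ u \in Y :|: powerset (v |: s).
Proof. by rewrite !inE subsetDl orbT. Qed.

(** * Uniform bounds and decorrelation for explored walks *)

Variable C : R.
Hypothesis rC : #|T|%:R * ext_pr <= C.

Lemma C_gt0 : 0 < C.
Proof. by apply: lt_le_trans rC; rewrite mulr_gt0 ?ext_pr_gt0 // ltr0n (leq_trans _ kT). Qed.

Lemma sum_new_le (A : {set T}) (x : R) : 0 <= x -> \sum_(v in A) ext_pr * x <= C * x.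
Proof.
move=> x0; rewrite sumr_const -mulr_natl mulrA ler_wpM2r //.
by apply: le_trans rC; rewrite (ler_pM2r ext_pr_gt0) ler_nat max_card.
Qed.

(** Relative to [pr Y], a known vertex counts at most 1, and the new ones count [ext_pr] each, hence
    at most [C] together. *)
Lemma sum_step_le Y s V : cplx Y -> s \in Y -> #|s| = k.+1 -> (#|vert Y| <= V)%N ->
  \sum_(v | v \notin s) pr (Y :|: powerset (v |: s)) <= (V%:R + C) * pr Y.
Proof.
move=> cY sY sk YV; rewrite (bigID (mem (vert Y))) /= mulrDl lerD //.
  apply: (@le_trans _ _ (\sum_(v in vert Y) pr Y)); last first.
    by rewrite sumr_const -(mulr_natl (pr Y)) ler_wpM2r ?pr_ge0 ?ler_nat.
  rewrite big_mkcond /= [leRHS]big_mkcond /=; apply: ler_sum => v _.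
  case: (v \in vert Y); rewrite ?andbT ?andbF //.
  by case: ifP => _; rewrite ?step_le ?pr_ge0.
apply: le_trans (sum_new_le (~: vert Y) (pr_ge0 Y)).
rewrite big_mkcond /= [leRHS]big_mkcond /=; apply: ler_sum => v _.
rewrite [v \in ~: _]inE; case: (boolP (v \in vert Y)) => vY; rewrite ?andbT ?andbF //=.
have vs : v \notin s by apply: contra vY; apply: (subsetP (sub_vert cY sY)).
by rewrite vs step_new.
Qed.

Lemma vert_step Y s v V : cplx Y -> s \in Y -> (#|vert Y| <= V)%N ->
  (#|vert (Y :|: powerset (v |: s))| <= V.+1)%N.
Proof.
move=> cY sY YV; rewrite vertU vert_powerset.
have -> : vert Y :|: (v |: s) = v |: vert Y.
  apply/setP => x; rewrite !inE orbCA; case: (x == v) => //=.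
  case: (boolP (x \in s)) => xs; rewrite ?orbF // orbT.
  by have := subsetP (sub_vert cY sY) _ xs; rewrite inE.
by apply: leq_trans (leq_card_setU _ _) _; rewrite cards1 add1n ltnS.
Qed.

Local Notation walk_bound := (walk_bound k C).

Lemma walk_boundC_ge0 m V : 0 <= walk_bound m V.
Proof. exact/walk_bound_ge0/ltW/C_gt0. Qed.

Lemma sum_incs_le v s (F : T -> R) B : v \notin s -> #|s| = k.+1 ->
  (forall u, u \in v |: s -> `|F u| <= B) ->
  `|\sum_(u in v |: s) incs v s u * F u| <= k.+2%:R * B.
Proof.
move=> vs sk FB; apply: le_trans (ler_norm_sum _ _ _) _.
rewrite -(card_vs sk vs) mulr_natl -sumr_const; apply: ler_sum => u uvs.
by rewrite normrM incs_norm mul1r FB.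
Qed.

(** The weight [H] is general because the bound serves twice: with the constant 1, and with the
    centred trace in the variance. V + m vertices suffice in the hypothesis, as each of the m steps
    adds at most one. *)
Lemma Phi_le H h m V Y s s0 : 0 <= h ->
  (forall Y, cplx Y -> (#|vert Y| <= V + m)%N ->
     `|Ex (fun X => (Y \subset X)%:R * H X)| <= h * pr Y) ->
  cplx Y -> s \in Y -> #|s| = k.+1 -> (#|vert Y| <= V)%N ->
  `|Phi H m Y s s0| <= walk_bound m V * (h * pr Y).
Proof.
move=> h0; elim: m V Y s => [|m IH] V Y s HY cY sY sk YV.
  rewrite mul1r /Phi /=; case: eqP => _; last first.
    rewrite (_ : Ex _ = 0) ?normr0 ?mulr_ge0 ?pr_ge0 //.
    by rewrite /Ex big1 // => X _; rewrite mul0r !mulr0.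
  rewrite (_ : Ex _ = Ex (fun X => (Y \subset X)%:R * H X)); last first.
    by apply: eq_Ex => X _; rewrite mul1r.
  by apply: HY; rewrite ?addn0.
rewrite Phi_rec; apply: le_trans (ler_norm_sum _ _ _) _.
apply: (@le_trans _ _ (\sum_(v | v \notin s)
    k.+2%:R * (walk_bound m V.+1 * h) * pr (Y :|: powerset (v |: s)))).
  apply: ler_sum => v vs; rewrite -!mulrA; apply: sum_incs_le => // u uvs.
  apply: IH; rewrite ?mem_step ?card_step ?vert_step //.
    by move=> Y' cY' YV'; apply: HY => //; rewrite addnS.
  by rewrite cplxU ?cplx_powerset.
rewrite -mulr_sumr.
have := sum_step_le cY sY sk YV.
rewrite -(ler_pM2l (ltr0Sn R k.+1)) /= => /(ler_wpM2l (mulr_ge0 (walk_boundC_ge0 m V.+1) h0)).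
by rewrite -subr_ge0 => H1; rewrite -subr_ge0; move: H1; congr (is_true (0 <= _)); ring.
Qed.

Definition unit_fun : {set {set T}} -> R := fun=> 1.

Lemma Phi1_le m V Y s s0 : cplx Y -> s \in Y -> #|s| = k.+1 -> (#|vert Y| <= V)%N ->
  `|Phi unit_fun m Y s s0| <= walk_bound m V * pr Y.
Proof.
move=> cY sY sk YV; rewrite -[pr Y in leRHS]mul1r; apply: Phi_le => // Z cZ _.
rewrite mul1r (_ : Ex _ = pr Z) ?ger0_norm ?pr_ge0 //.
by apply: eq_Ex => X _; rewrite mulr1.
Qed.

(** The last summand is the price of a collision with one of the V vertices of the other complex;
    its 2 bounds the joint and the factorised term separately. *)
Fixpoint decor_bound m V : R := if m is m'.+1 then
  k.+2%:R * ((V%:R + C) * decor_bound m' V.+1 + 2 * V%:R * walk_bound m' (V + V).+1) else 0.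

Lemma decor_bound_ge0 m V : 0 <= decor_bound m V.
Proof.
elim: m V => //= m IH V; rewrite mulr_ge0 // addr_ge0 //.
  by rewrite mulr_ge0 // addr_ge0 // ltW // C_gt0.
by rewrite mulr_ge0 ?walk_boundC_ge0 // mulr_ge0.
Qed.

(** While the walk around Y' avoids the vertices of Y, the two complexes stay vertex-disjoint and
    the induction continues. At a vertex of Y, the joint term pays [eps] by [step_cross], and in the
    factorised term the vertex is merely new to Y' and pays [ext_pr], which is at most [eps]. *)
Lemma Phi_disj m V Y Y' s s0 : cplx Y -> cplx Y' -> [disjoint vert Y & vert Y'] ->
  s \in Y' -> #|s| = k.+1 -> (#|vert Y| <= V)%N -> (#|vert Y'| <= V)%N ->
  `|Phi unit_fun m (Y :|: Y') s s0 - pr Y * Phi unit_fun m Y' s s0|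
     <= decor_bound m V * (eps * (pr Y * pr Y')).
Proof.
move=> cY; elim: m V Y' s => [|m IH] V Y' s cY' dis sY' sk YV YV'.
  have PE Z : Phi unit_fun 0 Z s s0 = (s == s0)%:R * pr Z.
    by rewrite -ExZ; apply: eq_Ex => X _; rewrite /= mulr1 mulrC.
  by rewrite !PE pr_disj // mulrCA subrr normr0 mul0r.
rewrite !Phi_rec mulr_sumr -sumrB.
apply: le_trans (ler_norm_sum _ _ _) _.
have e0 : 0 <= eps by rewrite (le_trans (ltW ext_pr_gt0)) ?ext_pr_le_eps.
have pp0 : 0 <= pr Y * pr Y' by rewrite mulr_ge0 ?pr_ge0.
have cUU : cplx (Y :|: Y') by rewrite cplxU.
have sUU : s \in Y :|: Y' by rewrite inE sY' orbT.
pose A := k.+2%:R * decor_bound m V.+1 * eps * pr Y.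
pose B := k.+2%:R * (2 * walk_bound m (V + V).+1) * (eps * (pr Y * pr Y')).
have A0 : 0 <= A.
  apply: mulr_ge0 (pr_ge0 _); apply: mulr_ge0 e0.
  by rewrite mulr_ge0 ?decor_bound_ge0.
have B0 : 0 <= B.
  by apply: mulr_ge0 (mulr_ge0 e0 pp0); rewrite !mulr_ge0 ?walk_boundC_ge0.
apply: (@le_trans _ _ (\sum_(v | v \notin s)
   (A * pr (Y' :|: powerset (v |: s)) + (v \in vert Y)%:R * B))); last first.
  rewrite big_split /= -mulr_sumr -mulr_suml.
  have S1 := sum_step_le cY' sY' sk YV'.
  have S2 : \sum_(v | v \notin s) (v \in vert Y)%:R <= V%:R :> R.
    apply: (@le_trans _ _ (\sum_v (v \in vert Y)%:R)).
      by rewrite [leRHS](bigID (fun v => v \notin s)) /= lerDl sumr_ge0.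
    rewrite (eq_bigr (fun v => if v \in vert Y then 1 else 0)).
      by rewrite -big_mkcond /= sumr_const ler_nat.
    by move=> v _; case: (v \in vert Y).
  apply: le_trans (lerD (ler_wpM2l A0 S1) (ler_wpM2r B0 S2)) _.
  by rewrite le_eqVlt; apply/orP; left; apply/eqP; rewrite /A /B /=; ring.
apply: ler_sum => v vs.
rewrite mulr_sumr -sumrB.
have -> : \sum_(u in v |: s)
   (incs v s u * Phi unit_fun m (Y :|: Y' :|: powerset (v |: s)) ((v |: s) :\ u) s0 -
    pr Y * (incs v s u * Phi unit_fun m (Y' :|: powerset (v |: s)) ((v |: s) :\ u) s0)) =
  \sum_(u in v |: s) incs v s u *
   (Phi unit_fun m (Y :|: (Y' :|: powerset (v |: s))) ((v |: s) :\ u) s0 -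
    pr Y * Phi unit_fun m (Y' :|: powerset (v |: s)) ((v |: s) :\ u) s0).
  by apply: eq_bigr => u _; rewrite setUA; ring.
have cP := cplx_powerset (v |: s).
case: (boolP (v \in vert Y)) => vY; last first.
  rewrite mul0r addr0; set Z := Y' :|: _.
  have -> : A * pr Z = k.+2%:R * (decor_bound m V.+1 * (eps * (pr Y * pr Z))).
    by rewrite /A; ring.
  apply: sum_incs_le => // u uvs; rewrite {}/Z.
  apply: IH; rewrite ?mem_step ?card_step ?vert_step ?cplxU //; last first.
    exact: leqW.
  rewrite vertU vert_powerset -setI_eq0 !setIUr !setU_eq0 !setI_eq0 dis /=.
  by rewrite disjoint_sym disjoints1 vY (disjointWr (sub_vert cY' sY')).
have vY' : v \notin vert Y' by rewrite (disjointFr dis).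
(* Any vertex of [s] will do: no edge of a union of vertex-disjoint complexes joins it to [v]. *)
have x0s : exists x, x \in s by apply/card_gt0P; rewrite sk.
case: x0s => x xs.
have vxN : [set v; x] \notin Y :|: Y'.
  have xY' : x \in vert Y' := subsetP (sub_vert cY' sY') _ xs.
  rewrite inE negb_or; apply/andP; split.
    apply: contraL xY' => H; rewrite (disjointFr dis) // inE (cplxS cY H) //.
    by rewrite sub1set !inE eqxx orbT.
  apply: contra vY' => H; rewrite inE (cplxS cY' H) //.
  by rewrite sub1set !inE eqxx.
rewrite mul1r; apply: ler_wpDl (mulr_ge0 A0 (pr_ge0 _)) _.
rewrite /B -mulrA; apply: sum_incs_le => // u uvs.
apply: le_trans (ler_normB _ _) _.
rewrite -[2]/(1 + 1) mulrDl mulrDl mul1r; apply: lerD.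
  apply: (@le_trans _ _ (walk_bound m (V + V).+1 * pr (Y :|: (Y' :|: powerset (v |: s))))).
    apply: Phi1_le; rewrite ?card_step ?cplxU //.
      by rewrite !inE subsetDl !orbT.
    rewrite setUA vert_step //.
    rewrite vertU (leq_trans (leq_card_setU _ _)) // leq_add //.
  rewrite ler_wpM2l ?walk_boundC_ge0 // setUA -pr_disj //.
  by apply: step_cross xs vxN.
rewrite normrM ger0_norm ?pr_ge0 //.
apply: (@le_trans _ _ (pr Y * (walk_bound m (V + V).+1 * (ext_pr * pr Y')))).
  rewrite ler_wpM2l ?pr_ge0 // -(step_new cY' sY' sk vs vY').
  apply: Phi1_le; rewrite ?card_step ?mem_step ?cplxU //.
  by rewrite vert_step // (leq_trans YV') // leq_addr.
rewrite [leLHS](_ : _ = walk_bound m (V + V).+1 * (ext_pr * (pr Y * pr Y'))); last by ring.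
by rewrite ler_wpM2l ?walk_boundC_ge0 // ler_wpM2r // ext_pr_le_eps.
Qed.

(** * Labelled tree-like complexes and the limiting walk *)

Definition emb (z : nat -> T) (a : seq nat) : {set T} := [set x in map z a].

Lemma mem_emb z a x : (x \in emb z a) = (x \in map z a).
Proof. by rewrite inE. Qed.

Lemma emb_cons z i a : emb z (i :: a) = z i |: emb z a.
Proof. by apply/setP => x; rewrite !inE. Qed.

Section Embedding.
Variables (z : nat -> T) (V : nat).
Hypothesis zI : {in gtn V &, injective z}.

Lemma mem_emb_lab i a : (i < V)%N -> all (gtn V) a -> (z i \in emb z a) = (i \in a).
Proof.
move=> iV /allP aV; rewrite mem_emb; apply/mapP/idP => [[j ja]|ia]; last by exists i.
by move/zI => -> //; exact: aV.
Qed.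

Lemma card_emb a : uniq a -> all (gtn V) a -> #|emb z a| = size a.
Proof.
move=> ua aV; rewrite cardsE -(size_map z); apply/card_uniqP.
by rewrite map_inj_in_uniq // => x y /(allP aV) xV /(allP aV) yV; apply: zI.
Qed.

Lemma emb_del i a j : all (gtn V) (i :: a) -> j \in i :: a ->
  emb z [seq x <- i :: a | x != j] = (z i |: emb z a) :\ z j.
Proof.
move=> iaV ja; rewrite -emb_cons; apply/setP => x; rewrite in_setD1 !mem_emb.
apply/mapP/andP => [[y]|[xj /mapP[y ya xy]]].
  rewrite mem_filter => /andP[yj ya] ->; split; last by apply/mapP; exists y.
  by apply: contra yj => /eqP /zI -> //; apply: (allP iaV).
by exists y => //; rewrite mem_filter ya andbT; apply: contra xj => /eqP <-; rewrite xy.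
Qed.

Lemma sub_emb a b : all (gtn V) a -> all (gtn V) b ->
  (emb z a \subset emb z b) = all (mem b) a.
Proof.
move=> /allP aV bV; apply/subsetP/allP => [H i ia|H x].
  by rewrite /= -(mem_emb_lab (aV _ ia) bV) H // mem_emb map_f.
by rewrite !mem_emb => /mapP[i ia ->]; apply/map_f/H.
Qed.

Lemma sum_emb i a (f : T -> R) : uniq (i :: a) -> all (gtn V) (i :: a) ->
  \sum_(u in z i |: emb z a) f u = \sum_(j <- i :: a) f (z j).
Proof.
move=> ua aV; rewrite -emb_cons -(big_map z predT f) big_uniq.
  by apply: eq_bigl => x; rewrite mem_emb.
by rewrite map_inj_in_uniq // => x y /(allP aV) xV /(allP aV) yV; apply: zI.
Qed.
End Embedding.

(* [flag]: a vertex joined to all vertices of a face spans a face with it;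
   [gauge]: the incidence signs are a coboundary, so closed walks have sign 1. *)
Definition flag Y := forall s v, s \in Y -> s != set0 ->
  (forall x, x \in s -> [set v; x] \in Y) -> v |: s \in Y.

Definition gauge (th : {set T} -> R) Y := forall t v u, t \in Y -> #|t| = k.+2 ->
  v \in t -> u \in t -> inc t (t :\ v) * inc t (t :\ u) = th (t :\ v) * th (t :\ u).

(** [z] realises the state of [tree_walk] inside [T]: the lists in [F] generate [Y], so membership
    in [Y] becomes a test on lists of labels that no longer mentions [T]. *)
Definition labelled z (F : seq (seq nat)) V Y :=
  [/\ {in gtn V &, injective z},
      (forall a, all (gtn V) a -> (emb z a \in Y) = has (fun f => all (mem f) a) F),
      (forall x, x \in vert Y -> exists2 i, (i < V)%N & x = z i)
    & all (all (gtn V)) F].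

(** All neighbours of the new vertex lie in [s], so any simplex through [v] whose edges are present
    is a face of the one just glued; a simplex avoiding [v] is settled in [Y]. *)
Lemma flag_new Y s v : cplx Y -> flag Y -> s \in Y -> v \notin vert Y ->
  flag (Y :|: powerset (v |: s)).
Proof.
move=> cY fl sY vY s' x s'Y s'0 H.
have c' : cplx (Y :|: powerset (v |: s)) by rewrite cplxU ?cplx_powerset.
have inY t : t \in Y :|: powerset (v |: s) -> v \notin t -> t \in Y.
  rewrite inE => /orP[//|]; rewrite powersetE => ts vt; apply: (cplxS cY sY).
  apply/subsetP => y yt; have := subsetP ts _ yt; rewrite !inE => /orP[/eqP yv|//].
  by rewrite -yv yt in vt.
have nbr t y : t \in Y :|: powerset (v |: s) -> v \in t -> y \in t -> y \in v |: s.
  rewrite inE => /orP[tY vt|]; last by rewrite powersetE => /subsetP H1 _; apply: H1.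
  by case/negP: vY; rewrite inE (cplxS cY tY) // sub1set.
case: (boolP (v \in x |: s')) => vxs'.
  rewrite inE; apply/orP; right; rewrite powersetE.
  move: vxs'; rewrite !inE => /orP[/eqP vx|vs'].
    apply/subsetP => y; rewrite in_setU1 => /orP[/eqP ->|ys']; first by rewrite -vx setU11.
    by apply: (nbr _ _ (H _ ys')); rewrite ?vx !inE eqxx ?orbT.
  apply/subsetP => y; rewrite in_setU1 => /orP[/eqP ->|ys'].
    by apply: (nbr _ _ (H _ vs')); rewrite !inE eqxx ?orbT.
  exact: (nbr _ _ s'Y).
move: (vxs'); rewrite !inE negb_or => /andP[vx vs'].
apply/orP; left; apply: fl => //; first exact: inY.
move=> y ys'; apply: inY (H _ ys') _; rewrite !inE negb_or vx /=.
by apply: contra vs' => /eqP ->.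
Qed.

(** Faces of the glued simplex containing [v] are new, so their signs are free; they are transported
    from [s] across [v |: s]. *)
Definition th_new (th : {set T} -> R) v s (x : {set T}) : R :=
  if (v \in x) && (x \subset v |: s) then th s * (inc (v |: s) s * inc (v |: s) x) else th x.

Lemma gauge_new th Y s v : cplx Y -> s \in Y -> #|s| = k.+1 ->
  v \notin vert Y -> v \notin s -> (forall x, th x * th x = 1) ->
  gauge th Y -> gauge (th_new th v s) (Y :|: powerset (v |: s)).
Proof.
move=> cY sY sk vY vs th2 gY t x y tY' tk xt yt.
move: tY'; rewrite inE powersetE => /orP[tY|tvs].
  have vt : v \notin t.
    by apply: contra vY => vt; rewrite inE (cplxS cY tY) // sub1set.
  have vN u : v \in t :\ u = false by rewrite !inE (negPf vt) andbF.
  by rewrite /th_new !vN; apply: gY.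
have {tvs tk} tE : t = v |: s.
  by apply/eqP; rewrite eqEcard tvs tk card_vs ?leqnn.
subst t.
have D u : u \in v |: s -> th_new th v s ((v |: s) :\ u) =
    th s * (inc (v |: s) s * inc (v |: s) ((v |: s) :\ u)).
  move=> us; rewrite /th_new subsetDl andbT !inE eqxx andbT /=.
  case: eqVneq => //= vu; rewrite -vu setU1K // inc_sqr ?mulr1 //.
  exact: subsetUr.
have s2 : inc (v |: s) s * inc (v |: s) s = 1 by rewrite inc_sqr ?subsetUr.
rewrite !D //; set A := inc _ (_ :\ x); set B := inc _ (_ :\ y).
rewrite [RHS](_ : _ = (th s * th s) * (inc (v |: s) s * inc (v |: s) s) * (A * B)); last by ring.
by rewrite th2 s2 !mul1r.
Qed.

Lemma th_new_sqr th v s x : (forall x, th x * th x = 1) ->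
  th_new th v s x * th_new th v s x = 1.
Proof.
move=> th2; rewrite /th_new; case: ifP => [/andP[_ xs]|_]; last exact: th2.
rewrite [LHS](_ : _ = (th s * th s) * (inc (v |: s) s * inc (v |: s) s) *
  (inc (v |: s) x * inc (v |: s) x)); last by ring.
by rewrite th2 !inc_sqr ?subsetUr // !mulr1.
Qed.

Definition znew (z : nat -> T) V v i := if i == V then v else z i.

Lemma emb_znew z V v a : V \notin a -> emb (znew z V v) a = emb z a.
Proof.
move=> Va; apply/setP => x; rewrite !mem_emb; congr (x \in _).
by apply/eq_in_map => i ia; rewrite /znew; case: eqP => // iV; rewrite -iV ia in Va.
Qed.

Lemma labelled_new z F V Y v a : cplx Y -> labelled z F V Y -> all (gtn V) a ->
  emb z a \in Y -> v \notin emb z (iota 0 V) ->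
  labelled (znew z V v) ((V :: a) :: F) V.+1 (Y :|: powerset (v |: emb z a)).
Proof.
move=> cY [zI fY vY Fl] aV aY vZ.
have vz i : (i < V)%N -> z i != v.
  by move=> iV; apply: contra vZ => /eqP <-; rewrite mem_emb map_f // mem_iota.
have Va b : all (gtn V) b -> V \notin b.
  by move=> bV; apply/negP => /(allP bV); rewrite /= ltnn.
have vnY : v \notin vert Y.
  by apply/negP => /vY[i iV vi]; have := vz _ iV; rewrite vi eqxx.
have zI' : {in gtn V.+1 &, injective (znew z V v)}.
  move=> i j; rewrite !inE !ltnS /znew => iV jV.
  case: eqP => [->|/eqP niV]; case: eqP => [->|/eqP njV] //.
  - move=> E; have jV' : (j < V)%N by rewrite ltn_neqAle njV.
    by have := vz _ jV'; rewrite -E eqxx.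
  - move=> E; have iV' : (i < V)%N by rewrite ltn_neqAle niV.
    by have := vz _ iV'; rewrite E eqxx.
  by apply: zI; rewrite inE ltn_neqAle ?niV ?njV.
have Fl' : all (all (gtn V.+1)) ((V :: a) :: F).
  rewrite /= ltnSn /=; apply/andP; split.
    by apply: sub_all aV => x /= /leqW.
  by apply: sub_all Fl => f /=; apply: sub_all => x /= /leqW.
have embVa : emb (znew z V v) (V :: a) = v |: emb z a.
  by rewrite emb_cons emb_znew ?Va // /znew eqxx.
split=> //.
- move=> b bV; rewrite inE powersetE /= -embVa (sub_emb zI') //; last by case/andP: Fl'.
  case: (boolP (V \in b)) => Vb.
    have bF : has (fun f => all (mem f) b) F = false.
      apply/hasP => -[f fF /allP /(_ _ Vb)] /=; apply/negP.
      by apply: Va; apply: (allP Fl).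
    rewrite bF orbF (_ : _ \in Y = false) //; apply: contraNF vnY => bY.
    rewrite inE (cplxS cY bY) // sub1set mem_emb; apply/mapP; exists V => //.
    by rewrite /znew eqxx.
  rewrite emb_znew // fY; first by rewrite orbC.
  apply/allP => x xb.
  have := allP bV _ xb; rewrite /= ltnS leq_eqVlt => /orP[/eqP xV|//].
  by rewrite -xV xb in Vb.
- move=> x; rewrite vertU vert_powerset inE => /orP[/vY[i iV ->]|].
    by exists i; rewrite ?leqW // /znew ltn_eqF.
  rewrite in_setU1 => /orP[/eqP ->|]; first by exists V; rewrite ?ltnSn // /znew eqxx.
  rewrite mem_emb => /mapP[i ia ->]; have := allP aV _ ia => /= iV.
  by exists i; rewrite ?leqW // /znew ltn_eqF.
Qed.

Variables (c eta : R).
Hypothesis c_C : 0 <= c <= C.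
Hypothesis rc_eta : `|#|T|%:R * ext_pr - c| <= eta.
Hypothesis eps_eta : eps <= eta.

(** The four summands are: the inherited error after reusing a known simplex; steps to a known
    vertex along a missing edge; the inherited error after a new vertex; the replacement of the
    total weight of the new vertices by [c]. *)
Fixpoint tree_err m V : R := if m is m'.+1 then
  k.+2%:R * (V%:R * tree_err m' V + V%:R * walk_bound m' V.+1 + C * tree_err m' V.+1 + V.+1%:R * walk_bound m' V.+1)
  else 0.

Lemma tree_err_ge0 m V : 0 <= tree_err m V.
Proof.
have C0 := ltW C_gt0.
by elim: m V => //= m IH V; rewrite mulr_ge0 // !addr_ge0 // mulr_ge0 // walk_boundC_ge0.
Qed.

Lemma labelled_vert z F V Y : labelled z F V Y -> (#|vert Y| <= V)%N.
Proof.
case=> zI _ vY _; rewrite -[leqRHS](size_iota 0) -(card_emb zI) ?iota_uniq //.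
  apply: subset_leq_card; apply/subsetP => x /vY[i iV ->].
  by rewrite mem_emb map_f // mem_iota.
by apply/allP => x; rewrite mem_iota.
Qed.

(** The gauge writes the sign of a step as a product of two values of [th], which are signs
    themselves, so the signs telescope along a walk. The estimate is shared by steps over a known
    simplex and steps over a newly glued one. *)
Lemma gauge_step z V th Y i a a0 (Ph : {set T} -> R) (tw : nat -> R) (B p : R) :
  {in gtn V &, injective z} -> gauge th Y -> (forall x, th x * th x = 1) ->
  uniq (i :: a) -> size a = k.+1 -> all (gtn V) (i :: a) -> z i |: emb z a \in Y ->
  (forall j, j \in i :: a -> `|Ph ((z i |: emb z a) :\ z j) -
      th ((z i |: emb z a) :\ z j) * th (emb z a0) * tw j * p| <= B) ->
  `|\sum_(u in z i |: emb z a) incs (z i) (emb z a) u * Ph ((z i |: emb z a) :\ u) -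
     th (emb z a) * th (emb z a0) * (\sum_(j <- i :: a) tw j) * p| <= k.+2%:R * B.
Proof.
move=> zI gY th2 uia sa iaV tY IH.
have iV : (i < V)%N by case/andP: iaV.
have aV : all (gtn V) a by case/andP: iaV.
have ia : i \notin a by case/andP: uia.
have ck : #|z i |: emb z a| = k.+2.
  by rewrite -emb_cons (card_emb zI) //= sa.
rewrite (sum_emb zI) // mulr_sumr mulr_suml -sumrB.
apply: le_trans (ler_norm_sum _ _ _) _.
rewrite -sa -[(size a).+1]/(size (i :: a)) mulr_natl -sumr_const_seq.
rewrite big_seq [leRHS]big_seq; apply: ler_sum => j ja.
have sE : (z i |: emb z a) :\ z i = emb z a.
  by rewrite setU1K // (mem_emb_lab zI).
have zj : z j \in z i |: emb z a by rewrite -emb_cons mem_emb map_f.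
have := gY _ (z i) (z j) tY ck (setU11 _ _) zj; rewrite sE -/(incs _ _ _) => iE.
set s' := _ :\ z j in iE *.
have -> : th (emb z a) = incs (z i) (emb z a) (z j) * th s'.
  by rewrite iE -mulrA th2 mulr1.
rewrite [X in `|X|](_ : _ = incs (z i) (emb z a) (z j) *
  (Ph s' - th s' * th (emb z a0) * tw j * p)); last by ring.
by rewrite normrM incs_norm mul1r IH.
Qed.

(** The product of the two values of [th] is the sign of any walk from [a] to [a0] in a gauged
    complex; it is 1 for closed walks, but open ends are needed for the induction. *)
Lemma Phi_tree m F V a z Y th a0 : cplx Y -> labelled z F V Y -> flag Y ->
  gauge th Y -> (forall x, th x * th x = 1) ->
  uniq a -> size a = k.+1 -> all (gtn V) a -> emb z a \in Y ->
  uniq a0 -> size a0 = k.+1 -> all (gtn V) a0 ->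
  `|Phi unit_fun m Y (emb z a) (emb z a0)
     - th (emb z a) * th (emb z a0) * tree_walk c m F V a a0 * pr Y|
    <= tree_err m V * (eta * pr Y).
Proof.
have C0 := ltW C_gt0.
have e0 : 0 <= eta.
  apply: le_trans eps_eta; apply: le_trans ext_pr_le_eps; exact/ltW/ext_pr_gt0.
elim: m F V a z Y th => [|m IH] F V a z Y th cY lY fY gY th2 ua sa aV aY ua0 sa0 aV0.
  have zI : {in gtn V &, injective z} by case: lY.
  have -> : Phi unit_fun 0 Y (emb z a) (emb z a0) = (all (mem a0) a)%:R * pr Y.
    have <- : (emb z a == emb z a0) = all (mem a0) a.
      by rewrite eqEcard !(card_emb zI) // sa sa0 leqnn andbT (sub_emb zI).
    by rewrite -ExZ; apply: eq_Ex => X _; rewrite /= mulr1 mulrC.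
  rewrite /= mul0r; case: (boolP (all (mem a0) a)) => H; last by rewrite mul0r mulr0 mul0r subrr normr0.
  have -> : emb z a = emb z a0.
    by apply/eqP; rewrite eqEcard !(card_emb zI) // sa sa0 leqnn andbT (sub_emb zI).
  by rewrite th2 mulr1 subrr normr0.
have [zI embY vY FV] := lY.
set s := emb z a; set s0 := emb z a0; set p := pr Y.
have p0 : 0 <= p := pr_ge0 Y.
have YV := labelled_vert lY.
have sk : #|s| = k.+1 by rewrite (card_emb zI).
set Z := emb z (iota 0 V).
have cZ : #|Z| = V.
  rewrite (card_emb zI) ?iota_uniq ?size_iota //.
  by apply/allP => x; rewrite mem_iota.
have sZ : s \subset Z.
  apply/subsetP => x; rewrite !mem_emb => /mapP[i ia ->]; rewrite map_f // mem_iota.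
  exact: (allP aV).
pose G v := \sum_(u in v |: s)
  incs v s u * Phi unit_fun m (Y :|: powerset (v |: s)) ((v |: s) :\ u) s0.
rewrite [Phi _ _ _ _ _](_ : _ = \sum_(v | v \notin s) G v); last exact: Phi_rec.
pose D i := \sum_(j <- i :: a) tree_walk c m F V [seq x <- i :: a | x != j] a0.
pose hs i := has (fun f => all (mem f) (i :: a)) F.
pose W := \sum_(j <- V :: a)
  tree_walk c m ((V :: a) :: F) V.+1 [seq x <- V :: a | x != j] a0.
have -> : tree_walk c m.+1 F V a a0 =
    \sum_(i <- iota 0 V | i \notin a) (if hs i then D i else 0) + c * W.
  by rewrite /= big_mkcondr.
have -> : \sum_(v | v \notin s) G v =
    \sum_(i <- iota 0 V | i \notin a) G (z i) + \sum_(v in ~: Z) G v.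
  rewrite (bigID (mem Z)) /=; congr (_ + _); last first.
    apply: eq_bigl => v; rewrite [RHS]in_setC andb_idl //.
    by apply: contra; apply: (subsetP sZ).
  transitivity (\sum_(v <- [seq v <- map z (iota 0 V) | v \notin s]) G v).
    rewrite big_uniq /=; last first.
      rewrite filter_uniq // map_inj_in_uniq ?iota_uniq // => x y.
      by rewrite !mem_iota => xV yV; apply: zI.
    by apply: eq_bigl => v; rewrite mem_filter -mem_emb.
  rewrite big_filter big_map big_seq_cond [RHS]big_seq_cond.
  apply: eq_bigl => i; rewrite mem_iota add0n /=; case: (ltnP i V) => //= iV.
  by rewrite (mem_emb_lab zI).
(* Three errors: at known vertices, at new vertices with weight exactly [ext_pr], and in comparing
   the total of these weights with [c]. *)
rewrite [X in `|X|](_ : _ =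
   \sum_(i <- iota 0 V | i \notin a)
      (G (z i) - th s * th s0 * (if hs i then D i else 0) * p)
   + \sum_(v in ~: Z) (G v - th s * th s0 * W * (ext_pr * p))
   + th s * th s0 * W * p * (#|~: Z|%:R * ext_pr - c)); last first.
  rewrite !sumrB -mulr_suml -mulr_sumr sumr_const -mulr_natl; ring.
have thn : `|th s * th s0| = 1.
  have H x : `|th x| = 1.
    apply/eqP; rewrite -(@pexpr_eq1 _ `|th x| 2) // -normrX expr2 th2 normr1 //.
  by rewrite normrM !H mulr1.
rewrite [leRHS](_ : _ =
   V%:R * (k.+2%:R * ((tree_err m V + walk_bound m V.+1) * (eta * p)))
   + C * (k.+2%:R * (tree_err m V.+1 * (eta * p)))
   + k.+2%:R * walk_bound m V.+1 * p * (V.+1%:R * eta)); last by rewrite /=; ring.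
have ep0 : 0 <= eta * p by rewrite mulr_ge0.
have bm0 := walk_boundC_ge0 m V.+1.
have zVs i : (i < V)%N -> i \notin a -> z i \notin s.
  by move=> iV ia; rewrite (mem_emb_lab zI).
apply: le_trans (ler_normD _ _) _; apply: lerD; last first.
  rewrite !normrM -normrM thn mul1r (ger0_norm p0); apply: ler_pM => //.
  - by rewrite mulr_ge0.
  - rewrite ler_wpM2r //.
    apply: le_trans (ler_norm_sum _ _ _) _.
    rewrite -sa -[(size a).+1]/(size (V :: a)) mulr_natl -sumr_const_seq.
    rewrite big_seq [leRHS]big_seq; apply: ler_sum => j ja.
    have Va : V \notin a by apply/negP => /(allP aV); rewrite /= ltnn.
    have uVa : uniq (V :: a) by rewrite /= Va.
    apply: tree_walk_bound => //; rewrite ?filter_uniq ?size_del //.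
    apply/allP => x; rewrite mem_filter inE => /andP[_ /orP[/eqP ->|/(allP aV) /leqW //]].
    by rewrite inE.
  (* The new vertices number V fewer than all of [T]; the V missing weights cost at most [eta] each,
     because [ext_pr] is at most [eps]. *)
  - rewrite cardsCs setCK cZ natrB; last by rewrite -{1}cZ max_card.
    rewrite mulrBl addrAC; apply: le_trans (ler_normB _ _) _.
    rewrite -addn1 natrD mulrDl mul1r [_ * eta + _]addrC lerD //.
    rewrite normrM normr_nat (ger0_norm (ltW ext_pr_gt0)) ler_wpM2l //.
    exact: le_trans ext_pr_le_eps eps_eta.
apply: le_trans (ler_normD _ _) _; apply: lerD; apply: le_trans (ler_norm_sum _ _ _) _.
- rewrite [V%:R * _](_ : _ = \sum_(i <- iota 0 V)
     (k.+2%:R * ((tree_err m V + walk_bound m V.+1) * (eta * p)))); last first.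
    by rewrite sumr_const_seq size_iota mulr_natl.
  rewrite big_mkcond big_seq [leRHS]big_seq; apply: ler_sum => i.
  rewrite mem_iota add0n => /= iV; case: ifP => ia; last first.
    by rewrite mulr_ge0 // mulr_ge0 // addr_ge0 // tree_err_ge0.
  have iaV : all (gtn V) (i :: a) by rewrite /= iV.
  have uia : uniq (i :: a) by rewrite /= ia.
  have hE : hs i = (z i |: s \in Y) by rewrite -emb_cons embY.
  rewrite hE; case: ifP => tY.
    apply: le_trans (_ : k.+2%:R * (tree_err m V * (eta * p)) <= _); last first.
      by rewrite ler_wpM2l // ler_wpM2r // lerDl.
    have YE : Y :|: powerset (z i |: s) = Y.
      by apply/setUidPl; rewrite powerset_subP.
    rewrite /G YE; apply: (gauge_step (Y := Y) (Ph := fun x => Phi unit_fun m Y x s0) zI) => // j ja.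
    rewrite -(emb_del zI) //; apply: IH => //; rewrite ?filter_uniq ?size_del //.
      by apply/allP => x; rewrite mem_filter => /andP[_ /(allP iaV)].
    by rewrite (emb_del zI) //; apply: (cplxS cY tY); rewrite subsetDl.
  rewrite mulr0 mul0r subr0.
  apply: le_trans (_ : k.+2%:R * (walk_bound m V.+1 * (eta * p)) <= _); last first.
    by rewrite ler_wpM2l // ler_wpM2r // lerDr tree_err_ge0.
  (* Flagness turns the missing simplex into a missing edge, as [step_cross] requires. *)
  have [x xs xY] : exists2 x, x \in s & [set z i; x] \notin Y.
    apply/exists_inP; apply: contraFT tY => /exists_inPn H.
    apply: fY => //; first by rewrite -card_gt0 sk.
    by move=> x xs; have := H x xs; rewrite negbK.
  apply: sum_incs_le => [||u uts]; rewrite ?zVs //.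
  apply: le_trans (Phi1_le (V := V.+1) _ _ _ _ _ _) _;
    rewrite ?card_step ?mem_step ?vert_step ?cplxU ?cplx_powerset ?zVs //.
  rewrite ler_wpM2l //; apply: le_trans (step_cross cY sk _ xs xY) _; rewrite ?zVs //.
  by rewrite ler_wpM2r.
rewrite [X in C * X](_ : _ = k.+2%:R * tree_err m V.+1 * eta * p); last by ring.
apply: le_trans (sum_new_le (~: Z) _); last by rewrite !mulr_ge0 // tree_err_ge0.
apply: ler_sum => v; rewrite inE => vZ.
have vs : v \notin s by apply: contra vZ; apply: (subsetP sZ).
have vnY : v \notin vert Y.
  apply: contra vZ => /vY[i iV ->]; rewrite mem_emb map_f // mem_iota //.
have lY' := labelled_new cY lY aV aY vZ.
have fY' := flag_new cY fY aY vnY.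
have gY' := gauge_new cY aY sk vnY vs th2 gY.
have th2' x := th_new_sqr v s x th2.
set th' := th_new th v s in gY' th2'.
set Y' := Y :|: _ in lY' fY' gY'.
set z' := znew z V v in lY'.
have Va : V \notin a by apply/negP => /(allP aV); rewrite /= ltnn.
have Va0 : V \notin a0 by apply/negP => /(allP aV0); rewrite /= ltnn.
have ths : th' s = th s by rewrite /th' /th_new (negPf vs).
have vs0 : v \notin s0.
  apply: contra vZ; rewrite !mem_emb => /mapP[i ia ->]; rewrite map_f // mem_iota.
  exact: (allP aV0).
have ths0 : th' s0 = th s0 by rewrite /th' /th_new (negPf vs0).
have z's : emb z' a = s by rewrite emb_znew.
have z's0 : emb z' a0 = s0 by rewrite emb_znew.
have z'V : z' V = v by rewrite /z' /znew eqxx.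
have zI' : {in gtn V.+1 &, injective z'} by case: lY'.
have VaV : all (gtn V.+1) (V :: a).
  by rewrite /= ltnSn; apply: sub_all aV => x /= /leqW.
have aV0' : all (gtn V.+1) a0 by apply: sub_all aV0 => x /= /leqW.
have uVa : uniq (V :: a) by rewrite /= Va.
have tY' : v |: s \in Y' by rewrite !inE subxx orbT.
have cY' : cplx Y' by rewrite cplxU ?cplx_powerset.
have pY' : pr Y' = ext_pr * p := step_new cY aY sk vs vnY.
rewrite [leRHS](_ : _ = k.+2%:R * (tree_err m V.+1 * (eta * (ext_pr * p)))); last by ring.
rewrite -ths -ths0 /G -pY' -/Y' -z's -z's0 -{1 2 3}z'V.
apply: (gauge_step (Y := Y') (Ph := fun x => Phi unit_fun m Y' x (emb z' a0)) zI') => //.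
  by rewrite z'V z's.
move=> j ja; rewrite -(emb_del zI') //; apply: IH => //; rewrite ?filter_uniq ?size_del //.
  by apply/allP => x; rewrite mem_filter => /andP[_ /(allP VaV)].
by rewrite (emb_del zI') // z's z'V; apply: (cplxS cY' tY'); rewrite subsetDl.
Qed.

(** * Mean and variance of the traces *)

Definition trace_walk m X : R := \sum_(s : {set T} | #|s| == k.+1) (s \in X)%:R * walk m X s s.
Definition mean_faces : R := 'C(#|T|, k.+1)%:R * Q k.+1.

Lemma Ex_trace_walk H m : Ex (fun X => trace_walk m X * H X) =
  \sum_(s : {set T} | #|s| == k.+1) Phi H m (powerset s) s s.
Proof.
rewrite -Ex_sum; apply: eq_Ex => X cX; rewrite mulr_suml; apply: eq_bigr => s _.
by rewrite powerset_subP // mulrA.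
Qed.

Lemma sum_simplices (x : R) : \sum_(s : {set T} | #|s| == k.+1) x = 'C(#|T|, k.+1)%:R * x.
Proof. by rewrite sumr_const mulr_natl -card_draws cardsE. Qed.

Lemma sum_simplices_le (f : {set T} -> R) b :
  (forall s, #|s| = k.+1 -> `|f s| <= b * Q k.+1) ->
  `|\sum_(s : {set T} | #|s| == k.+1) f s| <= b * mean_faces.
Proof.
move=> H; apply: le_trans (ler_norm_sum _ _ _) _.
rewrite /mean_faces mulrCA -sum_simplices; apply: ler_sum => s /eqP; exact: H.
Qed.

(** A lone k-simplex contains no (k+1)-simplex, so the constant gauge 1 is admissible, and any
    enumeration of its vertices is a labelling. *)
Lemma Phi_start m s : #|s| = k.+1 ->
  `|Phi unit_fun m (powerset s) s s - moment k c m * Q k.+1| <= tree_err m k.+1 * eta * Q k.+1.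
Proof.
move=> sk; have [x0 x0s] : exists x, x \in s by apply/card_gt0P; rewrite sk.
pose z i := nth x0 (enum s) i.
have ss : size (enum s) = k.+1 by rewrite -cardE.
have aV : all (gtn k.+1) (iota 0 k.+1) by apply/allP => x; rewrite mem_iota.
have zE : emb z (iota 0 k.+1) = s.
  apply/setP => x; rewrite mem_emb -[RHS]mem_enum.
  by rewrite -ss map_nth_iota0 // take_size.
have zI : {in gtn k.+1 &, injective z}.
  move=> i j; rewrite !inE => iV jV /eqP.
  by rewrite /z nth_uniq ?enum_uniq ?ss // => /eqP.
have := Phi_tree (F := [:: iota 0 k.+1]) (V := k.+1) (a := iota 0 k.+1) (z := z)
  (Y := powerset s) (th := fun=> 1) (a0 := iota 0 k.+1) m.
rewrite zE pr_hom sk !mulr1 mul1r mulrA; apply=> //.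
- exact: cplx_powerset.
- split=> //=; last by rewrite andbT.
    by move=> a aV'; rewrite orbF powersetE -zE (sub_emb zI).
  move=> x; rewrite vert_powerset -zE mem_emb => /mapP[i]; rewrite mem_iota => iV ->.
  by exists i.
- move=> u v; rewrite powersetE => us /set0Pn[y yu] H.
  have := H y yu; rewrite !powersetE !subUset !sub1set us => /andP[-> _] //.
- move=> t v u; rewrite powersetE => /subset_leq_card; rewrite sk => H tk.
  by rewrite tk ltnn in H.
- by rewrite iota_uniq.
- by rewrite size_iota.
- by rewrite powersetE.
- by rewrite iota_uniq.
- by rewrite size_iota.
Qed.

Lemma Ex_trace_walk_approx m : `|Ex (trace_walk m) - mean_faces * moment k c m| <= tree_err m k.+1 * eta * mean_faces.
Proof.
have -> : Ex (trace_walk m) = \sum_(s : {set T} | #|s| == k.+1) Phi unit_fun m (powerset s) s s.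
  by rewrite -Ex_trace_walk; apply: eq_Ex => X _; rewrite mulr1.
rewrite /mean_faces -mulrA -sum_simplices -sumrB; apply: sum_simplices_le => s sk.
by rewrite (mulrC (Q _)); apply: Phi_start.
Qed.

Lemma bin_leq_exp n m : ('C(n, m) <= n ^ m)%N.
Proof.
apply: leq_trans (_ : n ^_ m <= _)%N; first by rewrite -bin_ffact leq_pmulr ?fact_gt0.
elim: m n => [|m IH] n; first by rewrite ffactn0.
rewrite ffactnS expnS leq_mul //; apply: leq_trans (IH _) _.
by case: m {IH} => // m; rewrite leq_exp2r ?leq_pred.
Qed.

(** Such a set is determined by its part outside [D], which has m - |D| elements. *)
Lemma card_trace (A D : {set T}) m :
  (#|[set s : {set T} | (#|s| == m) && (s :&: A == D)]| <= #|T| ^ (m - #|D|))%N.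
Proof.
apply: leq_trans (bin_leq_exp _ _); rewrite -card_draws.
rewrite -(card_in_imset (f := fun s => s :\: D)).
  apply: subset_leq_card; apply/subsetP => u /imsetP[s].
  rewrite !inE => /andP[/eqP <- /eqP sD] ->; rewrite cardsD.
  by rewrite (setIidPr _) // -sD subsetIl.
move=> s t; rewrite !inE => /andP[_ /eqP sD] /andP[_ /eqP tD] E.
rewrite -(setID s D) -(setID t D) E; congr (_ :|: _).
have Ds : D \subset s by rewrite -sD subsetIl.
have Dt : D \subset t by rewrite -tD subsetIl.
by rewrite (setIidPr Ds) (setIidPr Dt).
Qed.

Hypothesis eta_meet : forall j, (0 < j <= k.+1)%N ->
  #|T|%:R ^+ (k.+1 - j) <= eta * Q j * 'C(#|T|, k.+1)%:R.

(** The simplices are sorted by their trace D on [A], with at most 2^V values. For nonempty D there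
    are at most n^(k+1-|D|) of them, and [eta_meet] says that this number divided by Q |D| is a
    small proportion of all vertex sets of size k+1. *)
Lemma sum_meet_le (A : {set T}) V : (#|A| <= V)%N ->
  \sum_(s : {set T} | (#|s| == k.+1) && (s :&: A != set0)) (Q #|s :&: A|)^-1
    <= 2 ^+ V * (eta * 'C(#|T|, k.+1)%:R).
Proof.
move=> AV; have e0 : 0 <= eta.
  apply: le_trans eps_eta; apply: le_trans ext_pr_le_eps; exact/ltW/ext_pr_gt0.
have ec : 0 <= eta * 'C(#|T|, k.+1)%:R by rewrite mulr_ge0.
rewrite (partition_big (fun s => s :&: A) (mem (powerset A))) /=; last first.
  by move=> s _; rewrite powersetE subsetIr.
apply: (@le_trans _ _ (\sum_(D in powerset A) eta * 'C(#|T|, k.+1)%:R)); last first.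
  rewrite sumr_const -[leLHS]mulr_natl card_powerset natrX ler_wpM2r //.
  by rewrite ler_weXn2l // ler1n.
apply: ler_sum => D DA.
rewrite (eq_bigl (fun s : {set T} => (D != set0) &&
    (s \in [set s : {set T} | (#|s| == k.+1) && (s :&: A == D)]))); last first.
  move=> s; rewrite inE -andbA andbCA; case: (s :&: A =P D) => [->|]; rewrite ?andbF //.
case: (boolP (D != set0)) => D0; last by rewrite big_pred0.
rewrite (eq_bigr (fun=> (Q #|D|)^-1)); last by move=> s /=; rewrite inE => /andP[_ /eqP ->].
rewrite /= sumr_const -[leLHS]mulr_natl.
have D1 : (0 < #|D|)%N by rewrite card_gt0.
case: (leqP #|D| k.+1) => Dk.
  have QD : 0 < Q #|D| by rewrite Q_gt0 // leqW.
  rewrite ler_pdivrMr // mulrAC; apply: le_trans (eta_meet _); rewrite ?D1 //.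
  by rewrite -natrX ler_nat card_trace.
rewrite (_ : [set _ | _] = set0) ?cards0 ?mul0r //.
apply/setP => s; rewrite !inE; apply/andP => -[/eqP sk /eqP sD].
by move: (subset_leq_card (subsetIl s A)); rewrite sD sk leqNgt Dk.
Qed.

Definition cov_bound m V : R := decor_bound m (V + k.+1) + 2 ^+ V * (2 * walk_bound m (V + k.+1)).

(** The presence of [Y] barely shifts the mean trace: walks started away from [Y] decorrelate by
    [Phi_disj], and those started at a simplex touching [Y] are few by [sum_meet_le]. *)
Lemma cov_bound_le m V Y : cplx Y -> (#|vert Y| <= V)%N ->
  `|Ex (fun X => (Y \subset X)%:R * (trace_walk m X - Ex (trace_walk m)))| <= cov_bound m V * (eta * mean_faces) * pr Y.
Proof.
move=> cY YV.
have e0 : 0 <= eta.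
  apply: le_trans eps_eta; apply: le_trans ext_pr_le_eps; exact/ltW/ext_pr_gt0.
have Yle W : (#|vert Y| <= V + W)%N by rewrite (leq_trans YV) // leq_addr.
have -> : Ex (fun X => (Y \subset X)%:R * (trace_walk m X - Ex (trace_walk m))) =
    \sum_(s : {set T} | #|s| == k.+1)
      (Phi unit_fun m (Y :|: powerset s) s s - pr Y * Phi unit_fun m (powerset s) s s).
  rewrite sumrB -mulr_sumr.
  rewrite (_ : Ex _ = Ex (fun X => (Y \subset X)%:R * trace_walk m X + - Ex (trace_walk m) * (Y \subset X)%:R));
    last by apply: eq_Ex => X _; ring.
  rewrite ExD ExZ mulNr (mulrC (Ex (trace_walk m))); congr (_ - _ * _).
    rewrite -Ex_sum; apply: eq_Ex => X cX; rewrite mulr_sumr; apply: eq_bigr => s _.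
    by rewrite subUset powerset_subP // -mulnb natrM mulr1 !mulrA.
  by rewrite -Ex_trace_walk; apply: eq_Ex => X _; rewrite mulr1.
rewrite (bigID (fun s : {set T} => s :&: vert Y != set0)) /= addrC.
apply: le_trans (ler_normD _ _) _; rewrite /cov_bound mulrDl mulrDl; apply: lerD.
  apply: le_trans (ler_norm_sum _ _ _) _.
  apply: (@le_trans _ _ (\sum_(s : {set T} | #|s| == k.+1)
     decor_bound m (V + k.+1) * (eta * (pr Y * Q k.+1)))); last first.
    by rewrite sum_simplices le_eqVlt; apply/orP; left; apply/eqP; rewrite /mean_faces; ring.
  rewrite big_mkcondr /=; apply: ler_sum => s /eqP sk; case: ifP; last first.
    by move=> _; rewrite mulr_ge0 ?decor_bound_ge0 // mulr_ge0 // mulr_ge0 ?pr_ge0 // ltW // Q_gt0.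
  rewrite negbK setIC => /eqP sY.
  apply: le_trans (Phi_disj (V := V + k.+1) _ _ cY (cplx_powerset s) _ _ sk _ _) _.
  - by rewrite vert_powerset -setI_eq0 sY.
  - by rewrite powersetE.
  - exact: Yle.
  - by rewrite vert_powerset sk leq_addl.
  rewrite ler_wpM2l ?decor_bound_ge0 // pr_hom sk ler_wpM2r // mulr_ge0 ?pr_ge0 //.
  exact/ltW/Q_gt0.
apply: le_trans (ler_norm_sum _ _ _) _.
have B0 := walk_boundC_ge0 m (V + k.+1).
have q0 : 0 < Q k.+1 by rewrite Q_gt0.
apply: (@le_trans _ _ (\sum_(s : {set T} | (#|s| == k.+1) && (s :&: vert Y != set0))
     (2 * walk_bound m (V + k.+1) * pr Y * Q k.+1) * (Q #|s :&: vert Y|)^-1)); last first.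
  rewrite -mulr_sumr.
  have -> : 2 ^+ V * (2 * walk_bound m (V + k.+1)) * (eta * mean_faces) * pr Y =
    (2 * walk_bound m (V + k.+1) * pr Y * Q k.+1) * (2 ^+ V * (eta * 'C(#|T|, k.+1)%:R)).
    by rewrite /mean_faces; ring.
  by rewrite ler_wpM2l ?sum_meet_le // !mulr_ge0 ?pr_ge0 // ltW.
apply: ler_sum => s /andP[/eqP sk sY].
apply: le_trans (ler_normB _ _) _.
have Qm : 0 < Q #|s :&: vert Y|.
  by rewrite Q_gt0 // -sk leqW // subset_leq_card // subsetIl.
have -> : 2 * walk_bound m (V + k.+1) * pr Y * Q k.+1 / Q #|s :&: vert Y| =
  walk_bound m (V + k.+1) * (pr Y * Q k.+1 / Q #|s :&: vert Y|) +
  walk_bound m (V + k.+1) * (pr Y * Q k.+1 / Q #|s :&: vert Y|) by ring.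
apply: lerD.
  apply: le_trans (Phi1_le (V := V + k.+1) _ _ _ _ sk _) _.
  - by rewrite cplxU ?cplx_powerset.
  - by rewrite !inE subxx orbT.
  - rewrite vertU vert_powerset (leq_trans (leq_card_setU _ _)) // sk leq_add2r //.
  by rewrite ler_wpM2l // pr_add_simplex.
rewrite normrM (ger0_norm (pr_ge0 _)).
apply: (@le_trans _ _ (pr Y * (walk_bound m (V + k.+1) * Q k.+1))).
  rewrite ler_wpM2l ?pr_ge0 // -sk -pr_hom.
  by apply: Phi1_le; rewrite ?cplx_powerset ?powersetE // vert_powerset sk leq_addl.
rewrite mulrCA ler_wpM2l // ler_peMr ?mulr_ge0 ?pr_ge0 ?(ltW q0) //.
by rewrite invf_ge1 // -pr_hom pr_le1 ?cplx_powerset.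
Qed.

Definition var_const m : R := walk_bound m k.+1 * cov_bound m (k.+1 + m) + tree_err m k.+1 ^+ 2.

(** The mean of trace times centred trace is a sum of [Phi] with the centred trace as weight, and
    [cov_bound_le] is precisely the hypothesis on that weight in [Phi_le]. The squared bias adds a
    term in eta^2, absorbed by [eta <= 1]. *)
Lemma var_trace_walk m : eta <= 1 ->
  Ex (fun X => (trace_walk m X - mean_faces * moment k c m) ^+ 2) <= var_const m * eta * mean_faces ^+ 2.
Proof.
move=> e1.
have e0 : 0 <= eta.
  apply: le_trans eps_eta; apply: le_trans ext_pr_le_eps; exact/ltW/ext_pr_gt0.
have q0 : 0 < Q k.+1 by rewrite Q_gt0.
have a0 : 0 <= mean_faces by rewrite mulr_ge0 // ltW.
pose tau := Ex (trace_walk m); pose H X := trace_walk m X - tau.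
have EH : Ex H = 0.
  rewrite (_ : Ex H = Ex (fun X => trace_walk m X + - tau * 1)); last first.
    by apply: eq_Ex => X _; rewrite mulr1.
  by rewrite ExD ExZ Ex1 mulr1 subrr.
have -> : Ex (fun X => (trace_walk m X - mean_faces * moment k c m) ^+ 2) =
   Ex (fun X => trace_walk m X * H X) + (tau - mean_faces * moment k c m) ^+ 2.
  set b := mean_faces * _.
  rewrite (_ : Ex _ = Ex (fun X => trace_walk m X * H X +
     ((tau - 2 * b) * H X + (tau - b) ^+ 2 * 1))); last first.
    by apply: eq_Ex => X _; rewrite /H; ring.
  by rewrite !ExD !ExZ EH Ex1 mulr0 add0r mulr1.
rewrite /var_const !mulrDl; apply: lerD.
  rewrite Ex_trace_walk; apply: le_trans (ler_norm _) _.
  rewrite expr2 mulrA; apply: sum_simplices_le => s sk.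
  have h0 : 0 <= cov_bound m (k.+1 + m) * (eta * mean_faces).
    apply: mulr_ge0; last exact: mulr_ge0.
    apply: addr_ge0 (decor_bound_ge0 _ _) _; apply: mulr_ge0; first exact: exprn_ge0.
    exact: mulr_ge0 (ler0n _ _) (walk_boundC_ge0 _ _).
  have := Phi_le (H := H) (m := m) (V := k.+1) (Y := powerset s) (s := s) s h0.
  rewrite pr_hom sk => /(_ _ (cplx_powerset s) _ erefl _).
  rewrite powersetE vert_powerset sk subxx leqnn => /(_ _ isT isT) HH.
  apply: le_trans (HH _) _; last by rewrite le_eqVlt; apply/orP; left; apply/eqP; ring.
  by move=> Y cY YV; apply: cov_bound_le.
have := Ex_trace_walk_approx m; rewrite -/tau => HH.
rewrite -real_normK ?num_real //.
apply: (@le_trans _ _ ((tree_err m k.+1 * eta * mean_faces) ^+ 2)).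
  have E0 := mulr_ge0 (mulr_ge0 (tree_err_ge0 m k.+1) e0) a0.
  by rewrite lerXn2r // nnegrE.
rewrite 2!exprMn; apply: ler_wpM2r; first exact: exprn_ge0.
apply: ler_wpM2l; first exact: exprn_ge0 _ (tree_err_ge0 _ _).
by rewrite expr2 ler_piMl.
Qed.
End Weights.

(** * Decay of eps *)

(** Each factor n - i of the falling factorial is at least n / 2. *)
Lemma pow_le_bin n k : (2 * k.+1 <= n)%N -> (n ^ k.+1 <= 2 ^ k.+1 * (k.+1)`! * 'C(n, k.+1))%N.
Proof.
move=> nk; rewrite -mulnA [(_`! * _)%N]mulnC bin_ffact ffact_prod.
have Hc x : (x ^ k.+1 = \prod_(i < k.+1) x)%N by rewrite prod_nat_const card_ord.
by rewrite !Hc -big_split /=; apply: leq_prod => i _; have := ltn_ord i; lia.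
Qed.

Section Density.
Variables (R : realFieldType) (T : finType) (w : {set {set T}} -> R) (Q : nat -> R).
Implicit Types (X Y : {set {set T}}) (s t : {set T}).
Hypothesis w_ge0 : forall X, 0 <= w X.
Hypothesis w_cplx : forall X, ~~ cplx X -> w X = 0.
Hypothesis pr_indep : forall Y1 Y2, cplx Y1 -> cplx Y2 ->
  pr w (Y1 :|: Y2) * pr w (Y1 :&: Y2) = pr w Y1 * pr w Y2.
Hypothesis pr_hom : forall s, pr w (powerset s) = Q #|s|.
Hypothesis Q0 : Q 0 = 1.
Variable k : nat.
Hypothesis Qpos : 0 < Q k.+2.
Hypothesis kT : (k.+2 <= #|T|)%N.

Let Q_gt0 i : (i <= k.+2)%N -> 0 < Q i.
Proof. exact: (Q_gt0 w_ge0 w_cplx pr_hom Qpos kT). Qed.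

Lemma exists_simplex j : (j <= k.+2)%N -> exists s : {set T}, #|s| = j.
Proof.
move=> jk; have : (0 < #|[set s : {set T} | #|s| == j]|)%N.
  by rewrite card_draws bin_gt0 (leq_trans jk).
by case/card_gt0P => s; rewrite inE => /eqP; exists s.
Qed.

(* Lifts the situation defining [eps Q j.+1] to the link of an extra vertex u. *)
Lemma eps_antimono j : (j < k)%N -> eps Q j.+1 <= eps Q j.
Proof.
move=> jk; have [t tj] := exists_simplex (j := j.+3) jk.
have [u ut] : exists u, u \in t by apply/card_gt0P; rewrite tj.
have c1 : #|t :\ u| = j.+2 by move: (cardsD1 u t); rewrite ut tj => -[].
have [v vt1] : exists v, v \in t :\ u by apply/card_gt0P; rewrite c1.
have c2 : #|t :\ u :\ v| = j.+1 by move: (cardsD1 v (t :\ u)); rewrite vt1 c1 => -[].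
have [x xt2] : exists x, x \in t :\ u :\ v by apply/card_gt0P; rewrite c2.
move: (vt1) (xt2); rewrite !inE => /andP[vu vt] /and3P[xv xu xt].
have cv : #|t :\ v| = j.+2 by move: (cardsD1 v t); rewrite vt tj => -[].
have cx : #|t :\ x| = j.+2 by move: (cardsD1 x t); rewrite xt tj => -[].
have cvx : #|(t :\ v) :&: (t :\ x)| = j.+1.
  have -> : (t :\ v) :&: (t :\ x) = (t :\ v) :\ x.
    by apply/setP => y; rewrite !inE; case: (y == x); case: (y == v); case: (y \in t).
  by move: (cardsD1 x (t :\ v)); rewrite !inE xv xt cv => -[].
pose Y := powerset (t :\ v) :|: powerset (t :\ x).
have cY : cplx Y by rewrite cplxU ?cplx_powerset.
have Q1 : 0 < Q j.+1 by apply/Q_gt0/leqW/leqW.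
have Q2 : 0 < Q j.+2 by apply/Q_gt0/leqW.
have := pr_indep (cplx_powerset (t :\ v)) (cplx_powerset (t :\ x)).
rewrite -powersetI !pr_hom cv cx cvx -/Y => pY.
have vs : v \notin t :\ u :\ v by rewrite !inE eqxx.
have vxY : [set v; x] \notin Y.
  by rewrite !inE !subUset !sub1set !inE !eqxx !andbF.
have jT : (j.+2 <= #|T|)%N by apply: leq_trans kT; apply: leqW.
have le1 := step_cross w_ge0 w_cplx pr_indep pr_hom Q2 jT cY c2 vs xt2 vxY.
have le2 : Q j.+3 <= pr w (Y :|: powerset (v |: t :\ u :\ v)).
  rewrite -tj -pr_hom pr_mono // !subUset !powersetS subsetDl subsetDl /=.
  by rewrite subUset sub1set vt (subset_trans (subsetDl _ _)) // subsetDl.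
have {le1 le2} le := le_trans le2 le1.
rewrite {1}/eps ler_pdivrMr ?exprn_gt0 // -(ler_pM2r Q1) in le *.
by apply: le_trans le _; rewrite [Q j.+2 ^+ 2]expr2 -pY mulrA.
Qed.

Lemma eps_le i j : (i <= j <= k)%N -> eps Q j <= eps Q i.
Proof.
elim: j => [|j IH]; first by rewrite leqn0 andbT => /eqP ->.
rewrite leq_eqVlt => /andP[/orP[/eqP -> //|ij] jk].
apply: le_trans (eps_antimono jk) _; apply: IH.
by rewrite (ltnW jk) andbT.
Qed.

Let ratio j := Q j.+1 / Q j.

Let Qk : 0 < Q k. Proof. exact/Q_gt0/leqW/leqnSn. Qed.
Let Qk1 : 0 < Q k.+1. Proof. exact/Q_gt0/leqnSn. Qed.

Lemma eps_gt0 : 0 < eps Q k.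
Proof. by rewrite /eps divr_gt0 ?exprn_gt0 ?mulr_gt0. Qed.

Let eps_ge0 := ltW eps_gt0.

Let ratio_ge0 j : (j <= k)%N -> 0 <= ratio j.
Proof. by move=> jk; rewrite divr_ge0 // ltW // Q_gt0 // leqW // leqW. Qed.

Lemma ratio_eps j : (j <= k)%N -> ratio j * eps Q j = ratio j.+1.
Proof.
move=> jk; rewrite /ratio /eps; field.
by rewrite !gt_eqF // Q_gt0 //; lia.
Qed.

(** At j = 0 the bound says that an edge requires its two vertices, whose presences are independent;
    monotonicity does the rest. *)
Lemma eps_le1 j : (j <= k)%N -> eps Q j <= 1.
Proof.
move=> jk; apply: le_trans (eps_le (i := 0) _) _; first by rewrite leq0n.
rewrite /eps Q0 mulr1 ler_pdivrMr ?exprn_gt0 ?Q_gt0 // mul1r.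
have [t t2] := exists_simplex (j := 2) isT.
have [v vt] : exists v, v \in t by apply/card_gt0P; rewrite t2.
have c1 : #|t :\ v| = 1%N by move: (cardsD1 v t); rewrite vt t2 => -[].
have := pr_disj pr_indep pr_hom Q0 (cplx_powerset (t :\ v)) (cplx_powerset [set v]).
rewrite !vert_powerset disjoint_sym disjoints1 !inE eqxx /= => /(_ isT).
rewrite !pr_hom c1 cards1 expr2 => <-; rewrite -t2 -pr_hom pr_mono //.
by rewrite subUset !powersetS subsetDl sub1set vt.
Qed.

Let ratio_anti i j : (i <= j <= k)%N -> ratio j <= ratio i.
Proof.
elim: j => [|j IH]; first by rewrite leqn0 andbT => /eqP ->.
rewrite leq_eqVlt => /andP[/orP[/eqP -> //|ij] jk].
apply: le_trans (_ : ratio j <= _); last by apply: IH; rewrite (ltnW jk) andbT.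
rewrite -ratio_eps ?(ltnW jk) // ler_piMr ?eps_le1 ?(ltnW jk) //.
exact/ratio_ge0/ltnW.
Qed.

(** [ratio k.+1] is [ratio j] times the product of [eps Q i] over j <= i <= k, and each factor is at
    least [eps Q k]. *)
Lemma ratio_le j : (j <= k)%N -> ratio j * eps Q k ^+ (k.+1 - j) <= ratio k.+1.
Proof.
elim: {j}(k - j)%N {-2}j (erefl (k - j)%N) => [|d IH] j dE jk.
  have -> : j = k by lia.
  by rewrite subSnn expr1 ratio_eps.
have -> : (k.+1 - j)%N = (k.+1 - j.+1).+1 by lia.
have jk1 : (j < k)%N by lia.
apply: le_trans (IH j.+1 _ jk1); last by lia.
rewrite exprS mulrA ler_wpM2r ?exprn_ge0 ?eps_ge0 // -ratio_eps //.
rewrite ler_wpM2l ?eps_le ?jk ?leqnn //.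
exact: ratio_ge0.
Qed.

(** Q (k+1) is the product of k+1 ratios, each at most [ext_pr] divided by the (k+1)-st power of
    [eps]. For i > 0 a smaller power would do; the uniform one keeps the exponent simple. *)
Lemma eps_small C : #|T|%:R * ext_pr Q k <= C ->
  #|T|%:R ^+ k.+1 * Q k.+1 * eps Q k ^+ (k.+1 * k.+1) <= C ^+ k.+1.
Proof.
move=> rC; have e0 := eps_ge0; have e1 := eps_le1 (leqnn k).
have H i : (i <= k.+1)%N -> #|T|%:R ^+ i * Q i * eps Q k ^+ (k.+1 * i) <= C ^+ i.
  elim: i => [|i IH] ik; first by rewrite Q0 muln0 !expr0 !mul1r.
  have Qi : 0 < Q i by apply/Q_gt0/leqW/ltnW.
  have Qi1 : 0 < Q i.+1 by apply/Q_gt0/leqW.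
  rewrite [leLHS](_ : _ = (#|T|%:R ^+ i * Q i * eps Q k ^+ (k.+1 * i)) *
     (#|T|%:R * (ratio i * eps Q k ^+ k.+1))); last first.
    rewrite mulnS exprD exprS /ratio; field.
    by rewrite gt_eqF.
  have r0 : 0 <= ratio i by rewrite divr_ge0 // ltW.
  rewrite [C ^+ _]exprSr; apply: ler_pM.
  - by apply: mulr_ge0; [apply: mulr_ge0; [exact: exprn_ge0|exact: ltW]|exact: exprn_ge0].
  - by apply: mulr_ge0 => //; apply: mulr_ge0 => //; exact: exprn_ge0.
  - exact: IH (ltnW ik).
  apply: le_trans rC; rewrite ler_wpM2l // -[ext_pr Q k]/(ratio k.+1).
  apply: le_trans (ratio_le (j := i) _); last exact: ik.
  rewrite ler_wpM2l // ler_wiXn2l // leq_subr //.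
exact: H.
Qed.

(** n times [ratio k] is n [ext_pr] divided by [eps], hence at least c / (2 eps), which is at least
    1. Ratios at lower indices are larger, so n^j Q j is at least c / (2 eps) for all j >= 1. The
    factor 2^(k+1) (k+1)! comes from [pow_le_bin], the other 2 / c from c / 2. *)
Lemma meet_small c j : 0 < c -> (2 * k.+1 <= #|T|)%N -> c / 2 <= #|T|%:R * ext_pr Q k ->
  eps Q k <= c / 2 -> (0 < j <= k.+1)%N ->
  #|T|%:R ^+ (k.+1 - j) <=
    (eps Q k * (2 ^+ k.+2 * (k.+1)`!%:R / c)) * Q j * 'C(#|T|, k.+1)%:R.
Proof.
move=> c0 nk nrr epsc /andP[j0 jk].
have e0 := eps_gt0.
have e1 := eps_le1 (leqnn k).
have n0 : 0 < #|T|%:R :> R by rewrite ltr0n (leq_trans _ kT).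
have rk : c / 2 / eps Q k <= #|T|%:R * ratio k.
  by rewrite ler_pdivrMr // -mulrA ratio_eps.
have r1 i : (i <= k)%N -> ratio k <= ratio i by move=> ik; rewrite ratio_anti // ik leqnn.
have b1 : 1 <= c / 2 / eps Q k by rewrite ler_pdivlMr // mul1r.
have nQ i : (i <= k.+1)%N -> (#|T|%:R * ratio k) ^+ i <= #|T|%:R ^+ i * Q i.
  elim: i => [|i IH] ik; first by rewrite Q0 !expr0 mulr1.
  have Qi : 0 < Q i by apply/Q_gt0/leqW/ltnW.
  have -> : #|T|%:R ^+ i.+1 * Q i.+1 = #|T|%:R ^+ i * Q i * (#|T|%:R * ratio i).
    by rewrite exprS /ratio; field; rewrite gt_eqF.
  have rk0 : 0 <= ratio k by rewrite /ratio divr_ge0 ?ltW.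
  rewrite [(_ * ratio k) ^+ _]exprSr; apply: ler_pM.
  - by apply: exprn_ge0; apply: mulr_ge0.
  - exact: mulr_ge0.
  - exact: IH (ltnW ik).
  - by rewrite ler_wpM2l // r1.
have Qj : 0 < Q j by apply/Q_gt0/leqW.
have nj : c / 2 / eps Q k <= #|T|%:R ^+ j * Q j.
  apply: le_trans (nQ j jk); have rk' := le_trans b1 rk; apply: (le_trans rk).
  by rewrite -[leLHS]expr1; apply: ler_weXn2l => //; exact: rk'.
have binl : #|T|%:R ^+ k.+1 <= 2 ^+ k.+1 * (k.+1)`!%:R * 'C(#|T|, k.+1)%:R :> R.
  by rewrite -!natrX -!natrM ler_nat pow_le_bin.
have -> : eps Q k * (2 ^+ k.+2 * (k.+1)`!%:R / c) * Q j * 'C(#|T|, k.+1)%:R =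
  (2 ^+ k.+1 * (k.+1)`!%:R * 'C(#|T|, k.+1)%:R) * (Q j * (2 * eps Q k / c)).
  by rewrite [2 ^+ k.+2]exprS; ring.
apply: (@le_trans _ _ (#|T|%:R ^+ k.+1 * (Q j * (2 * eps Q k / c)))); last first.
  rewrite ler_wpM2r // mulr_ge0 ?(ltW Qj) //.
  by rewrite divr_ge0 ?(ltW c0) // mulr_ge0 ?(ltW e0).
rewrite -{2}(subnK jk) exprD -mulrA ler_peMr ?exprn_ge0 //.
rewrite mulrA; move: nj; rewrite ler_pdivrMr // ler_pdivrMr // => nj.
by rewrite mulrA ler_pdivlMr // mul1r; lra.
Qed.
End Density.

(** * Spectrum of the up-Laplacian *)

From mathcomp Require Import complex.

Section DetReindex.
Variables (T : finType).
Let N := #|T|.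

Lemma rank_perm_inj (g : {perm T}) : injective (fun i : 'I_N => enum_rank (g (enum_val i))).
Proof. by move=> i j /enum_rank_inj /perm_inj /enum_val_inj. Qed.
(** [detR] runs over permutations of an arbitrary finite type and [\det] over those of an ordinal;
    the enumeration of T conjugates one into the other. *)
Definition rank_perm g : 'S_N := perm (@rank_perm_inj g).

Lemma rank_permE g i : rank_perm g i = enum_rank (g (enum_val i)).
Proof. by rewrite permE. Qed.

Lemma rank_permM g h : rank_perm (g * h)%g = (rank_perm g * rank_perm h)%g.
Proof. by apply/permP => i; rewrite permM !rank_permE enum_rankK permM. Qed.

Lemma rank_perm_tperm x y :
  rank_perm (tperm x y) = tperm (enum_rank x) (enum_rank y).
Proof.
apply/permP => i; rewrite rank_permE -[i in RHS]enum_valK.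
by rewrite -[RHS](inj_tperm _ _ _ (@enum_rank_inj T)).
Qed.

(** Parity is read off a factorisation into transpositions, which the conjugation maps to
    transpositions. *)
Lemma odd_rank_perm g : odd_perm (rank_perm g) = odd_perm g :> bool.
Proof.
have [ts -> /allP dts] := prod_tpermP g.
elim: ts dts => [|t ts IH] dts.
  rewrite !big_nil odd_perm1; suff -> : rank_perm 1 = 1%g by rewrite odd_perm1.
  by apply/permP => i; rewrite rank_permE !perm1 enum_valK.
rewrite !big_cons rank_permM !odd_permM IH; last first.
  by move=> u ut; apply: dts; rewrite inE ut orbT.
by rewrite rank_perm_tperm !odd_tperm (inj_eq (@enum_rank_inj T)).
Qed.

Lemma unrank_perm_inj (h : 'S_N) : injective (fun x : T => enum_val (h (enum_rank x))).
Proof. by move=> x y /enum_val_inj /perm_inj /enum_rank_inj. Qed.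

Lemma rank_perm_bij : bijective rank_perm.
Proof.
exists (fun h => perm (@unrank_perm_inj h)) => g; apply/permP => x.
  by rewrite permE rank_permE !enum_rankK.
by rewrite rank_permE permE !enum_valK.
Qed.

Definition mx_of (M : T -> T -> RR) : 'M[RR]_N := \matrix_(i, j) M (enum_val i) (enum_val j).

Lemma detR_mx (M : T -> T -> RR) : detR M = \det (mx_of M).
Proof.
rewrite /detR /determinant (reindex rank_perm); last exact: onW_bij rank_perm_bij.
apply: eq_bigr => g _; rewrite odd_rank_perm RpowE; congr (_ * _).
rewrite (reindex (@enum_val T predT)); last exact: onW_bij (enum_val_bij T).
by apply: eq_bigr => i _; rewrite !mxE rank_permE enum_rankK.
Qed.

Lemma charpolyR_mx (M : T -> T -> RR) x : charpolyR M x = (char_poly (mx_of M)).[x].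
Proof.
rewrite /charpolyR detR_mx /char_poly -horner_evalE -det_map_mx; congr (\det _).
apply/matrixP => i j; rewrite !mxE rmorphB rmorphMn /= /horner_eval hornerX hornerC.
by rewrite (inj_eq enum_val_inj); case: (i == j); rewrite ?mulr1n ?mulr0n.
Qed.
End DetReindex.

Lemma exp_conj_diag_mx (F : comUnitRingType) n (P : 'M[F]_n) (D : 'rV[F]_n) j :
  P \in unitmx ->
  (invmx P *m diag_mx D *m P) ^+ j = invmx P *m diag_mx (\row_i D 0 i ^+ j) *m P.
Proof.
move=> uP; elim: j => [|j IH].
  rewrite expr0 (_ : diag_mx _ = 1%:M) ?mulmx1 ?mulVmx //.
  by apply/matrixP => i l; rewrite !mxE expr0.
rewrite exprS IH -[LHS]/(_ *m _) -!mulmxA mulKVmx // !mulmxA; congr (_ *m _).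
rewrite -mulmxA mulmx_diag; congr (_ *m diag_mx _).
by apply/rowP => i; rewrite !mxE exprS.
Qed.

Section Gram.
Local Open Scope sesquilinear_scope.
Variables (m N : nat) (B : 'M[RR]_(m, N)).
Let M := B^T *m B.
Local Notation rc := (real_complex RR).

(* Diagonalise over the complex numbers; the eigenvalue attached to the unit
   eigenvector v is the squared norm of B v, hence real and nonnegative. *)
Lemma gram_spectrum : exists ls : seq RR, [/\ size ls = N, all (>= 0) ls,
   forall x, (char_poly M).[x] = \prod_(l <- ls) (x - l) &
   forall j, \sum_(l <- ls) l ^+ j = \tr (M ^+ j)].
Proof.
pose Bc := map_mx rc B; pose A := map_mx rc M.
have BcJ : Bc ^t* = Bc^T.
  by apply/matrixP => i j; rewrite !mxE; apply: conjc_real.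
have AE : A = Bc ^t* *m Bc by rewrite BcJ /A map_mxM map_trmx.
have AJ : A ^t* = A.
  by rewrite AE trmx_mul map_mxM trmxCK.
have nA : A \is normalmx by apply/normalmxP; rewrite AJ.
pose P := spectralmx A; pose D := spectral_diag A.
have uP : P \is unitarymx := spectral_unitarymx A.
have invP : P \in unitmx := unitarymx_unit uP.
have AD : A = invmx P *m diag_mx D *m P := orthomx_spectralP nA.
have DE : diag_mx D = (P *m Bc ^t*) *m (P *m Bc ^t*) ^t*.
  rewrite trmx_mul map_mxM trmxCK -!mulmxA [Bc^t* *m _]mulmxA -AE.
  by rewrite -invmx_unitary // AD -!mulmxA mulmxV // mulmx1 mulmxA mulmxV // mul1mx.
have D0 i : 0 <= D 0 i.
  have /matrixP /(_ i i) := DE; rewrite !mxE eqxx mulr1n => ->.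
  by apply: sumr_ge0 => j _; rewrite !mxE mul_conjC_ge0.
have DR i : D 0 i = rc (complex.Re (D 0 i)).
  by rewrite RRe_real // ger0_real.
exists [seq complex.Re (D 0 i) | i <- enum 'I_N]; split.
- by rewrite size_map size_enum_ord.
- apply/allP => _ /mapP[i _ ->]; have := D0 i; rewrite lecE => /andP[_] //.
- move=> x; apply: (@complexI RR).
  rewrite big_map big_enum /= rmorph_prod /=.
  rewrite (eq_bigr (fun i => rc x - D 0 i)) => [|i _]; last by rewrite rmorphB /= -DR.
  have -> : (char_poly M).[x] = \det (x%:M - M).
    rewrite /char_poly -horner_evalE -det_map_mx; congr (\det _).
    apply/matrixP => i j; rewrite !mxE rmorphB rmorphMn /= /horner_eval hornerX hornerC.
    by case: (i == j); rewrite ?mulr1n ?mulr0n.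
  rewrite -det_map_mx map_mxB map_scalar_mx -/A.
  have -> : (rc x)%:M - A = invmx P *m diag_mx (\row_i (rc x - D 0 i)) *m P.
    rewrite [in LHS]AD (_ : diag_mx (\row_i _) = (rc x)%:M - diag_mx D).
      by rewrite mulmxBr mulmxBl scalar_mxC mulmxKV.
    by apply/matrixP => i j; rewrite !mxE; case: (i == j); rewrite ?mulr1n ?mulr0n ?subr0.
  rewrite !det_mulmx mulrAC -det_mulmx mulVmx // det1 mul1r det_diag.
  by apply: eq_bigr => i _; rewrite mxE.
move=> j; apply: (@complexI RR).
rewrite big_map big_enum /= rmorph_sum /=.
rewrite (eq_bigr (fun i => D 0 i ^+ j)) => [|i _]; last by rewrite rmorphXn /= -DR.
rewrite -trace_map_mx.
have -> : map_mx rc (M ^+ j) = invmx P *m diag_mx (\row_i (D 0 i ^+ j)) *m P.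
  rewrite -exp_conj_diag_mx // -AD; elim: j => [|j IH]; first by rewrite !expr0 map_mx1.
  by rewrite !exprS -IH; apply: map_mxM.
rewrite mxtrace_mulC mulmxA mulmxV // mul1mx mxtrace_diag.
by apply: eq_bigr => i _; rewrite mxE.
Qed.
End Gram.

Section UpLaplacian.
Variables (n k : nat) (X : {set {set 'I_n}}).
Hypothesis cX : cplx X.
Implicit Types s t : {set 'I_n}.

Lemma cobd_sqr t s : s \subset t -> cobd t s * cobd t s = 1.
Proof. move=> st; rewrite /cobd st RpowE -expr2 -exprM mulnC exprM.
by rewrite -[IZR (-1)]/(-1 : RR) sqrrN !expr1n. Qed.

Lemma cobd0 t s : ~~ (s \subset t) -> cobd t s = 0.
Proof. by rewrite /cobd => /negPf ->. Qed.

Lemma sum_kface (f : {set 'I_n} -> RR) :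
  \sum_(s : kface X k) f (val s) = \sum_(s : {set 'I_n} | #|s| == k.+1) (s \in X)%:R * f s.
Proof.
transitivity (\sum_(s : {set 'I_n} | (s \in X) && (#|s| == k.+1)) f s); last first.
  rewrite big_mkcondl; apply: eq_bigr => s _.
  by case: (s \in X); rewrite ?mul1r ?mul0r.
rewrite (reindex_omap (val : kface X k -> _) insub) => [|s sX]; last by rewrite insubT.
by apply: eq_bigl => s; rewrite (valP s) valK eqxx.
Qed.

Lemma cofaces s : #|s| = k.+1 ->
  [set t : {set 'I_n} | (#|t| == k.+2) && (s \subset t)] = [set v |: s | v in ~: s].
Proof.
move=> sk; apply/setP => t; rewrite inE; apply/andP/imsetP => [[/eqP tk st]|[v]].
  have : (0 < #|t :\: s|)%N by rewrite cardsD (setIidPr st) tk sk subSnn.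
  case/card_gt0P => v; rewrite inE => /andP[vs vt]; exists v; first by rewrite inE.
  apply/esym/eqP; rewrite eqEcard subUset sub1set vt st /= cardsU1 vs sk tk //.
by rewrite inE => vs ->; rewrite cardsU1 vs sk subsetUr.
Qed.

Lemma facets t : #|t| = k.+2 ->
  [set s : {set 'I_n} | (#|s| == k.+1) && (s \subset t)] = [set t :\ u | u in t].
Proof.
move=> tk; apply/setP => s; rewrite inE; apply/andP/imsetP => [[/eqP sk st]|[u ut ->]].
  have : (0 < #|t :\: s|)%N by rewrite cardsD (setIidPr st) tk sk subSnn.
  case/card_gt0P => v; rewrite inE => /andP[vs vt]; exists v => //.
  apply/eqP; rewrite eqEcard subsetD1 st vs /=.
  by move: (cardsD1 v t); rewrite vt tk sk => -[->].
by rewrite subsetDl; split=> //; have := cardsD1 u t; rewrite ut tk add1n => -[<-].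
Qed.

Lemma sum_cofaces s (F : {set 'I_n} -> RR) : #|s| = k.+1 ->
  \sum_(t : {set 'I_n} | (#|t| == k.+2) && (s \subset t)) F t = \sum_(v | v \notin s) F (v |: s).
Proof.
move=> sk; transitivity (\sum_(t in [set v |: s | v in ~: s]) F t).
  by rewrite -cofaces //; apply: eq_bigl => t; rewrite inE.
rewrite big_imset /=; first by apply: eq_bigl => v; rewrite inE.
move=> v u; rewrite !inE => vs us E; have := setU11 v s.
by rewrite E !inE (negPf vs) orbF => /eqP.
Qed.

Lemma sum_facets t (F : {set 'I_n} -> RR) : #|t| = k.+2 ->
  \sum_(s : {set 'I_n} | (#|s| == k.+1) && (s \subset t)) F s = \sum_(u in t) F (t :\ u).
Proof.
move=> tk; transitivity (\sum_(s in [set t :\ u | u in t]) F s).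
  by rewrite -facets //; apply: eq_bigl => s; rewrite inE.
rewrite big_imset //= => v u vt ut E; apply/eqP; apply: contraT => vu.
have : v \in t :\ v by rewrite E !inE vu.
by rewrite !inE eqxx.
Qed.

(** [walk] does not test whether the faces it visits belong to [X]: they are facets of a simplex of
    [X]. The sum over cofaces and facets becomes a sum over the vertex added and the vertex
    removed. *)
Lemma Lup_pow m (a b : kface X k) :
  (mx_of (@Lup n X k) ^+ m) (enum_rank a) (enum_rank b) = walk (@cobd n) m X (val a) (val b).
Proof.
elim: m a => [|m IH] a; first by rewrite expr0 !mxE /= (inj_eq enum_rank_inj) val_eqE.
have ak : #|val a| = k.+1 by case/andP: (valP a) => _ /eqP.
rewrite exprS !mxE (reindex (@enum_rank (kface X k))) /=; last exact: onW_bij (enum_rank_bij _).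
transitivity (\sum_(t : {set 'I_n} | (t \in X) && (#|t| == k.+2)) \sum_(c : kface X k)
   cobd t (val a) * cobd t (val c) * walk (@cobd n) m X (val c) (val b)).
  rewrite exchange_big; apply: eq_bigr => c _; rewrite IH mxE !enum_rankK -mulr_suml.
  by congr (_ * _).
rewrite [LHS](bigID (fun t : {set 'I_n} => val a \subset t)) /= [X in _ + X]big1 ?addr0; last first.
  by move=> t /andP[_ at']; rewrite big1 // => c _; rewrite cobd0 ?mul0r.
transitivity (\sum_(t : {set 'I_n} | (#|t| == k.+2) && (val a \subset t))
  (t \in X)%:R * \sum_(u in t) cobd t (val a) * cobd t (t :\ u)
    * walk (@cobd n) m X (t :\ u) (val b)).
  rewrite (eq_bigl (fun t : {set 'I_n} => (#|t| == k.+2) && (val a \subset t) && (t \in X)));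
    last by move=> t; case: (t \in X); rewrite /= ?andbT ?andbF.
  rewrite big_mkcondr; apply: eq_bigr => t /andP[/eqP tk ta].
  case: (boolP (t \in X)) => tX; rewrite ?mul0r // mul1r.
  rewrite (sum_kface (fun s => cobd t (val a) * cobd t s * walk (@cobd n) m X s (val b))).
  rewrite -(sum_facets (fun s => cobd t (val a) * cobd t s * walk (@cobd n) m X s (val b))) //.
  rewrite [LHS](bigID (fun s : {set 'I_n} => s \subset t)) /= [X in _ + X]big1 ?addr0; last first.
    by move=> s /andP[_ st]; rewrite (cobd0 st) mulr0 mul0r mulr0.
  by apply: eq_bigr => s /andP[_ st]; rewrite (cplxS cX tX st) mul1r.
by rewrite (sum_cofaces (fun t => (t \in X)%:R * \sum_(u in t)
  cobd t (val a) * cobd t (t :\ u) * walk (@cobd n) m X (t :\ u) (val b))).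
Qed.

Lemma trace_walk_mx m : \tr (mx_of (@Lup n X k) ^+ m) = trace_walk k (@cobd n) m X.
Proof.
rewrite /trace_walk -sum_kface /mxtrace (reindex (@enum_rank (kface X k))) /=;
  last exact: onW_bij (enum_rank_bij _).
by apply: eq_bigr => a _; rewrite Lup_pow.
Qed.

Lemma Lup_spectrum : exists ls, [/\ is_spectrum (@Lup n X k) ls, all (>= 0) ls &
  forall m, \sum_(l <- ls) l ^+ m = trace_walk k (@cobd n) m X].
Proof.
(* The coboundary matrix, with a row for every vertex set, zero unless that set is a (k+1)-simplex
   of [X]. *)
pose B : 'M[RR]_(#|{set 'I_n}|, #|{: kface X k}|) := \matrix_(i, a)
  (if (enum_val i \in X) && (#|enum_val i| == k.+2) then cobd (enum_val i) (val (enum_val a)) else 0).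
have BE : mx_of (@Lup n X k) = B^T *m B.
  apply/matrixP => a b; rewrite !mxE /Lup [LHS]big_mkcond /=.
  rewrite (reindex (@enum_val {set 'I_n} predT)) /=; last exact: onW_bij (enum_val_bij _).
  by apply: eq_bigr => i _; rewrite !mxE; case: ifP => _; rewrite ?mulr0.
have [ls [sz pos cp tr]] := gram_spectrum B.
exists ls; split=> //; last by move=> m; rewrite tr -BE trace_walk_mx.
by split=> [|x]; rewrite ?sz // charpolyR_mx BE cp.
Qed.
End UpLaplacian.

(** * Concentration of the moments *)

From mathcomp Require Import boolp.

Lemma Un_cvP (u : nat -> RR) (l : RR) :
  Un_cv u l <-> forall e : RR, 0 < e -> exists N : nat, forall n, (N <= n)%N -> `|u n - l| < e.
Proof.
split=> H e e0.
  have [N HN] := H e (elimT RltP e0); exists N => n /ssrnat.leP Nn.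
  by have := HN n Nn; rewrite RdistE => /RltP.
have [N HN] := H e (introT RltP e0); exists N => n /ssrnat.leP Nn.
by rewrite RdistE; apply/RltP/HN.
Qed.

Lemma bigRplusE (I : Type) (r : seq I) (P : pred I) (F : I -> RR) :
  \big[Rplus/IZR 0]_(i <- r | P i) F i = \sum_(i <- r | P i) F i.
Proof. by []. Qed.

Lemma indic_asbool (Q : Prop) : Defs.indic Q = (asbool Q)%:R.
Proof.
rewrite /Defs.indic; case: excluded_middle_informative => q.
  by rewrite asboolT.
by rewrite asboolF.
Qed.

Section RandomComplex.
Variables (n : nat) (p : {set {set 'I_n}} -> RR).
Implicit Types (X Y : {set {set 'I_n}}) (s t : {set 'I_n}).
Hypothesis p_rand : is_random_subcomplex p.
Hypothesis p_hom : Defs.homogeneous p.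
Hypothesis p_indep : spatially_independent p.

Definition empty_pr : RR := Pr p (fun X => set0 \in X).

(* The law conditioned on containing the empty simplex. *)
Definition cond_law X : RR := if cplx X then p X / empty_pr else 0.

Lemma p_ge0 X : 0 <= p X.
Proof. by case: p_rand => p0 _; apply/RleP. Qed.

Lemma cplx_subcomplex X : cplx X -> is_subcomplex X.
Proof. by move=> /cplxP[_ H] s t; apply: H. Qed.

Lemma p_ncplx X : ~~ cplx X -> set0 \in X -> p X = 0.
Proof.
move=> nc X0; case: p_rand => _ [_]; apply=> sX; case/negP: nc; exact/cplxP.
Qed.

Lemma Pr_sum (E : {set {set 'I_n}} -> Prop) : Pr p E = \sum_X (asbool (E X))%:R * p X.
Proof. by rewrite /Pr bigRplusE; apply: eq_bigr => X _; rewrite indic_asbool. Qed.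

Lemma Pr_le (E D : {set {set 'I_n}} -> Prop) : (forall X, is_subcomplex X -> E X -> D X) -> Pr p E <= Pr p D.
Proof.
move=> ED; rewrite !Pr_sum; apply: ler_sum => X _.
have [sX|nX] := pselect (is_subcomplex X); last first.
  by case: p_rand => _ [_ ->] //; rewrite !mulr0.
rewrite ler_wpM2r ?p_ge0 // ler_nat; case: asboolP => // EX.
by rewrite asboolT //; apply: ED.
Qed.

Lemma empty_pr_le1 : empty_pr <= 1.
Proof.
case: p_rand => _ [p1 _]; rewrite -[leRHS]p1 bigRplusE /empty_pr Pr_sum; apply: ler_sum => X _.
by rewrite ler_piMl ?p_ge0 //; case: asbool.
Qed.

Hypothesis empty_pr_gt0 : 0 < empty_pr.

Lemma cond_law_ge0 X : 0 <= cond_law X.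
Proof. by rewrite /cond_law; case: ifP => // _; rewrite divr_ge0 ?p_ge0 // ltW. Qed.

Lemma cond_law_ncplx X : ~~ cplx X -> cond_law X = 0.
Proof. by rewrite /cond_law => /negPf ->. Qed.

Lemma Pr_cond_law (E : {set {set 'I_n}} -> Prop) :
  Pr p (fun X => E X /\ set0 \in X) = empty_pr * Ex cond_law (fun X => (asbool (E X))%:R).
Proof.
rewrite Pr_sum /Ex mulr_sumr; apply: eq_bigr => X _; rewrite /cond_law.
case: (boolP (cplx X)) => cX.
  rewrite mulrA mulrCA divff ?mulr1 ?gt_eqF // mulrC; congr (_ * (nat_of_bool _)%:R).
  by apply/asboolP/asboolP => [[]//|H]; split=> //; apply: cplx0.
rewrite mul0r mulr0; case: (boolP (set0 \in X)) => X0; first by rewrite p_ncplx ?mulr0.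
by rewrite asboolF ?mul0r // => -[].
Qed.

Lemma Pr_sub Y : cplx Y -> Pr p (fun X => Y \subset X) = empty_pr * pr cond_law Y.
Proof.
move=> cY; have -> : Pr p (fun X => Y \subset X) = Pr p (fun X => Y \subset X /\ set0 \in X).
  rewrite !Pr_sum; apply: eq_bigr => X _; congr ((nat_of_bool _)%:R * _).
  apply/asboolP/asboolP => [H|[]//]; split=> //; apply: (subsetP H); exact: cplx0.
rewrite Pr_cond_law; congr (_ * _); apply: eq_bigr => X _; congr (_ * (nat_of_bool _)%:R).
exact: asboolb.
Qed.

Lemma cond_law_indep Y1 Y2 : cplx Y1 -> cplx Y2 ->
  pr cond_law (Y1 :|: Y2) * pr cond_law (Y1 :&: Y2) = pr cond_law Y1 * pr cond_law Y2.
Proof.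
move=> c1 c2; have := p_indep (cplx_subcomplex c1) (cplx_subcomplex c2).
rewrite !Pr_sub ?cplxU ?cplxI // !RmultE => H.
have P00 : empty_pr * empty_pr != 0 by rewrite mulf_neq0 // gt_eqF.
apply: (mulfI P00); rewrite mulrACA H; ring.
Qed.

Lemma act_inj (g : {perm 'I_n}) : injective (act_cx g).
Proof. by apply: imset_inj; apply: imset_inj; apply: perm_inj. Qed.

Lemma p_act (g : {perm 'I_n}) X : p (act_cx g X) = p X.
Proof.
rewrite -(p_hom g) Pr_sum (bigD1 X) //= asboolT // mul1r big1 ?addr0 // => Z ZX.
by rewrite asboolF ?mul0r // => /act_inj /eqP; apply/negP.
Qed.

(** Each set is listed first and its complement after it; the permutation matches the two lists
    position by position. *)
Lemma exists_perm s t : #|s| = #|t| -> exists g : {perm 'I_n}, [set g x | x in t] = s.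
Proof.
move=> st; pose e (u : {set 'I_n}) := enum u ++ enum (~: u).
have eU u : uniq (e u).
  rewrite cat_uniq !enum_uniq andbT /=; apply/hasPn => x.
  by rewrite !mem_enum inE.
have eM u x : x \in e u by rewrite mem_cat !mem_enum inE orbN.
have eS u : size (e u) = n by rewrite size_cat -!cardE cardsC card_ord.
pose f x := nth x (e s) (index x (e t)).
have iE u x : (index x (e u) < n)%N by rewrite -[X in (_ < X)%N](eS u) index_mem.
have fI : injective f.
  move=> x y; rewrite /f (set_nth_default y) ?eS // => /eqP.
  rewrite nth_uniq ?eS // => /eqP /(congr1 (nth x (e t))).
  by rewrite !nth_index.
exists (perm fI); apply/eqP; rewrite eqEcard card_imset ?st ?leqnn ?andbT; last exact: perm_inj.
apply/subsetP => _ /imsetP[x xt ->]; rewrite permE /f -mem_enum.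
have it : (index x (e t) < size (enum s))%N.
  by rewrite -cardE st cardE index_cat mem_enum xt index_mem mem_enum.
by rewrite nth_cat it mem_nth.
Qed.

Lemma cplx_act (g : {perm 'I_n}) X : cplx X -> cplx (act_cx g X).
Proof.
move=> cX; apply/cplxP; split; first by apply/imsetP; exists set0; rewrite ?cplx0 ?imset0.
move=> _ t /imsetP[s sX ->] ts; apply/imsetP; exists (g @^-1: t); last first.
  apply/setP => x; apply/idP/imsetP => [xt|[y]]; last by rewrite inE => yt ->.
  by exists ((g^-1)%g x); rewrite ?inE permKV.
apply: (cplxS cX sX); apply/subsetP => x; rewrite inE => /(subsetP ts).
by case/imsetP => y ys /perm_inj ->.
Qed.

Lemma cond_law_act (g : {perm 'I_n}) X : cond_law (act_cx g X) = cond_law X.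
Proof.
have K h Y : act_cx h^-1%g (act_cx h Y) = Y.
  rewrite /act_cx -imset_comp (eq_imset (g := id)) ?imset_id // => s /=.
  by rewrite -imset_comp (eq_imset (g := id)) ?imset_id // => x /=; rewrite permK.
rewrite /cond_law p_act; case: (boolP (cplx X)) => cX; first by rewrite cplx_act.
by case: (boolP (cplx _)) => // /(cplx_act g^-1%g); rewrite K (negPf cX).
Qed.

Definition simplex_pr j := pr cond_law (powerset [set i : 'I_n | (i < j)%N]).

Lemma pr_perm s t : #|s| = #|t| -> pr cond_law (powerset s) = pr cond_law (powerset t).
Proof.
move=> st; have [g gt] := exists_perm st.
rewrite /pr /Ex (reindex_inj (@act_inj g)); apply: eq_bigr => X _ /=; rewrite cond_law_act.
rewrite /cond_law; case: (boolP (cplx X)) => cX; last by rewrite !mul0r.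
congr (_ * (nat_of_bool _)%:R).
rewrite !powerset_subP ?cplx_act // -gt mem_imset //; exact/imset_inj/perm_inj.
Qed.

Lemma card_below j : (j <= n)%N -> #|[set i : 'I_n | (i < j)%N]| = j.
Proof.
move=> jn; rewrite -[RHS](card_ord j) -(card_imset _ (f := widen_ord jn)).
  apply: eq_card => i; rewrite inE; apply/idP/imsetP => [ij|[u _ ->] /=]; last exact: ltn_ord.
  by exists (Ordinal ij) => //; apply: val_inj.
by move=> a b /(congr1 val) /= /val_inj.
Qed.

Lemma pr_simplex_pr s : pr cond_law (powerset s) = simplex_pr #|s|.
Proof. by apply: pr_perm; rewrite card_below // -[leqRHS](card_ord n) max_card. Qed.

Lemma Qs0 : simplex_pr 0 = 1.
Proof.
rewrite /simplex_pr; have -> : [set i : 'I_n | (i < 0)%N] = set0 by apply/setP => i; rewrite !inE.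
have P00 : empty_pr != 0 by rewrite gt_eqF.
apply: (mulfI P00); rewrite -Pr_sub ?cplx_powerset // mulr1 /empty_pr powerset0.
by rewrite !Pr_sum; apply: eq_bigr => X _; rewrite sub1set.
Qed.

Lemma Pr_mem s : Pr p (fun X => s \in X) = empty_pr * pr cond_law (powerset s).
Proof.
rewrite -Pr_sub ?cplx_powerset //; apply/eqP; rewrite eq_le; apply/andP; split; apply: Pr_le => X sX.
  move=> sx; apply/subsetP => t; rewrite powersetE; exact: sX.
by move=> /subsetP; apply; rewrite powersetE.
Qed.

Lemma std_simplexE j : std_simplex n j = [set i : 'I_n | (i < j.+1)%N].
Proof. by apply/setP => i; rewrite !inE. Qed.

Lemma q_kE k : q_k p k = empty_pr * simplex_pr k.+1.
Proof. by rewrite /q_k Pr_mem std_simplexE. Qed.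

Lemma r_kE k : q_k p k != 0 -> r_k p k = simplex_pr k.+2 / simplex_pr k.+1.
Proof.
move=> q0; rewrite /r_k /=; case: (excluded_middle_informative _) => H; first by rewrite H eqxx in q0.
have -> : Pr p (fun X => std_simplex n k.+1 \in X /\ std_simplex n k \in X) = empty_pr * simplex_pr k.+2.
  transitivity (Pr p (fun X => std_simplex n k.+1 \in X)); last by rewrite Pr_mem std_simplexE.
  apply/eqP; rewrite eq_le; apply/andP; split; apply: Pr_le => X sX; first by move=> [].
  move=> sk; split=> //; apply: sX sk _; apply/subsetP => i; rewrite !inE; exact: leqW.
rewrite /= RdivE q_kE -mulf_div divff ?mul1r // gt_eqF //.
Qed.
End RandomComplex.

Section Chebyshev.
Variables (R : realFieldType) (T : finType) (w : {set {set T}} -> R) (Q : nat -> R).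
Variables (k : nat) (inc : {set T} -> {set T} -> R) (c C : R).
Hypothesis w_ge0 : forall X, 0 <= w X.
Hypothesis w_cplx : forall X, ~~ cplx X -> w X = 0.

(** Deviations are measured against the expected number of k-simplices; the actual number replaces
    it only in [moments_close_typical]. *)
Definition moments_close N (d : R) (X : {set {set T}}) :=
  [forall m : 'I_N, `|trace_walk k inc m X - mean_faces T Q k * moment k c m| <= d * mean_faces T Q k].

(** A union bound over m combined with Markov's inequality for the squared deviation. *)
Lemma chebyshev N d eta : 0 < d -> 0 < mean_faces T Q k ->
  (forall m, Ex w (fun X => (trace_walk k inc m X - mean_faces T Q k * moment k c m) ^+ 2)
     <= var_const k C m * eta * mean_faces T Q k ^+ 2) ->
  Ex w (fun X => (~~ moments_close N d X)%:R) <= (\sum_(m < N) var_const k C m) * eta / d ^+ 2.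
Proof.
set a := mean_faces T Q k => d0 a0 V.
have da : 0 < (d * a) ^+ 2 by rewrite exprn_gt0 // mulr_gt0.
apply: (@le_trans _ _ (Ex w (fun X => \sum_(m < N)
   ((d * a) ^+ 2)^-1 * (trace_walk k inc m X - a * moment k c m) ^+ 2))).
  apply: le_Ex => // X _; case: (boolP (moments_close N d X)) => /= [_|/forallPn[m]].
    by apply: sumr_ge0 => m _; rewrite mulr_ge0 ?sqr_ge0 // invr_ge0 ltW.
  rewrite -ltNge -/a => lt; rewrite (bigD1 m) //=; apply: ler_wpDr.
    by apply: sumr_ge0 => i _; rewrite mulr_ge0 ?sqr_ge0 // invr_ge0 ltW.
  rewrite mulrC ler_pdivlMr // mul1r -[leRHS]real_normK ?num_real //.
  by rewrite lerXn2r ?nnegrE ?normr_ge0 // ltW // mulr_gt0.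
rewrite Ex_sum -mulrA mulr_suml; apply: ler_sum => m _; rewrite ExZ.
apply: le_trans (ler_wpM2l _ (V m)) _; first by rewrite invr_ge0 ltW.
rewrite le_eqVlt; apply/orP; left; apply/eqP; field.
by rewrite !gt_eqF.
Qed.
End Chebyshev.

Lemma leq_double_succ k : (k.+2 <= 2 * k.+1)%N.
Proof. by lia. Qed.

Section Asymptotics.
Variables (k : nat) (c : RR) (p : forall n : nat, {set {set 'I_n}} -> RR).
Hypothesis c_gt0 : 0 < c.
Hypothesis p_rand : forall n, is_random_subcomplex (@p n).
Hypothesis p_hom : forall n, Defs.homogeneous (@p n).
Hypothesis p_indep : forall n, spatially_independent (@p n).
Hypothesis q_infty : forall M : RR, exists n0 : nat, forall n, (n0 <= n)%N ->
  M < n%:R ^+ k.+1 * q_k (@p n) k.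
Hypothesis r_lim : forall e : RR, 0 < e -> exists n0 : nat, forall n, (n0 <= n)%N ->
  `|n%:R * r_k (@p n) k - c| < e.

Lemma q_le_empty_pr n : q_k (@p n) k <= empty_pr (@p n).
Proof. by apply: Pr_le => // X sX sk; apply: sX sk (sub0set _). Qed.

(** Were [eps] at least e, [eps_small] would bound n^(k+1) Q (k+1), hence also n^(k+1) [q_k], by
    (c+1)^(k+1) / e^M. *)
Lemma eventually_eps e : 0 < e -> exists n0 : nat, forall n, (n0 <= n)%N ->
  [/\ 0 < empty_pr (@p n), 0 < simplex_pr (@p n) k.+2, (2 * k.+1 <= n)%N,
   `|n%:R * ext_pr (simplex_pr (@p n)) k - c| < e & eps (simplex_pr (@p n)) k < e].
Proof.
(* The bound c / 2 keeps n [r_k] positive, which forces Q (k+2) > 0; the bound 1 keeps n [ext_pr]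
   below c + 1. *)
move=> e0; pose e1 := Num.min e (Num.min (c / 2) 1).
have c2 : 0 < c / 2 by rewrite divr_gt0.
have e1p : 0 < e1 by rewrite !lt_min e0 c2 ltr01.
have e1e : e1 <= e by rewrite ge_min lexx.
have e1c : e1 <= c / 2 by rewrite !ge_min lexx orbT.
have e11 : e1 <= 1 by rewrite !ge_min lexx !orbT.
have [n1 H1] := r_lim e1p; have [n2 H2] := q_infty 0.
pose M := (k.+1 * k.+1)%N.
have [n3 H3] := q_infty ((c + 1) ^+ k.+1 / e ^+ M).
exists (maxn (maxn n1 n2) (maxn n3 (2 * k.+1))) => n.
rewrite !geq_max => /andP[/andP[nn1 nn2] /andP[nn3 nk]].
move/(_ n nn1): H1 => H1; move/(_ n nn2): H2 => H2; move/(_ n nn3): H3 => H3.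
have kn : (k.+2 <= n)%N := leq_trans (leq_double_succ k) nk.
have n0' : 0 < n%:R :> RR by rewrite ltr0n (leq_trans _ kn).
have n0 : 0 < n%:R ^+ k.+1 :> RR by rewrite exprn_gt0.
have q0 : 0 < q_k (@p n) k by rewrite pmulr_rgt0 in H2.
have P00 : 0 < empty_pr (@p n) := lt_le_trans q0 (q_le_empty_pr n).
have r_E : r_k (@p n) k = ext_pr (simplex_pr (@p n)) k by apply: r_kE => //; rewrite gt_eqF.
rewrite r_E in H1; move: H1; rewrite ltr_distl => /andP[h1 h2].
have Q1 : 0 < simplex_pr (@p n) k.+1 by move: q0; rewrite q_kE // pmulr_rgt0.
have Q2 : 0 < simplex_pr (@p n) k.+2.
  have : 0 < n%:R * ext_pr (simplex_pr (@p n)) k by lra.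
  by rewrite pmulr_rgt0 // /ext_pr pmulr_lgt0 // invr_gt0.
have card : #|'I_n| = n by rewrite card_ord.
split=> //.
  by apply: lt_le_trans e1e; rewrite ltr_distl h1.
rewrite ltNge; apply/negP => ee.
have kn' : (k.+2 <= #|'I_n|)%N by rewrite card.
have rC : #|'I_n|%:R * ext_pr (simplex_pr (@p n)) k <= c + 1 by rewrite card; lra.
have := eps_small (cond_law_ge0 (p_rand n) P00) (@cond_law_ncplx n (@p n)) (cond_law_indep (p_rand n) (@p_indep n) P00)
   (pr_simplex_pr (@p_hom n)) (Qs0 (p_rand n) P00) Q2 kn' rC.
rewrite card -/M; apply/negP; rewrite -ltNge.
have eM : 0 < e ^+ M by rewrite exprn_gt0.
rewrite ltr_pdivrMr // in H3; apply: lt_le_trans H3 _.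
apply: ler_pM; rewrite ?(ltW eM) //.
- by rewrite mulr_ge0 // ltW.
- rewrite ler_wpM2l ?(ltW n0) // q_kE // ler_piMl ?(ltW Q1) //; exact: empty_pr_le1.
- by rewrite lerXn2r ?nnegrE ?(ltW e0) // (le_trans (ltW e0)).
Qed.

Lemma concentration N d e : 0 < d -> 0 < e -> exists n0 : nat, forall n, (n0 <= n)%N ->
  [/\ 0 < empty_pr (@p n), 0 < mean_faces 'I_n (simplex_pr (@p n)) k &
   1 - e <= Ex (cond_law (@p n)) (fun X => (moments_close (simplex_pr (@p n)) k (@cobd n) c N d X)%:R)].
Proof.
move=> d0 e0.
(* The summand 1 makes [eps * K] dominate [eps], the other is the constant of [meet_small]: a single
   [eta] then meets both requirements. *)
pose K : RR := 1 + 2 ^+ k.+2 * (k.+1)`!%:R / c.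
have K1 : 1 <= K by rewrite lerDl divr_ge0 ?(ltW c_gt0) // mulr_ge0 ?exprn_ge0.
have K0 : 0 < K := lt_le_trans ltr01 K1.
(* Absolute values spare a sign discussion for [var_const]. *)
pose S : RR := \sum_(m < N) `|var_const k (c + 1) m|.
have S0 : 0 <= S by apply: sumr_ge0 => m _; apply: normr_ge0.
(* Once [eta] is at most h, the Chebyshev bound S eta / d^2 is at most e. *)
pose h : RR := Num.min 1 (e * d ^+ 2 / (S + 1)).
have S1 : 0 < S + 1 by lra.
have h0 : 0 < h by rewrite lt_min ltr01 divr_gt0 // mulr_gt0 // exprn_gt0.
pose e1 := Num.min (h / (2 * K)) (Num.min (c / 2) 1).
have K2 : 0 < 2 * K by lra.
have e1p : 0 < e1 by rewrite !lt_min ltr01 !divr_gt0.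
have e1c : e1 <= c / 2 by rewrite !ge_min lexx orbT.
have e11 : e1 <= 1 by rewrite !ge_min lexx !orbT.
have e1h : e1 * (2 * K) <= h by rewrite -ler_pdivlMr // ge_min lexx.
have [n0 H0] := eventually_eps e1p; exists n0 => n /H0[P00 Q2 nk hr he].
have card : #|'I_n| = n by rewrite card_ord.
have kn : (k.+2 <= #|'I_n|)%N by rewrite card (leq_trans (leq_double_succ k) nk).
have W0 := cond_law_ge0 (p_rand n) P00; have WC := @cond_law_ncplx n (@p n).
have WI := cond_law_indep (p_rand n) (@p_indep n) P00.
have WQ := pr_simplex_pr (@p_hom n); have Q0 := Qs0 (p_rand n) P00.
have Qp := Q_gt0 W0 WC WQ Q2 kn.
have a0 : 0 < mean_faces 'I_n (simplex_pr (@p n)) k.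
  by rewrite /mean_faces mulr_gt0 ?Qp // ltr0n bin_gt0 ltnW.
split=> //.
set Q := simplex_pr (@p n) in Q2 hr he WQ Q0 Qp a0 *.
set eta := eps Q k * K + `|n%:R * ext_pr Q k - c|.
have ep0 : 0 < eps Q k by apply: (eps_gt0 W0 WC WQ Q2 kn).
have etah : eta <= h.
  apply: le_trans e1h; rewrite mulrCA mulr_natl mulr2n.
  apply: lerD; first by rewrite ler_wpM2r // ltW.
  by apply: le_trans (ltW hr) _; rewrite ler_peMr // ltW.
have eta0 : 0 <= eta by rewrite addr_ge0 ?normr_ge0 // mulr_ge0 // ltW.
have [nr1 nr2] : c / 2 <= n%:R * ext_pr Q k /\ n%:R * ext_pr Q k <= c + 1.
  by move: hr; rewrite ltr_distl => /andP[? ?]; split; lra.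
have V m := @var_trace_walk _ _ _ Q W0 WC WI WQ Q0 k Q2 kn (@cobd n) (@cobd_sqr n) (c + 1) _ c eta _ _ _ _ m.
have {}V m : Ex (cond_law (@p n)) (fun X => (trace_walk k (@cobd n) m X - mean_faces 'I_n Q k * moment k c m) ^+ 2)
     <= var_const k (c + 1) m * eta * mean_faces 'I_n Q k ^+ 2.
  apply: V; rewrite ?card //.
  - by rewrite (ltW c_gt0) lerDl ler01.
  - by rewrite lerDr mulr_ge0 // ltW.
  - apply: (@le_trans _ _ (eps Q k * K)); last by rewrite lerDl normr_ge0.
    by rewrite ler_peMr // ltW.
  - move=> j jk; have := meet_small W0 WC WI WQ Q0 Q2 kn c_gt0 _ _ _ jk.
    rewrite card => /(_ nk nr1 (le_trans (ltW he) e1c)) /le_trans; apply.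
    have jk2 : (j <= k.+2)%N by case/andP: jk => _ jk; apply: leqW.
    rewrite ler_wpM2r ?ler0n // ler_wpM2r ?(ltW (Qp j jk2)) //.
    rewrite -[leLHS]addr0 lerD ?normr_ge0 // ler_wpM2l ?(ltW ep0) // /K.
    by rewrite lerDr.
  - by apply: le_trans etah _; rewrite ge_min lexx.
have := chebyshev W0 WC N d0 a0 V.
set B := Ex _ _ => HB; set G := Ex _ _.
have GB : G + B = 1.
  rewrite /G /B -ExD -[RHS](Ex1 WC WQ Q0); apply: (eq_Ex WC) => X _.
  by case: (moments_close Q k (@cobd n) c N d X); rewrite ?addr0 ?add0r.
have {}HB : B <= e.
  apply: le_trans HB _; rewrite ler_pdivrMr ?exprn_gt0 //.
  apply: (@le_trans _ _ (S * h)).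
    apply: (@le_trans _ _ (S * eta)); last by rewrite ler_wpM2l.
    by rewrite ler_wpM2r //; apply: ler_sum => m _; apply: ler_norm.
  apply: (@le_trans _ _ ((S + 1) * h)); first by rewrite ler_wpM2r ?lerDl // ltW.
  by rewrite mulrC -ler_pdivlMr // ge_min lexx orbT.
lra.
Qed.
End Asymptotics.

(** * The moment problem *)

From mathcomp Require Import all_classical all_reals all_analysis.
From mathcomp Require Import measurable_realfun.
Import numFieldNormedType.Exports.

(** * Taylor remainder of the exponential *)

Section ExpTaylor.
Variable R : realType.

Definition exp_tail n (y : R) : R := expR (- y) - \sum_(j < n) (- y) ^+ j / j`!%:R.

Lemma exp_tail0 n : (0 < n)%N -> exp_tail n 0 = 0.
Proof.
case: n => // n _; rewrite /exp_tail oppr0 expR0 big_ord_recl expr0 fact0 divr1.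
by rewrite big1 ?addr0 ?subrr // => j _; rewrite /= expr0n mul0r.
Qed.

Lemma is_derive_monomial (c : R) n (g : R -> R) (y dg : R) : is_derive y 1 g dg ->
  is_derive y 1 (fun z => c * g z ^+ n.+1) (c * (n.+1%:R * g y ^+ n * dg)).
Proof.
by move=> H; have := is_deriveZ c (is_deriveX n.+1 H); rewrite exprfctE.
Qed.

Lemma is_derive_exp_tail n (y : R) : is_derive y 1 (exp_tail n.+1) (- exp_tail n y).
Proof.
elim: n y => [|n IH] y.
  rewrite /exp_tail big_ord0 subr0.
  have -> : (fun y : R => expR (- y) - \sum_(j < 1) (- y) ^+ j / j`!%:R) = fun y => expR (- y) - 1.
    by apply/funext => z; rewrite big_ord1 expr0 fact0 divr1.
  apply: is_derive_eq; ring.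
have f0 m : m`!%:R != 0 :> R by rewrite pnatr_eq0 -lt0n fact_gt0.
have -> : exp_tail n.+2 = fun y => exp_tail n.+1 y - (n.+1)`!%:R^-1 * (- y) ^+ n.+1.
  apply/funext => z; rewrite /exp_tail big_ord_recr /= opprD addrA.
  by rewrite [_^-1 * _]mulrC.
have H := is_deriveB (IH y) (is_derive_monomial (n.+1)`!%:R^-1 n (is_deriveNid y 1)).
apply: is_derive_eq H _.
have -> : exp_tail n.+1 y = exp_tail n y - (- y) ^+ n / n`!%:R.
  by rewrite /exp_tail big_ord_recr /= opprD addrA.
have := f0 n; have : n.+1%:R != 0 :> R by rewrite pnatr_eq0.
by rewrite factS natrM => n1 fn; field; rewrite fn nat1r n1.
Qed.

(** For e = 1 and e = -1 the function y^(n+1) / (n+1)! + e [exp_tail n.+1 y] vanishes at 0, and the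
    bound for n makes its derivative nonnegative; the mean value theorem concludes. *)
Lemma exp_tail_le n (y : R) : 0 <= y -> `|exp_tail n y| <= y ^+ n / n`!%:R.
Proof.
elim: n y => [|n IH] y y0.
  by rewrite /exp_tail big_ord0 subr0 expr0 fact0 divr1 ger0_norm ?expR_ge0 // -expR0 ler_expR oppr_le0.
have f0 m : m`!%:R != 0 :> R by rewrite pnatr_eq0 -lt0n fact_gt0.
have key (e : R) : `|e| <= 1 -> 0 <= y ^+ n.+1 / (n.+1)`!%:R + e * exp_tail n.+1 y.
  move=> e1; pose G (x : R) := x ^+ n.+1 / (n.+1)`!%:R + e * exp_tail n.+1 x.
  have dG (x : R) : is_derive x 1 G (x ^+ n / n`!%:R - e * exp_tail n x).
    have -> : G = fun x => (n.+1)`!%:R^-1 * x ^+ n.+1 + e * exp_tail n.+1 x.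
      by apply/funext => z; rewrite /G [_^-1 * _]mulrC.
    have H := is_deriveD (is_derive_monomial (n.+1)`!%:R^-1 n (is_derive_id x 1))
      (is_deriveZ e (is_derive_exp_tail n x)).
    apply: is_derive_eq H _.
    rewrite factS natrM /GRing.scale /=.
    have := f0 n; have : n.+1%:R != 0 :> R by rewrite pnatr_eq0.
    by move=> n1 fn; field; rewrite fn nat1r n1.
  have G0 : G 0 = 0 by rewrite /G exp_tail0 // expr0n /= mul0r mulr0 addr0.
  have [->|yn0] := eqVneq y 0; first by rewrite -/(G 0) G0.
  have yp : 0 < y by rewrite lt_def yn0.
  have [|c] := @MVT R G (fun x => x ^+ n / n`!%:R - e * exp_tail n x) 0 y yp (fun x _ => dG x).
    apply: continuous_subspaceT => x; apply: differentiable_continuous.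
    exact/derivable1_diffP/ex_derive.
  rewrite in_itv /= => /andP[c0 _]; rewrite G0 !subr0 -/(G y) => ->.
  rewrite mulr_ge0 // subr_ge0; apply: le_trans (IH c (ltW c0)).
  apply: le_trans (ler_norm _) _; rewrite normrM -[leRHS]mul1r ler_wpM2r //.
rewrite ler_norml; apply/andP; split.
  by have := key 1; rewrite normr1 mul1r => /(_ (lexx _)); lra.
by have := key (-1); rewrite normrN1 mulN1r subr_ge0 => /(_ (lexx _)).
Qed.
End ExpTaylor.

(** * Integrals of bounded measurable functions *)

Section BoundedIntegral.
Variables (R : realType) (P : probability (measurableTypeR R) R).
Implicit Types f g : measurableTypeR R -> R.

Definition bmeas f := measurable_fun setT f /\ exists M, forall x, `|f x| <= M.

Definition mean f : R := (\int[P]_x f x)%R.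

Lemma bmeas_integrable f : bmeas f -> P.-integrable setT (EFin \o f).
Proof.
move=> [mf [M fM]]; apply: measurable_bounded_integrable => //.
  by apply: le_lt_trans (ltry 1); apply: probability_le1.
exists M; split; first exact: num_real.
by move=> x Mx y _ /=; apply: le_trans (fM y) (ltW Mx).
Qed.

Lemma bmeas_add f g : bmeas f -> bmeas g -> bmeas (fun x => f x + g x).
Proof.
move=> [mf [M fM]] [mg [N gN]]; split; first exact: measurable_funD.
by exists (M + N) => x; apply: le_trans (ler_normD _ _) (lerD (fM x) (gN x)).
Qed.

Lemma bmeas_cst c : bmeas (fun=> c).
Proof. by split; [exact: measurable_cst|exists `|c|]. Qed.

Lemma bmeas_scale c f : bmeas f -> bmeas (fun x => c * f x).
Proof.
move=> [mf [M fM]]; split; first by apply: measurable_funM => //; exact: measurable_cst.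
by exists (`|c| * M) => x; rewrite normrM ler_wpM2l.
Qed.

Lemma bmeas_indic (A : set (measurableTypeR R)) : measurable A -> bmeas (\1_A).
Proof.
move=> mA; split; first exact: measurable_indic.
by exists 1 => x; rewrite indicE; case: (x \in A); rewrite ?normr1 ?normr0.
Qed.

Lemma mean_add f g : bmeas f -> bmeas g -> mean (fun x => f x + g x) = mean f + mean g.
Proof. by move=> bf bg; rewrite /mean RintegralD //; apply: bmeas_integrable. Qed.

Lemma mean_scale c f : bmeas f -> mean (fun x => c * f x) = c * mean f.
Proof. by move=> bf; rewrite /mean RintegralZl //; apply: bmeas_integrable. Qed.

Lemma mean_cst c : mean (fun=> c) = c.
Proof.
rewrite /mean Rintegral_cst; last exact: measurableT.
rewrite -[RHS]mulr1; congr (_ * _).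
by rewrite -[RHS]/(fine 1%E); congr fine; apply: probability_setT.
Qed.

Lemma mean_le f g : bmeas f -> bmeas g -> (forall x, f x <= g x) -> mean f <= mean g.
Proof. by move=> bf bg fg; apply: le_Rintegral => //; apply: bmeas_integrable. Qed.

Lemma mean_indic (A : set (measurableTypeR R)) : measurable A -> mean (\1_A) = fine (P A).
Proof. by move=> mA; rewrite /mean /Rintegral integral_indic // setIT. Qed.

Lemma bmeas_sum (r : seq nat) (G : nat -> measurableTypeR R -> R) : (forall i, bmeas (G i)) ->
  bmeas (fun x => \sum_(i <- r) G i x).
Proof.
move=> DG; elim: r => [|i r IH].
  by rewrite (_ : (fun _ => _) = fun=> 0); [exact: bmeas_cst|apply/funext => x; rewrite big_nil].
rewrite (_ : (fun _ => _) = fun x => G i x + \sum_(i <- r) G i x); first exact: bmeas_add.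
by apply/funext => x; rewrite big_cons.
Qed.

Lemma mean_sum (r : seq nat) (G : nat -> measurableTypeR R -> R) : (forall i, bmeas (G i)) ->
  mean (fun x => \sum_(i <- r) G i x) = \sum_(i <- r) mean (G i).
Proof.
move=> DG; elim: r => [|i r IH].
  by rewrite big_nil (_ : (fun _ => _) = fun=> 0) ?mean_cst //; apply/funext => x; rewrite big_nil.
rewrite big_cons -IH -mean_add //; last exact: bmeas_sum.
by congr mean; apply/funext => x; rewrite big_cons.
Qed.

Lemma mean_dist f g e : bmeas f -> bmeas g -> (forall x, `|f x - g x| <= e) ->
  `|mean f - mean g| <= e.
Proof.
have le u v : bmeas u -> bmeas v -> (forall x, u x <= v x + e) -> mean u <= mean v + e.
  move=> bu bv uv; rewrite -[e]mean_cst -mean_add //; last exact: bmeas_cst.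
  by apply: mean_le => //; apply: bmeas_add => //; apply: bmeas_cst.
move=> bf bg fg; have H1 : mean f <= mean g + e.
  by apply: le => // x; have := fg x; rewrite ler_norml => /andP[]; lra.
have H2 : mean g <= mean f + e.
  by apply: le => // x; have := fg x; rewrite ler_norml => /andP[]; lra.
by rewrite ler_norml; apply/andP; split; lra.
Qed.
End BoundedIntegral.

(** * Dyadic step approximation *)

Section DyadicStep.
Variable R : realType.

(** The sum counts the integers from 1 to m not exceeding t, so it is the floor of t. *)
Lemma count_floor (t : R) (m : nat) : 0 <= t < m.+1%:R ->
  t - 1 <= \sum_(1 <= j < m.+1) (j%:R <= t)%R%:R <= t.
Proof.
elim: m => [|m IH] /andP[t0 tm].
  by rewrite big_geq // t0 andbT; move: tm; lra.
rewrite big_nat_recr //=; case: (leP m.+1%:R t) => mt.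
  rewrite (eq_big_nat _ _ (F2 := fun=> 1)).
    rewrite sumr_const_nat subn1 /= natr1.
    by rewrite mt andbT lerBlDr natr1 ltW.
  move=> j /andP[_ jm]; rewrite (_ : (j%:R <= t)%R) //.
  by apply: le_trans mt; rewrite ler_nat ltnW.
by rewrite addr0 IH // t0.
Qed.

(** The pointwise form of [approx_integral], in the range where its cap n is inactive. *)
Lemma dyadic_approx (y : R) (n : nat) : 0 <= y <= n%:R ->
  `|\sum_(1 <= j < (n * 2 ^ n).+1) 2^-1 ^+ n * (j%:R / 2 ^+ n <= y)%R%:R - y| <= 2^-1 ^+ n.
Proof.
move=> /andP[y0 yn]; have p0 : 0 < 2 ^+ n :> R by rewrite exprn_gt0.
have H : 0 <= y * 2 ^+ n < (n * 2 ^ n).+1%:R.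
  apply/andP; split; first exact: mulr_ge0 y0 (ltW p0).
  by rewrite -[_.+1%:R in ltRHS]natr1 natrM natrX ltr_pwDr // ler_pM2r.
have := count_floor H.
rewrite -mulr_sumr [in X in _ -> X](eq_bigr (fun j => (j%:R <= y * 2 ^+ n)%R%:R)); last first.
  by move=> j _; rewrite ler_pdivrMr.
set s := \sum_(_ <= _ < _) _ => /andP[s1 s2].
rewrite exprVn; have -> : (2 ^+ n)^-1 * s - y = (s - y * 2 ^+ n) / 2 ^+ n.
  by field; rewrite gt_eqF.
rewrite normrM [`|(2 ^+ n)^-1|]ger0_norm ?invr_ge0 ?(ltW p0) //.
by rewrite ler_piMl ?invr_ge0 ?(ltW p0) // ler_norml; apply/andP; split; lra.
Qed.
End DyadicStep.

Lemma max_lip (R : realFieldType) (l a b : R) :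
  `|Num.max l a - Num.max l b| <= `|a - b|.
Proof.
wlog ab : a b / b <= a => [H|].
  by case: (leP b a) => [/H//|/ltW/H]; rewrite distrC [`|b - a|]distrC.
rewrite (ger0_norm (x := a - b)) ?subr_ge0 // ler_norml !maxElt.
by case: (ltP l a) => ?; case: (ltP l b) => ?; apply/andP; split; lra.
Qed.

Lemma clip_lip (R : realFieldType) (l h a b : R) :
  `|Num.max l (Num.min h a) - Num.max l (Num.min h b)| <= `|a - b|.
Proof.
apply: le_trans (max_lip _ _ _) _; wlog ab : a b / b <= a => [H|].
  by case: (leP b a) => [/H//|/ltW/H]; rewrite distrC [`|b - a|]distrC.
rewrite (ger0_norm (x := a - b)) ?subr_ge0 // ler_norml !minElt.
by case: (ltP h a) => ?; case: (ltP h b) => ?; apply/andP; split; lra.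
Qed.

Lemma le_clip (R : realFieldType) (l h a b : R) : a <= b ->
  Num.max l (Num.min h a) <= Num.max l (Num.min h b).
Proof. by move=> ab; rewrite le_max2 // le_min2. Qed.

Definition ucont_on (R : realType) (f : R -> R) a b := forall e, 0 < e -> exists2 d, 0 < d &
  forall x y, a <= x <= b -> a <= y <= b -> `|x - y| < d -> `|f x - f y| < e.

(** * Piecewise linear ramps *)

Section Ramp.
Variable R : realType.
Implicit Types a b h x y : R.

(** A continuous substitute for the indicator of x <= a, decreasing linearly to 0 at a + h. *)
Definition ramp a h x : R := Num.max 0 (Num.min 1 ((a + h - x) / h)).

Lemma ramp_range a h x : 0 <= ramp a h x <= 1.
Proof. by rewrite /ramp le_max lexx ge_max ler01 /= ge_min lexx. Qed.

Lemma ramp1 a h x : 0 < h -> x <= a -> ramp a h x = 1.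
Proof.
move=> h0 xa; have H : 1 <= (a + h - x) / h by rewrite ler_pdivlMr // mul1r; lra.
by rewrite /ramp min_l // max_r.
Qed.

Lemma ramp0 a h x : 0 < h -> a + h <= x -> ramp a h x = 0.
Proof.
move=> h0 xa; have H : (a + h - x) / h <= 0 by rewrite pmulr_lle0 ?invr_gt0 // subr_le0.
by rewrite /ramp min_r ?max_l // (le_trans H).
Qed.

Lemma ramp_lip a b h x y : 0 < h -> `|ramp a h x - ramp b h y| <= `|(a - x) - (b - y)| / h.
Proof.
move=> h0; rewrite /ramp.
set u := (a + h - x) / h; set v := (b + h - y) / h.
have -> : `|(a - x) - (b - y)| / h = `|u - v|.
  rewrite -[h in LHS](ger0_norm (ltW h0)) -normfV -normrM; congr (`| _ |).
  by rewrite /u /v; field; rewrite gt_eqF.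
exact: clip_lip.
Qed.

Lemma le_ramp a b h x : 0 < h -> a <= b -> ramp a h x <= ramp b h x.
Proof.
by move=> h0 ab; apply: le_clip; rewrite ler_wpM2r ?invr_ge0 ?(ltW h0) //; lra.
Qed.

Lemma ramp_le_shift a h h' x : 0 < h -> 0 < h' -> ramp a h x <= ramp (a + h) h' x.
Proof.
move=> h0 h'0; case: (leP x (a + h)) => xa.
  by rewrite (ramp1 h'0 xa); have /andP[] := ramp_range a h x.
by rewrite (ramp0 h0 (ltW xa)); have /andP[] := ramp_range (a + h) h' x.
Qed.
End Ramp.

(* Two positive normalised linear functionals whose values on ramps are squeezed
   between the same distribution function agree: write f as a combination of hat
   functions on a fine grid and sum by parts. *)
Section Squeeze.
Variable R : realType.
Variables (D : (R -> R) -> Prop) (F : R -> R).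
Implicit Types f g : R -> R.
Hypothesis D_ramp : forall a h, 0 < h -> D (ramp a h).
Hypothesis D_cst : forall c, D (fun=> c).
Hypothesis D_add : forall f g, D f -> D g -> D (fun x => f x + g x).
Hypothesis D_scale : forall c f, D f -> D (fun x => c * f x).
Hypothesis F_neg : forall x, x < 0 -> F x = 0.
Hypothesis F_nd : forall x y, x <= y -> F x <= F y.
Hypothesis F_le1 : forall x, F x <= 1.
Hypothesis F_lim : forall e, 0 < e -> exists n : nat, 1 - F n%:R < e.

(** Captures what the limit of averages and the integral against the limit law have in common, on a
    class [D] where both behave well. *)
Record functional (L : (R -> R) -> R) : Prop := Functional {
  fnl_add : forall f g, D f -> D g -> L (fun x => f x + g x) = L f + L g;
  fnl_scale : forall c f, D f -> L (fun x => c * f x) = c * L f;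
  fnl_cst : forall c, L (fun=> c) = c;
  fnl_le : forall f g, D f -> D g -> (forall x, f x <= g x) -> L f <= L g;
  fnl_ramp : forall a h, 0 < h -> F a <= L (ramp a h) <= F (a + h) }.

Lemma D_sum (r : seq nat) (G : nat -> R -> R) : (forall i, D (G i)) ->
  D (fun x => \sum_(i <- r) G i x).
Proof.
move=> DG; elim: r => [|i r IH].
  by rewrite (_ : (fun _ => _) = fun=> 0) //; apply/funext => x; rewrite big_nil.
rewrite (_ : (fun _ => _) = fun x => G i x + \sum_(i <- r) G i x); first exact: D_add.
by apply/funext => x; rewrite big_cons.
Qed.

Lemma fnl_sum L (r : seq nat) (G : nat -> R -> R) : functional L -> (forall i, D (G i)) ->
  L (fun x => \sum_(i <- r) G i x) = \sum_(i <- r) L (G i).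
Proof.
move=> fL DG; elim: r => [|i r IH].
  rewrite big_nil (_ : (fun _ => _) = fun=> 0) ?(fnl_cst fL) //.
  by apply/funext => x; rewrite big_nil.
rewrite big_cons -IH -(fnl_add fL) //; last exact: D_sum.
by congr (L _); apply/funext => x; rewrite big_cons.
Qed.

Section Grid.
Variables (f : R -> R) (M w h : R) (N : nat).
Hypotheses (h0 : 0 < h) (h1 : h < 1) (Df : D f) (fM : forall x, `|f x| <= M) (w0 : 0 <= w).
(** Starting at -1 with h < 1 keeps the first two nodes negative, where [F] vanishes; every
    functional then gives the first ramp the value 0. *)
Let x_ i : R := -1 + i%:R * h.
Hypothesis fw : forall x y, -1 <= x <= x_ N.+1 -> -1 <= y <= x_ N.+1 ->
  `|x - y| <= h -> `|f x - f y| <= w.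

Let xS i : x_ i.+1 = x_ i + h. Proof. by rewrite /x_ -natr1; ring. Qed.

Let x_ge i : -1 <= x_ i.
Proof. by rewrite /x_ lerDl mulr_ge0 // ltW. Qed.

Let x_le i j : (i <= j)%N -> x_ i <= x_ j.
Proof. by move=> ij; rewrite /x_ lerD2l ler_wpM2r ?ler_nat // ltW. Qed.

Let M0 : 0 <= M. Proof. exact: le_trans (fM 0). Qed.

Let hat i x := ramp (x_ i.+1) h x - ramp (x_ i) h x.
Let S x := \sum_(0 <= i < N) f (x_ i.+1) * hat i x.

Let D_hat i : D (hat i).
Proof.
rewrite /hat (_ : (fun _ => _) = fun x => ramp (x_ i.+1) h x + (-1) * ramp (x_ i) h x).
  by apply: D_add; [|apply: D_scale]; apply: D_ramp.
by apply/funext => x; rewrite mulN1r.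
Qed.

Let hat_ge0 i x : 0 <= hat i x.
Proof. by rewrite subr_ge0 le_ramp // x_le. Qed.

Let bump x := M * (1 - ramp (x_ N) h x + ramp (x_ 0) h x) + w.

(** The hats sum to the difference of the two extreme ramps, and the defect from 1 is paid with M.
    Each hat lives within h of its node, where [f] varies by at most w. *)
Let interp x : `|f x - S x| <= bump x.
Proof.
have tel : \sum_(0 <= i < N) hat i x = ramp (x_ N) h x - ramp (x_ 0) h x.
  by rewrite telescope_sumr.
have -> : f x - S x = f x * (1 - ramp (x_ N) h x + ramp (x_ 0) h x) +
    \sum_(0 <= i < N) (f x - f (x_ i.+1)) * hat i x.
  under eq_bigr do rewrite mulrBl.
  by rewrite sumrB -mulr_sumr tel /S; ring.
have /andP[a1 a2] := ramp_range (x_ N) h x; have /andP[b1 b2] := ramp_range (x_ 0) h x.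
apply: le_trans (ler_normD _ _) _; apply: lerD.
  rewrite normrM [X in _ * X]ger0_norm; last by lra.
  by rewrite ler_wpM2r //; lra.
apply: le_trans (ler_norm_sum _ _ _) _.
apply: (@le_trans _ _ (\sum_(0 <= i < N) w * hat i x)); last first.
  by rewrite -mulr_sumr tel ler_piMr //; lra.
rewrite big_nat [leRHS]big_nat; apply: ler_sum => i /andP[_ iN].
rewrite normrM (ger0_norm (hat_ge0 _ _)).
case: (leP x (x_ i)) => xi.
  by rewrite /hat !ramp1 // ?subrr ?mulr0 // (le_trans xi) // x_le.
case: (leP (x_ i.+2) x) => xi2.
  rewrite /hat !ramp0 ?subrr ?mulr0 // -xS //.
  by apply: le_trans xi2; apply: x_le.
rewrite ler_wpM2r //; apply: fw.
- by rewrite (le_trans (x_ge i) (ltW xi)) (le_trans (ltW xi2)) // x_le.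
- by rewrite x_ge x_le // ltnW.
- by move: xi xi2; rewrite !xS ler_norml; lra.
Qed.

Let fnl_interp L : functional L ->
  `|L f - \sum_(0 <= i < N) f (x_ i.+1) * (L (ramp (x_ i.+1) h) - L (ramp (x_ i) h))|
     <= M * (1 - F (x_ N)) + w.
Proof.
move=> fL.
have Dr i : D (ramp (x_ i) h) by apply: D_ramp.
have Dh i : D (fun x => f (x_ i.+1) * hat i x) by apply: D_scale.
have DS : D S by apply: D_sum.
have DN g : D g -> D (fun x => - g x).
  by move=> Dg; rewrite (_ : (fun _ => _) = fun x => -1 * g x); [apply: D_scale|apply/funext => x;
    rewrite mulN1r].
have LN g : D g -> L (fun x => - g x) = - L g.
  move=> Dg; rewrite -mulN1r -(fnl_scale fL) //; congr (L _).
  by apply/funext => x; rewrite mulN1r.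
have <- : L S = \sum_(0 <= i < N) f (x_ i.+1) * (L (ramp (x_ i.+1) h) - L (ramp (x_ i) h)).
  rewrite /S (fnl_sum _ fL) //; apply: eq_bigr => i _.
  rewrite (fnl_scale fL) // /hat (fnl_add fL) //; first by rewrite LN.
  exact: DN.
have Db : D bump.
  apply: D_add => //; apply: D_scale; apply: D_add => //; apply: D_add => //; exact: DN.
have Lb : L bump <= M * (1 - F (x_ N)) + w.
  rewrite /bump (fnl_add fL) // ?(fnl_cst fL) ?lerD2r; last first.
    apply: D_scale; apply: D_add => //; apply: D_add => //; exact: DN.
  rewrite (fnl_scale fL); last by apply: D_add => //; apply: D_add => //; exact: DN.
  rewrite ler_wpM2l // (fnl_add fL) //; last by apply: D_add => //; exact: DN.
  rewrite (fnl_add fL) // ?(fnl_cst fL) ?LN //; last exact: DN.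
  have /andP[l1 _] := fnl_ramp fL (x_ N) h0; have /andP[_ l2] := fnl_ramp fL (x_ 0) h0.
  have : F (x_ 0 + h) = 0. apply: F_neg; by rewrite /x_ mul0r addr0 addrC subr_lt0.
  lra.
have LB : L (fun x => f x - S x) = L f - L S by rewrite (fnl_add fL) ?LN //; apply: DN.
have DB : D (fun x => f x - S x) by apply: D_add => //; apply: DN.
apply: le_trans Lb; rewrite -LB ler_norml -LN //; apply/andP; split.
  by apply: (fnl_le fL) => //; [exact: DN|move=> x; have := interp x; rewrite ler_norml => /andP[]].
by apply: (fnl_le fL) => // x; have := interp x; rewrite ler_norml => /andP[].
Qed.

(** Summation by parts pairs increments of [f], at most w each, with values [d i] whose bounds F (x_
    i.+1) - F (x_ i) telescope, so no factor N appears. The 3 counts two interpolation errors and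
    this comparison. *)
Lemma fnl_grid L I : functional L -> functional I ->
  `|L f - I f| <= 3 * (M * (1 - F (x_ N)) + w).
Proof.
move=> fL fI.
have HL := fnl_interp fL; have HI := fnl_interp fI.
pose d i := L (ramp (x_ i) h) - I (ramp (x_ i) h).
have dw i : `|d i| <= F (x_ i.+1) - F (x_ i).
  have := fnl_ramp fL (x_ i) h0; have := fnl_ramp fI (x_ i) h0.
  by rewrite -xS /d ler_norml => /andP[? ?] /andP[? ?]; apply/andP; split; lra.
have d00 : d 0 = 0.
  have := dw 0; rewrite (F_neg (x := x_ 1)); last by rewrite /x_ mul1r addrC subr_lt0.
  rewrite (F_neg (x := x_ 0)); last by rewrite /x_ mul0r addr0 oppr_lt0.
  by rewrite subrr normr_le0 => /eqP.
have abel n : (n < N)%N ->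
   `|\sum_(0 <= i < n.+1) f (x_ i.+1) * (d i.+1 - d i) - f (x_ n.+1) * d n.+1|
      <= w * F (x_ n.+1).
  elim: n => [|n IH] nN.
    rewrite big_nat1 d00 subr0 subrr normr0 mulr_ge0 //.
    by rewrite -(F_neg (x := -1)) ?F_nd // oppr_lt0.
  have {}IH := IH (ltnW nN).
  rewrite big_nat_recr //=; set s := \sum_(0 <= i < n.+1) _ in IH *.
  rewrite [X in `|X|](_ : _ = (s - f (x_ n.+1) * d n.+1) + (f (x_ n.+1) - f (x_ n.+2)) * d n.+1);
    last by ring.
  apply: le_trans (ler_normD _ _) _; rewrite normrM.
  have df : `|f (x_ n.+1) - f (x_ n.+2)| <= w.
    apply: fw; rewrite ?x_ge ?x_le //; first exact: leqW (ltnW nN).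
      exact: ltnW.
    by rewrite (xS n.+1) opprD addrA subrr add0r normrN ger0_norm // ltW.
  have := ler_pM (normr_ge0 _) (normr_ge0 _) df (dw n.+1); lra.
have sumd : `|\sum_(0 <= i < N) f (x_ i.+1) * (d i.+1 - d i)| <= M * (1 - F (x_ N)) + w.
  have FN1 : 0 <= 1 - F (x_ N) by rewrite subr_ge0.
  case: (posnP N) => [->|N0]; first by rewrite big_geq // normr0 addr_ge0 // mulr_ge0 // subr_ge0.
  have := abel N.-1; rewrite prednK // => /(_ (leqnn _)).
  set s := \sum_(0 <= i < N) _ => H.
  rewrite -(addrNK (f (x_ N) * d N) s) addrC.
  apply: le_trans (ler_normD _ _) _; apply: lerD.
    rewrite normrM; apply: ler_pM => //; apply: le_trans (dw N) _.
    by rewrite lerD2r.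
  by apply: le_trans H _; rewrite ler_piMr.
have E : \sum_(0 <= i < N) f (x_ i.+1) * (d i.+1 - d i) =
   \sum_(0 <= i < N) f (x_ i.+1) * (L (ramp (x_ i.+1) h) - L (ramp (x_ i) h)) -
   \sum_(0 <= i < N) f (x_ i.+1) * (I (ramp (x_ i.+1) h) - I (ramp (x_ i) h)).
  by rewrite -sumrB; apply: eq_bigr => i _; rewrite /d; ring.
move: HL HI sumd; rewrite {}E !ler_norml => /andP[? ?] /andP[? ?] /andP[? ?].
by apply/andP; split; lra.
Qed.
End Grid.

Lemma fnl_eq L I f M : functional L -> functional I -> D f -> (forall x, `|f x| <= M) ->
  (forall n : nat, ucont_on f (-1) n%:R) -> L f = I f.
Proof.
move=> fL fI Df fM uf; have M0 : 0 <= M by apply: le_trans (fM 0).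
apply/eqP; rewrite -subr_eq0 -normr_eq0 eq_le normr_ge0 andbT.
apply/ler_addgt0Pl => e e0; rewrite addr0.
(* Sixths, because [fnl_grid] triples the sum of two errors; M + 1 avoids dividing by 0. *)
have e6 : 0 < e / (6 * (M + 1)) by rewrite divr_gt0 // mulr_gt0 // ltr_wpDl.
have e6' : 0 < e / 6 by rewrite divr_gt0.
have [K FK] := F_lim e6; have [dl dl0 Hdl] := uf K.+1 _ e6'.
(* With mesh 1 / p and p (K+1) steps from -1, the node [x_ N] is exactly K. *)
pose p := (Num.bound dl^-1).+2; have p0 : 0 < p%:R :> R by rewrite ltr0n.
have hd : p%:R^-1 < dl.
  rewrite -[ltRHS]invrK ltf_pV2 ?posrE ?invr_gt0 //.
  by apply: lt_le_trans (archi_boundP _) _; rewrite ?invr_ge0 ?(ltW dl0) // ler_nat leqW.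
have xN : -1 + (p * K.+1)%:R * p%:R^-1 = K%:R :> R.
  by rewrite natrM -natr1; field; rewrite gt_eqF.
have h1 : p%:R^-1 < 1 :> R by rewrite invf_lt1 // ltr1n.
have h0 : 0 < p%:R^-1 :> R by rewrite invr_gt0.
have xN1 : -1 + (p * K.+1).+1%:R * p%:R^-1 <= K.+1%:R :> R.
  by rewrite -natr1 mulrDl mul1r addrA xN -natr1 lerD2l ltW.
have := fnl_grid (w := e / 6) h0 h1 Df fM (ltW e6') _ fL fI (N := (p * K.+1)%N).
rewrite xN => H; apply: le_trans (H _) _.
  move=> x y /andP[x1 x2] /andP[y1 y2] xy; apply: ltW.
  apply: Hdl; rewrite ?x1 ?y1 ?(le_trans x2) ?(le_trans y2) //.
  exact: le_lt_trans xy hd.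
have : M * (1 - F K%:R) <= e / 6.
  apply: le_trans (_ : (M + 1) * (1 - F K%:R) <= _).
    by rewrite ler_wpM2r ?subr_ge0 // lerDl.
  rewrite mulrC -ler_pdivlMr ?ltr_wpDl //; apply: le_trans (ltW FK) _.
  by rewrite invfM mulrA.
lra.
Qed.
End Squeeze.

(** * Limits of averages along lists with prescribed moments *)

Section Moments.
Variable R : realType.
Implicit Types (f g phi psi : R -> R) (ls : seq R).

Definition avg phi ls : R := (\sum_(l <- ls) phi l) / (size ls)%:R.

Variables (beta : nat -> R) (A0 C0 : R).
Hypothesis C0_ge1 : 1 <= C0.
Hypothesis beta_le : forall m, `|beta m| <= A0 * C0 ^+ m * m`!%:R.

Definition good (N : nat) (d : R) ls : Prop :=
  [/\ ls != [::], all (>= 0) ls &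
    forall m, (m < N)%N -> `|avg (fun x => x ^+ m) ls - beta m| < d].

Hypothesis good_ex : forall N d, 0 < d -> exists ls, good N d ls.

Lemma good_weaken N d N' d' ls : (N' <= N)%N -> d <= d' -> good N d ls -> good N' d' ls.
Proof.
move=> NN dd [ls0 lp H]; split=> // m mN; apply: lt_le_trans dd; apply: H.
exact: leq_trans NN.
Qed.

(** The filter of properties that hold once enough moments are close enough to [beta]; [good_ex]
    makes it proper. *)
Definition near_good (P : seq R -> Prop) := exists N d, 0 < d /\ forall ls, good N d ls -> P ls.

Lemma near_goodI P1 P2 : near_good P1 -> near_good P2 -> near_good (fun ls => P1 ls /\ P2 ls).
Proof.
move=> [N1 [d1 [d10 H1]]] [N2 [d2 [d20 H2]]].
exists (maxn N1 N2), (Num.min d1 d2); rewrite lt_min d10 d20; split=> // ls H.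
split; [apply: H1|apply: H2]; apply: good_weaken H;
  by rewrite ?leq_maxl ?leq_maxr // ge_min lexx ?orbT.
Qed.

Lemma near_goodS P1 P2 : (forall ls, ls != [::] -> all (>= 0) ls -> P1 ls -> P2 ls) ->
  near_good P1 -> near_good P2.
Proof. by move=> H [N [d [d0 HP]]]; exists N, d; split=> // ls gl; have [? ? _] := gl; apply/H/HP. Qed.

Lemma near_good_ex P : near_good P -> exists2 ls, (ls != [::] /\ all (>= 0) ls) & P ls.
Proof. by move=> [N [d [d0 H]]]; have [ls gl] := good_ex N d0; exists ls; [case: gl|exact: H]. Qed.

Lemma avgD f g ls : avg (fun x => f x + g x) ls = avg f ls + avg g ls.
Proof. by rewrite /avg big_split mulrDl. Qed.

Lemma avgZ c f ls : avg (fun x => c * f x) ls = c * avg f ls.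
Proof. by rewrite /avg -mulr_sumr mulrA. Qed.

Lemma avgB f g ls : avg (fun x => f x - g x) ls = avg f ls - avg g ls.
Proof. by rewrite /avg sumrB mulrBl. Qed.

Lemma avg_cst c ls : ls != [::] -> avg (fun=> c) ls = c.
Proof.
move=> l0; rewrite /avg big_const_seq count_predT iter_addr_0 -[c *+ _]mulr_natr mulfK //.
by rewrite pnatr_eq0 size_eq0.
Qed.

Lemma avg_sum (I : Type) (r : seq I) (P : pred I) (F : I -> R -> R) ls :
  avg (fun x => \sum_(i <- r | P i) F i x) ls = \sum_(i <- r | P i) avg (F i) ls.
Proof. by rewrite /avg exchange_big mulr_suml. Qed.

Lemma le_avg f g ls : all (>= 0) ls -> (forall x, 0 <= x -> f x <= g x) -> avg f ls <= avg g ls.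
Proof.
move=> /allP l0 fg; rewrite /avg ler_wpM2r ?invr_ge0 // big_seq [leRHS]big_seq.
by apply: ler_sum => x /l0; apply: fg.
Qed.

Lemma avg_dist f g h ls : all (>= 0) ls -> (forall x, 0 <= x -> `|f x - g x| <= h x) ->
  `|avg f ls - avg g ls| <= avg h ls.
Proof.
move=> lp H; rewrite -avgB ler_norml -[- avg h ls]mulN1r -avgZ.
by apply/andP; split; apply: le_avg => // x /H; rewrite ler_norml ?mulN1r => /andP[].
Qed.

(* phi has a deterministic limit average along lists whose moments tend to beta. *)
Definition lim_avg phi (v : R) := forall e, 0 < e -> near_good (fun ls => `|avg phi ls - v| < e).
Definition has_lim phi := exists v, lim_avg phi v.

Lemma lim_avg_cst c : lim_avg (fun=> c) c.
Proof.
move=> e e0; exists 0%N, 1; split=> // ls [l0 _ _].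
by rewrite avg_cst // subrr normr0.
Qed.

Lemma lim_avg_pow m : lim_avg (fun x => x ^+ m) (beta m).
Proof. by move=> e e0; exists m.+1, e; split=> // ls [_ _]; apply. Qed.

Lemma lim_avgD f g u v : lim_avg f u -> lim_avg g v -> lim_avg (fun x => f x + g x) (u + v).
Proof.
move=> Hf Hg e e0; have e2 : 0 < e / 2 by rewrite divr_gt0.
apply: near_goodS (near_goodI (Hf _ e2) (Hg _ e2)) => ls _ _ [H1 H2].
rewrite avgD opprD addrACA; apply: le_lt_trans (ler_normD _ _) _.
by rewrite [ltRHS]splitr ltrD.
Qed.

Lemma lim_avgZ c f u : lim_avg f u -> lim_avg (fun x => c * f x) (c * u).
Proof.
move=> Hf e e0; have c1 : 0 < `|c| + 1 by rewrite ltr_wpDl.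
apply: near_goodS (Hf _ (divr_gt0 e0 c1)) => ls _ _ H.
rewrite avgZ -mulrBr normrM; apply: le_lt_trans (_ : (`|c| + 1) * `|avg f ls - u| < _).
  by rewrite ler_wpM2r // lerDl.
by rewrite mulrC -ltr_pdivlMr.
Qed.

Lemma lim_avg_sum (I : Type) (r : seq I) (F : I -> R -> R) (v : I -> R) :
  (forall i, lim_avg (F i) (v i)) ->
  lim_avg (fun x => \sum_(i <- r) F i x) (\sum_(i <- r) v i).
Proof.
move=> H; elim: r => [|i r IH].
  rewrite big_nil (_ : (fun _ => _) = fun=> 0); first exact: lim_avg_cst.
  by apply/funext => x; rewrite big_nil.
rewrite big_cons (_ : (fun _ => _) = fun x => F i x + \sum_(i <- r) F i x).
  exact: lim_avgD.
by apply/funext => x; rewrite big_cons.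
Qed.

Lemma lim_avg_le f g u v : lim_avg f u -> lim_avg g v ->
  (forall x, 0 <= x -> f x <= g x) -> u <= v.
Proof.
move=> Hf Hg fg; rewrite leNgt; apply/negP => vu.
have e0 : 0 < (u - v) / 2 by rewrite divr_gt0 // subr_gt0.
have [ls [_ lp] []] := near_good_ex (near_goodI (Hf _ e0) (Hg _ e0)).
have := le_avg lp fg; rewrite !ltr_norml => H /andP[H1 H2] /andP[H3 H4]; lra.
Qed.

Lemma lim_avg_uniq f u v : lim_avg f u -> lim_avg f v -> u = v.
Proof. by move=> H1 H2; apply/eqP; rewrite eq_le !(lim_avg_le H1 H2, lim_avg_le H2 H1). Qed.

(** The limit is the supremum of the numbers that are eventually lower bounds of the average. *)
Lemma has_lim_cauchy phi :
  (forall e, 0 < e -> exists2 v, near_good (fun ls => `|avg phi ls - v| < e) & True) ->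
  has_lim phi.
Proof.
move=> H; pose S : set R := fun x => near_good (fun ls => x <= avg phi ls).
have Slow e v : 0 < e -> near_good (fun ls => `|avg phi ls - v| < e) -> S (v - e).
  by move=> e0; apply: near_goodS => ls _ _; rewrite ltr_norml => /andP[]; lra.
have Sup e v x : 0 < e -> near_good (fun ls => `|avg phi ls - v| < e) -> S x -> x <= v + e.
  move=> e0 H1 H2; have [ls _ []] := near_good_ex (near_goodI H1 H2).
  by rewrite ltr_norml => /andP[]; lra.
have hS : has_sup S.
  have [v Hv _] := H 1 ltr01; split; first by exists (v - 1); apply: Slow.
  by exists (v + 1) => x; apply: Sup.
exists (sup S) => e e0; have e2 : 0 < e / 2 by rewrite divr_gt0.
have [v Hv _] := H _ e2.
have h1 : v - e / 2 <= sup S by apply: sup_upper_bound => //; apply: Slow.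
have h2 : sup S <= v + e / 2 by apply: sup_le_ub; [case: hS|move=> x; apply: Sup].
apply: near_goodS Hv => ls _ _; rewrite !ltr_norml => /andP[]; lra.
Qed.

Lemma has_lim_approx phi :
  (forall e, 0 < e -> exists psi, has_lim psi /\
     near_good (fun ls => `|avg phi ls - avg psi ls| < e)) -> has_lim phi.
Proof.
move=> H; apply: has_lim_cauchy => e e0; have e2 : 0 < e / 2 by rewrite divr_gt0.
have [psi [[v Hv] H2]] := H _ e2; exists v => //.
apply: near_goodS (near_goodI (Hv _ e2) H2) => ls _ _ [].
by rewrite !ltr_norml => /andP[] + + /andP[]; lra.
Qed.

Let C0_gt0 : 0 < C0.
Proof. exact: lt_le_trans C0_ge1. Qed.

(** As (m+J)! is at most m! J! 2^(m+J), the Taylor error of order J at rate t is of order (2 C0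
    t)^J; this t makes it 2^-J. *)
Definition damp : R := (4 * C0)^-1.

Lemma A0_ge0 : 0 <= A0.
Proof. by have := beta_le 0; rewrite expr0 fact0 !mulr1; apply: le_trans. Qed.

Lemma fact_addn m J : ((m + J)`! <= m`! * J`! * 2 ^ (m + J))%N.
Proof.
rewrite -(@bin_fact (m + J) J) ?leq_addl // addnK mulnC [(J`! * _)%N]mulnC leq_mul2l.
apply/orP; right; rewrite -[X in (_ <= 2 ^ X)%N](card_ord (m + J)) -cardsT -card_powerset.
rewrite -[X in ('C(X, _) <= _)%N](card_ord (m + J)) -cardsT -cards_draws.
by apply: subset_leq_card; apply/fintype.subsetP => A; rewrite !inE => /andP[].
Qed.

(** Only one exponential factor is expanded per step, while the other i are at most 1; so the error
    never exceeds that of rate [damp], although the series at rate (i+1) [damp] may diverge on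
    average. The powers x^m are carried along because the expansion creates them. *)
Lemma has_lim_exp m i : has_lim (fun x => x ^+ m * expR (- (damp * x)) ^+ i).
Proof.
have d0 : 0 < damp by rewrite invr_gt0 mulr_gt0.
elim: i m => [|i IH] m.
  exists (beta m); rewrite (_ : (fun _ => _) = fun x => x ^+ m); first exact: lim_avg_pow.
  by apply/funext => x; rewrite expr0 mulr1.
apply: has_lim_approx => e e0.
have K0 : 0 < (A0 * m`!%:R * (2 * C0) ^+ m + 1) + 1.
  by rewrite ltr_wpDl // addr_ge0 // !mulr_ge0 ?A0_ge0 // exprn_ge0 // mulr_ge0 // ltW.
pose K := A0 * m`!%:R * (2 * C0) ^+ m + 1.
have [J HJ] : exists J, K * 2^-1 ^+ J + damp ^+ J / J`!%:R < e.
  exists (Num.bound ((K + 1) / e)); set J := Num.bound _.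
  have bJ : (K + 1) / e < J%:R by apply/archi_boundP/divr_ge0; apply: ltW.
  have J2 : J%:R < 2 ^+ J :> R by rewrite -natrX ltr_nat ltn_expl.
  apply: (@le_lt_trans _ _ ((K + 1) * 2^-1 ^+ J)).
    rewrite [(K + 1) * _]mulrDl mul1r lerD2l ler_pdivrMr ?ltr0n ?fact_gt0 //.
    apply: le_trans (_ : 2^-1 ^+ J * 1 <= _); last first.
      by rewrite ler_wpM2l ?exprn_ge0 ?invr_ge0 // ler1n fact_gt0.
    have dh : damp <= 2^-1.
      by rewrite /damp lef_pV2 ?posrE ?mulr_gt0 //; have := C0_ge1; lra.
    rewrite mulr1; apply: lerXn2r dh; rewrite nnegrE; [exact: ltW d0|by rewrite invr_ge0].
  rewrite exprVn ltr_pdivrMr ?exprn_gt0 // mulrC -ltr_pdivrMr //.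
  exact: lt_trans bJ J2.
have [v hv] := boolp.choice (fun j : 'I_J => IH (m + j)%N).
exists (fun x => \sum_(j < J) ((- damp) ^+ j / j`!%:R) * (x ^+ (m + j) * expR (- (damp * x)) ^+ i)).
split.
  exists (\sum_(j < J) ((- damp) ^+ j / j`!%:R) * v j).
  by apply: lim_avg_sum => j; apply: lim_avgZ.
have H x : 0 <= x -> `|x ^+ m * expR (- (damp * x)) ^+ i.+1 -
     \sum_(j < J) ((- damp) ^+ j / j`!%:R) * (x ^+ (m + j) * expR (- (damp * x)) ^+ i)|
    <= damp ^+ J / J`!%:R * x ^+ (m + J).
  move=> x0; have dx : 0 <= damp * x by rewrite mulr_ge0 // ltW.
  have -> : x ^+ m * expR (- (damp * x)) ^+ i.+1 -
     \sum_(j < J) ((- damp) ^+ j / j`!%:R) * (x ^+ (m + j) * expR (- (damp * x)) ^+ i) =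
     x ^+ m * expR (- (damp * x)) ^+ i * exp_tail J (damp * x).
    rewrite /exp_tail mulrBr -mulrA -exprSr; congr (_ - _).
    rewrite mulr_sumr; apply: eq_bigr => j _.
    by rewrite exprD -mulNr exprMn; ring.
  have E1 : expR (- (damp * x)) ^+ i <= 1.
    by rewrite exprn_ile1 ?expR_ge0 // -expR0 ler_expR oppr_le0.
  rewrite !normrM (ger0_norm (exprn_ge0 _ x0)) (ger0_norm (exprn_ge0 _ (expR_ge0 _))).
  apply: le_trans (ler_wpM2l _ (exp_tail_le J dx)) _.
    by rewrite mulr_ge0 ?exprn_ge0 ?expR_ge0.
  rewrite exprMn exprD [leRHS](_ : _ = x ^+ m * 1 * (damp ^+ J * x ^+ J / J`!%:R)); last by ring.
  apply: ler_wpM2r; last by rewrite ler_wpM2l ?exprn_ge0.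
  by rewrite mulr_ge0 ?invr_ge0 // mulr_ge0 ?exprn_ge0 // ltW.
(* The moment of order m + J alone bounds the error; knowing it up to 1 accounts for the extra term
   damp^J / J! in the choice of J. *)
exists (m + J).+1, 1; split=> // ls [ls0 lp Hm].
apply: le_lt_trans (avg_dist lp H) _; rewrite avgZ.
have {}Hm := Hm (m + J)%N (ltnSn _).
have le1 : avg (fun x => x ^+ (m + J)) ls <= A0 * C0 ^+ (m + J) * (m + J)`!%:R + 1.
  have := beta_le (m + J); move: Hm; rewrite ltr_norml ler_norml => /andP[_ a] /andP[_ b]; lra.
have dJ : 0 <= damp ^+ J / J`!%:R by rewrite mulr_ge0 ?invr_ge0 ?exprn_ge0 // ltW.
apply: le_lt_trans (ler_wpM2l dJ le1) _; apply: le_lt_trans HJ.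
rewrite mulrDr mulr1 lerD2r.
have f0 : J`!%:R != 0 :> R by rewrite pnatr_eq0 -lt0n fact_gt0.
have -> : K = A0 * m`!%:R * (2 * C0) ^+ m + 1 by [].
apply: (@le_trans _ _ (A0 * m`!%:R * (2 * C0) ^+ m * 2^-1 ^+ J)); last first.
  by rewrite ler_wpM2r ?exprn_ge0 ?invr_ge0 // lerDl.
have -> : A0 * m`!%:R * (2 * C0) ^+ m * 2^-1 ^+ J =
  damp ^+ J / J`!%:R * (A0 * C0 ^+ (m + J) * (m`! * J`! * 2 ^ (m + J))%:R).
  rewrite !natrM natrX !exprD !exprMn.
  have -> : damp ^+ J = 2^-1 ^+ J * 2^-1 ^+ J * C0^-1 ^+ J.
    by rewrite -!exprMn; congr (_ ^+ _); rewrite /damp; field; rewrite gt_eqF.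
  have e1 : C0^-1 ^+ J * C0 ^+ J = 1 by rewrite -exprMn mulVf ?gt_eqF // expr1n.
  have e2 : 2^-1 ^+ J * 2 ^+ J = 1 :> R by rewrite -exprMn mulVf // expr1n.
  rewrite [RHS](_ : _ = (A0 * m`!%:R * (2 ^+ m * C0 ^+ m)) * 2^-1 ^+ J *
    (2^-1 ^+ J * 2 ^+ J) * (C0^-1 ^+ J * C0 ^+ J) * (J`!%:R / J`!%:R)); last by ring.
  by rewrite e1 e2 divff // !mulr1.
apply: ler_wpM2l => //; apply: ler_wpM2l; last by rewrite ler_nat fact_addn.
by rewrite mulr_ge0 ?A0_ge0 // exprn_ge0 // ltW.
Qed.

Lemma has_lim_poly (p : {poly R}) : has_lim (fun x => p.[expR (- (damp * x))]).
Proof.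
have [v hv] := boolp.choice (fun i : 'I_(size p) => has_lim_exp 0 i).
exists (\sum_(i < size p) p`_i * v i).
rewrite (_ : (fun _ => _) = fun x => \sum_(i < size p) p`_i * (x ^+ 0 * expR (- (damp * x)) ^+ i)).
  by apply: lim_avg_sum => i; apply: lim_avgZ.
by apply/funext => x; rewrite horner_coef; apply: eq_bigr => i _; rewrite expr0 mul1r.
Qed.

(* [bern N h a] at y is the mean of h after N steps of a walk from a which moves
   up with probability y. *)
Fixpoint bern N (h : nat -> R) a : {poly R} :=
  if N is N'.+1 then 'X * bern N' h a.+1 + (1 - 'X) * bern N' h a else (h a)%:P.

Lemma bernS N h a y : (bern N.+1 h a).[y] =
  y * (bern N h a.+1).[y] + (1 - y) * (bern N h a).[y].
Proof. by rewrite /= !hornerE. Qed.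

(** The number of upward moves has mean N y and variance N y (1 - y). *)
Lemma bern_quadratic N e K b a y :
  (bern N (fun j => e + K * (j%:R - b) ^+ 2) a).[y] =
    e + K * ((a%:R + N%:R * y - b) ^+ 2 + N%:R * y * (1 - y)).
Proof.
elim: N a => [|N IH] a; first by rewrite /= hornerC; ring.
by rewrite bernS !IH -!natr1; ring.
Qed.

Lemma bern_dist N h u b a y : 0 <= y <= 1 -> (forall j, `|h j - b| <= u j) ->
  `|(bern N h a).[y] - b| <= (bern N u a).[y].
Proof.
move=> /andP[y0 y1] hu; elim: N a => [|N IH] a; first by rewrite /= !hornerC.
rewrite !bernS.
have -> : y * (bern N h a.+1).[y] + (1 - y) * (bern N h a).[y] - b =
  y * ((bern N h a.+1).[y] - b) + (1 - y) * ((bern N h a).[y] - b) by ring.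
have y1' : 0 <= 1 - y by rewrite subr_ge0.
apply: le_trans (ler_normD _ _) _; rewrite !normrM (ger0_norm y0) (ger0_norm y1').
by apply: lerD; apply: ler_wpM2l.
Qed.

(** The inverse of x -> exp(- damp x), clipped so that with y0 = exp(- damp K) it is defined
    everywhere and takes values in [0, K]. *)
Definition back y0 a : R := - ln (Num.max y0 (Num.min a 1)) / damp.

Lemma damp_gt0 : 0 < damp.
Proof. by rewrite invr_gt0 mulr_gt0. Qed.

Lemma back_expR K x : 0 <= x <= K -> back (expR (- (damp * K))) (expR (- (damp * x))) = x.
Proof.
move=> /andP[x0 xK]; have d0 := damp_gt0.
rewrite /back min_l; last by rewrite -expR0 ler_expR oppr_le0 mulr_ge0 // ltW.
rewrite max_r ?ler_expR ?lerN2 ?ler_pM2l // expRK opprK mulrC mulKf //.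
by rewrite gt_eqF.
Qed.

Lemma back_range K a : 0 <= K -> 0 <= back (expR (- (damp * K))) a <= K.
Proof.
move=> K0; have d0 := damp_gt0; rewrite /back.
set y0 := expR _; set z := Num.max _ _.
have y00 : 0 < y0 := expR_gt0 _.
have y01 : y0 <= 1 by rewrite -expR0 ler_expR oppr_le0 mulr_ge0 // ltW.
have z0 : y0 <= z by rewrite le_max lexx.
have z1 : z <= 1 by rewrite ge_max y01 ge_min lexx orbT.
have zp : 0 < z by apply: lt_le_trans z0.
apply/andP; split.
  rewrite mulNr oppr_ge0 pmulr_lle0; first exact: ln_le0.
  by rewrite invr_gt0.
rewrite mulNr lerNl ler_pdivlMr // mulNr mulrC -[X in X <= _]expRK.
by rewrite ler_ln ?posrE.
Qed.

Lemma ln_lip (y0 a b : R) : 0 < y0 -> y0 <= a -> y0 <= b -> `|ln a - ln b| <= `|a - b| / y0.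
Proof.
move=> y00; wlog ab : a b / b <= a => [H ya yb|].
  by case: (leP b a) => [ab|/ltW ab]; [|rewrite distrC [`|a - b|]distrC]; apply: H.
move=> ya yb; have b0 : 0 < b by apply: lt_le_trans yb.
have a0 : 0 < a by apply: lt_le_trans ya.
rewrite !ger0_norm ?subr_ge0 ?ler_ln ?posrE //.
rewrite -ln_div ?posrE // -(addrNK 1 (a / b)) addrC.
apply: le_trans (le_ln1Dx _) _.
  by rewrite ltrBrDl subrr divr_gt0.
have -> : a / b - 1 = (a - b) / b by rewrite mulrBl divff // gt_eqF.
by rewrite ler_wpM2l ?subr_ge0 // lef_pV2 ?posrE.
Qed.

(** Bernstein's argument: uniform continuity and boundedness combine into one quadratic estimate
    [key], valid for near and far points alike, and the binomial variance makes its average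
    small. *)
Lemma poly_approx f M K e : 0 <= K -> 0 < e -> (forall x, `|f x| <= M) -> ucont_on f 0 K ->
  exists p : {poly R}, forall y, 0 <= y <= 1 ->
    `|p.[y] - f (back (expR (- (damp * K))) y)| <= e.
Proof.
move=> K0 e0 fM uf; have d0 := damp_gt0.
set y0 := expR _; have y00 : 0 < y0 := expR_gt0 _.
have M0 : 0 <= M by apply: le_trans (fM 0).
have e2 : 0 < e / 2 by rewrite divr_gt0.
have [dl dl0 Hdl] := uf _ e2.
(* Points closer than r have images under [back] closer than dl: above y0 the logarithm has
   Lipschitz constant 1 / y0. *)
pose r := dl * (y0 * damp); have r0 : 0 < r by rewrite !mulr_gt0.
pose K2 := 2 * M / r ^+ 2.
have K20 : 0 <= K2 by rewrite divr_ge0 ?mulr_ge0 ?exprn_ge0 // ltW.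
have key a b : `|f (back y0 a) - f (back y0 b)| <= e / 2 + K2 * (a - b) ^+ 2.
  have [ab|ab] := ltP `|a - b| r.
    have /Hdl H : 0 <= back y0 a <= K by apply: back_range.
    have {}H := H (back y0 b) (back_range b K0).
    apply: le_trans (ltW (H _)) _; last by rewrite lerDl mulr_ge0 ?sqr_ge0.
    rewrite /back -mulrBl normrM [`|damp^-1|]ger0_norm; last by rewrite invr_ge0 ltW.
    rewrite ltr_pdivrMr // opprK addrC distrC.
    apply: le_lt_trans (ln_lip y00 _ _) _; rewrite ?le_max ?lexx //.
    rewrite ltr_pdivrMr // 2!(minC _ 1); apply: le_lt_trans (clip_lip _ _ _ _) _.
    by apply: lt_le_trans ab _; rewrite /r mulrA mulrAC -mulrA.
  apply: (@le_trans _ _ (2 * M)).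
    by apply: le_trans (ler_normB _ _) _; rewrite mulr_natl mulr2n lerD.
  rewrite ler_wpDl ?(ltW e2) // /K2 -mulrA ler_peMr ?mulr_ge0 //.
  rewrite mulrC ler_pdivlMr ?exprn_gt0 // mul1r -real_normK ?num_real //.
  by apply: lerXn2r ab; rewrite nnegrE // ltW.
pose N := (Num.bound (2 * K2 / e)).+1.
have N0 : 0 < N%:R :> R by rewrite ltr0n.
have NK : K2 / N%:R <= e / 2.
  have : 2 * K2 / e < N%:R.
    apply: lt_le_trans (archi_boundP _) _; last by rewrite ler_nat.
    exact: divr_ge0 (mulr_ge0 (ler0n _ 2) K20) (ltW e0).
  rewrite ltr_pdivrMr // ler_pdivrMr // => H; lra.
exists (bern N (fun j => f (back y0 (j%:R / N%:R))) 0) => y y01.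
apply: le_trans (bern_dist (u := fun j => e / 2 + K2 / N%:R ^+ 2 * (j%:R - N%:R * y) ^+ 2) _ _ y01 _) _.
  move=> j; apply: le_trans (key _ _) _; rewrite lerD2l le_eqVlt; apply/orP; left; apply/eqP.
  by field; rewrite gt_eqF.
rewrite bern_quadratic add0r subrr expr0n /= add0r.
have -> : K2 / N%:R ^+ 2 * (N%:R * y * (1 - y)) = K2 / N%:R * (y * (1 - y)).
  by field; rewrite gt_eqF.
have yy : y * (1 - y) <= 1 by move/andP: y01 => [a b]; nra.
have := ler_wpM2l (divr_ge0 K20 (ltW N0)) yy; rewrite mulr1; lra.
Qed.

(** Beyond K the polynomial follows [f] at a different point, which costs at most 2 M <= 2 M x / K.
    The first moment controls the average of this bound, and K is chosen to make it at most e /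
    4. *)
Lemma has_lim_ucont f M : (forall x, `|f x| <= M) -> (forall K, ucont_on f 0 K) -> has_lim f.
Proof.
move=> fM uf; have M0 : 0 <= M by apply: le_trans (fM 0).
have d0 := damp_gt0.
apply: has_lim_approx => e e0; have e4 : 0 < e / 4 by rewrite divr_gt0.
pose K := 4 * (2 * M * (`|beta 1| + 1)) / e + 1.
have K0 : 0 < K by rewrite ltr_wpDl // divr_ge0 ?mulr_ge0 ?addr_ge0 // ltW.
have [p Hp] := poly_approx (ltW K0) e4 fM (uf K).
exists (fun x => p.[expR (- (damp * x))]); split; first exact: has_lim_poly.
have H x : 0 <= x -> `|f x - p.[expR (- (damp * x))]| <= e / 4 + 2 * M / K * x ^+ 1.
  move=> x0; set y := expR _.
  have y01 : 0 <= y <= 1.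
    by rewrite expR_ge0 -expR0 ler_expR oppr_le0 mulr_ge0 // ltW.
  have {}Hp := Hp _ y01; have [xK|xK] := leP x K.
    rewrite distrC -[x in f x](back_expR (K := K)) ?x0 //; apply: le_trans Hp _.
    by rewrite lerDl !mulr_ge0 ?invr_ge0 // ltW.
  apply: le_trans (ler_distD (f (back (expR (- (damp * K))) y)) _ _) _.
  rewrite addrC; apply: lerD; first by rewrite distrC.
  apply: (@le_trans _ _ (2 * M)).
    by apply: le_trans (ler_normB _ _) _; rewrite mulr_natl mulr2n lerD.
  rewrite expr1 -mulrA ler_peMr ?mulr_ge0 // mulrC ler_pdivlMr // mul1r ltW //.
exists 2%N, 1; split=> // ls [ls0 lp Hm].
apply: le_lt_trans (avg_dist lp H) _; rewrite avgD avg_cst // avgZ.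
have := Hm 1%N isT; set av := avg _ ls => Hav.
have av1 : av <= `|beta 1| + 1.
  by move: Hav; rewrite ltr_norml => /andP[_]; have := ler_norm (beta 1); lra.
have c0 : 0 <= 2 * M / K by rewrite divr_ge0 ?mulr_ge0 // ltW.
have := ler_wpM2l c0 av1.
suff : 2 * M / K * (`|beta 1| + 1) <= e / 4.
  by move=> h1 h2; lra.
rewrite mulrAC ler_pdivrMr //.
have -> : e / 4 * K = 2 * M * (`|beta 1| + 1) + e / 4.
  by rewrite /K; field; rewrite gt_eqF.
lra.
Qed.

Definition Lim phi : R := xget 0 [set v | lim_avg phi v].

Lemma LimP phi : has_lim phi -> lim_avg phi (Lim phi).
Proof. by case=> v hv; apply: (@xgetPex _ 0 [set v | lim_avg phi v]); exists v. Qed.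

Lemma Lim_eq phi v : lim_avg phi v -> Lim phi = v.
Proof. by move=> hv; apply: (lim_avg_uniq (LimP _) hv); exists v. Qed.

Lemma ramp_ucont (a h x y : R) : 0 < h -> ucont_on (ramp a h) x y.
Proof.
move=> h0 e e0; exists (e * h); first exact: mulr_gt0.
move=> u v _ _ uv; apply: le_lt_trans (ramp_lip _ _ _ _ h0) _.
rewrite ltr_pdivrMr // (_ : a - u - (a - v) = v - u); last by ring.
by rewrite distrC.
Qed.

Lemma has_lim_ramp a h : 0 < h -> has_lim (ramp a h).
Proof.
move=> h0; apply: (@has_lim_ucont _ 1) => [x|K]; last exact: ramp_ucont.
by have /andP[r0 r1] := ramp_range a h x; rewrite ger0_norm.
Qed.

(* The infimum over the width of the ramps makes [cdf] right-continuous. *)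
Definition cdf (a : R) : R := inf [set Lim (ramp a h) | h in [set h | 0 < h]].

Lemma Lim_le f g : has_lim f -> has_lim g -> (forall x, 0 <= x -> f x <= g x) -> Lim f <= Lim g.
Proof. by move=> /LimP Hf /LimP Hg; apply: lim_avg_le Hf Hg. Qed.

Lemma Lim_cst c : Lim (fun=> c) = c.
Proof. exact/Lim_eq/lim_avg_cst. Qed.

Lemma has_lim_cst c : has_lim (fun=> c).
Proof. by exists c; apply: lim_avg_cst. Qed.

Lemma LimD f g : has_lim f -> has_lim g -> Lim (fun x => f x + g x) = Lim f + Lim g.
Proof. by move=> /LimP Hf /LimP Hg; apply/Lim_eq/lim_avgD. Qed.

Lemma LimZ c f : has_lim f -> Lim (fun x => c * f x) = c * Lim f.
Proof. by move=> /LimP Hf; apply/Lim_eq/lim_avgZ. Qed.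

Lemma has_limD f g : has_lim f -> has_lim g -> has_lim (fun x => f x + g x).
Proof. by move=> [u Hf] [v Hg]; exists (u + v); apply: lim_avgD. Qed.

Lemma has_limZ c f : has_lim f -> has_lim (fun x => c * f x).
Proof. by move=> [u Hf]; exists (c * u); apply: lim_avgZ. Qed.

Lemma Lim_ramp_range a h : 0 < h -> 0 <= Lim (ramp a h) <= 1.
Proof.
move=> h0; have hr := has_lim_ramp a h0.
rewrite -[X in X <= _](Lim_cst 0) -[X in _ && (_ <= X)](Lim_cst 1).
apply/andP; split; apply: Lim_le => //; try exact: has_lim_cst.
  by move=> x _; have /andP[] := ramp_range a h x.
by move=> x _; have /andP[] := ramp_range a h x.
Qed.

Lemma cdf_has_inf a : has_inf [set Lim (ramp a h) | h in [set h | 0 < h]].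
Proof.
split; first by exists (Lim (ramp a 1)); exists 1 => //=.
by exists 0 => _ [h /= h0 <-]; have /andP[] := Lim_ramp_range a h0.
Qed.

Lemma cdf_le a h : 0 < h -> cdf a <= Lim (ramp a h).
Proof. by move=> h0; apply: ge_inf; [case: (cdf_has_inf a)|exists h]. Qed.

Lemma le_cdf a v : (forall h, 0 < h -> v <= Lim (ramp a h)) -> v <= cdf a.
Proof.
by move=> H; apply: lb_le_inf; [case: (cdf_has_inf a)|move=> _ [h h0 <-]; apply: H].
Qed.

Lemma cdf_ge a h : 0 < h -> Lim (ramp a h) <= cdf (a + h).
Proof.
move=> h0; apply: le_cdf => h' h'0; apply: Lim_le; try exact: has_lim_ramp.
by move=> x _; apply: ramp_le_shift.
Qed.

Lemma cdf_nd : {homo cdf : a b / a <= b}.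
Proof.
move=> a b ab; apply: le_cdf => h h0; apply: le_trans (cdf_le a h0) _.
by apply: Lim_le; try exact: has_lim_ramp; move=> x _; apply: le_ramp.
Qed.

Lemma cdf_ge0 a : 0 <= cdf a.
Proof. by apply: le_cdf => h h0; have /andP[] := Lim_ramp_range a h0. Qed.

Lemma cdf_le1 a : cdf a <= 1.
Proof. by apply: le_trans (cdf_le a ltr01) _; have /andP[] := Lim_ramp_range a ltr01. Qed.

Lemma cdf_neg a : a < 0 -> cdf a = 0.
Proof.
move=> a0; apply/eqP; rewrite eq_le cdf_ge0 andbT.
have h0 : 0 < - a by rewrite oppr_gt0.
apply: le_trans (cdf_le a h0) _; rewrite -[leRHS](Lim_cst 0).
apply: Lim_le; [exact: has_lim_ramp|exact: has_lim_cst|move=> x x0].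
by rewrite ramp0 // subrr.
Qed.

Lemma cdf_tail (K : R) : 0 < K -> 1 - cdf (K + 1) <= beta 1 / K.
Proof.
move=> K0; have := cdf_ge K ltr01.
suff : 1 - beta 1 / K <= Lim (ramp K 1) by lra.
have hx : lim_avg (fun x => 1 + - K^-1 * x ^+ 1) (1 + - K^-1 * beta 1).
  by apply: lim_avgD (lim_avg_cst 1) (lim_avgZ _ (lim_avg_pow 1)).
have -> : 1 - beta 1 / K = 1 + - K^-1 * beta 1 by ring.
apply: lim_avg_le hx (LimP (has_lim_ramp K ltr01)) _ => x x0; rewrite expr1.
case: (leP x K) => xK.
  by rewrite ramp1 // mulNr gerBl mulr_ge0 // invr_ge0 ltW.
have /andP[r0 _] := ramp_range K 1 x; apply: le_trans r0.
by rewrite mulNr subr_le0 mulrC ler_pdivlMr // mul1r ltW.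
Qed.

Lemma cdf_lim e : 0 < e -> exists n : nat, 1 - cdf n%:R < e.
Proof.
move=> e0; pose K := Num.bound (`|beta 1| / e).
have bK : `|beta 1| / e < K%:R by apply/archi_boundP/divr_ge0 => //; apply: ltW.
have K0 : 0 < K%:R :> R by apply: le_lt_trans bK; apply: divr_ge0 => //; apply: ltW.
exists K.+1; rewrite -natr1; apply: le_lt_trans (cdf_tail K0) _.
rewrite ltr_pdivrMr //; move: bK; rewrite ltr_pdivrMr // mulrC.
exact/le_lt_trans/ler_norm.
Qed.

(** With h nearly optimal for [cdf a], moving the ramp from a to b changes it by at most (b - a) /
    h. *)
Lemma cdf_right_near a e : 0 < e -> exists2 d, 0 < d & forall b, a <= b < a + d -> cdf b < cdf a + e.
Proof.
move=> e0; have e2 : 0 < e / 2 by rewrite divr_gt0.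
have [_ [h /= h0 <-] hh] := inf_adherent e2 (cdf_has_inf a).
exists (h * (e / 2)); first exact: mulr_gt0.
move=> b /andP[ab bd]; apply: le_lt_trans (cdf_le b h0) _.
suff : Lim (ramp b h) <= Lim (ramp a h) + (b - a) / h.
  have : (b - a) / h < e / 2 by rewrite ltr_pdivrMr // mulrC; lra.
  by move: hh; rewrite -/(cdf a); lra.
rewrite -[X in _ + X]Lim_cst -LimD; [|exact: has_lim_ramp|exact: has_lim_cst].
apply: Lim_le; [exact: has_lim_ramp|by apply: has_limD; [exact: has_lim_ramp|exact: has_lim_cst]|].
move=> x _; have := ramp_lip b a x x h0.
rewrite (_ : b - x - (a - x) = b - a); last by ring.
by rewrite [X in _ <= X / _]ger0_norm ?subr_ge0 // ler_norml => /andP[]; lra.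
Qed.

Lemma cdf_rc : (forall x, cdf @ at_right x --> cdf x)%classic.
Proof.
move=> a; apply/cvgrPdist_lt => e e0; have [d d0 Hd] := cdf_right_near a e0.
near=> b; have ab : a < b by near: b; exact: nbhs_right_gt.
rewrite distrC ger0_norm ?subr_ge0 ?cdf_nd ?ltW // ltrBlDl; apply: Hd.
rewrite (ltW ab) /=; near: b; apply: nbhs_right_lt; rewrite ltrDl //.
Unshelve. all: by end_near. Qed.

Lemma cdf_cvgy : (cdf @ +oo --> (1 : R))%classic.
Proof.
apply/cvgrPdist_lt => e e0; have [n Hn] := cdf_lim e0.
exists n%:R; split; first exact: num_real.
move=> x nx; rewrite ger0_norm ?subr_ge0 ?cdf_le1 //; apply: le_lt_trans Hn.
by rewrite lerD2l lerN2 cdf_nd // ltW.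
Qed.

Lemma cdf_cvgNy : (cdf @ -oo --> (0 : R))%classic.
Proof.
apply/cvgrPdist_lt => e e0; exists 0; split; first exact: num_real.
by move=> x x0; rewrite cdf_neg // subrr normr0.
Qed.

HB.instance Definition _ := isCumulative.Build R _ R cdf cdf_nd cdf_rc.
HB.instance Definition _ := isCumulativeBounded.Build R 0 1 cdf cdf_cvgNy cdf_cvgy.

Definition limit_law : probability (measurableTypeR R) R := lebesgue_stieltjes_measure cdf.

Lemma limit_law_itv a b : a <= b -> limit_law `]a, b]%classic = (cdf b - cdf a)%:E.
Proof.
move=> ab; rewrite /limit_law /= /lebesgue_stieltjes_measure.
rewrite /measure_extension measurable_mu_extE /=; last exact: is_ocitv.
by rewrite wlength_itv_bnd.
Qed.

Lemma bmeas_ramp (a h : R) : 0 < h -> bmeas (ramp a h).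
Proof.
move=> h0; split; last first.
  by exists 1 => x; have /andP[r0 r1] := ramp_range a h x; rewrite ger0_norm.
apply: continuous_measurable_fun => x; apply/cvgrPdist_lt => e e0.
near=> y; apply: le_lt_trans (ramp_lip _ _ _ _ h0) _.
rewrite ltr_pdivrMr // (_ : a - x - (a - y) = y - x); last by ring.
rewrite distrC; near: y.
have /cvgrPdist_lt : ((fun y : R => y) y @[y --> x] --> x)%classic by exact: cvg_id.
by apply; exact: mulr_gt0.
Unshelve. all: by end_near. Qed.

Lemma mean_law_itv (a b : R) : a <= b -> mean limit_law (\1_(`]a, b]%classic)) = cdf b - cdf a.
Proof.
move=> ab; rewrite mean_indic; last exact: measurable_itv.
by rewrite limit_law_itv.
Qed.

Lemma mean_law_ramp (a h : R) : 0 < h -> cdf a <= mean limit_law (ramp a h) <= cdf (a + h).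
Proof.
move=> h0; have br := bmeas_ramp a h0; apply/andP; split.
  (* A left end at which [cdf] vanishes stands in for minus infinity. *)
  pose b := Num.min a 0 - 1.
  have b0 : b < 0.
    by have : Num.min a 0 <= 0; [rewrite ge_min lexx orbT|rewrite /b; lra].
  have ba : b <= a.
    by have : Num.min a 0 <= a; [rewrite ge_min lexx|rewrite /b; lra].
  rewrite -[leLHS]subr0 -(cdf_neg b0) -mean_law_itv //.
  apply: mean_le => //; first by apply: bmeas_indic; exact: measurable_itv.
  move=> x; rewrite indicE; case: (boolP (x \in _)) => [|_]; last by have /andP[] := ramp_range a h x.
  by rewrite inE /= in_itv /= => /andP[_ xa]; rewrite ramp1.
apply/ler_addgt0Pl => e e0; have [n Hn] := cdf_lim e0.
(* A right end at which [cdf] is within e of 1 stands in for plus infinity. *)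
pose m := Num.max n%:R (a + h).
have am : a + h <= m by rewrite le_max lexx orbT.
have nm : cdf n%:R <= cdf m by rewrite cdf_nd // le_max lexx.
have mi : measurable (`]a + h, m]%classic : set (measurableTypeR R)) by exact: measurable_itv.
have bi := bmeas_scale (-1) (bmeas_indic mi).
apply: le_trans (_ : mean limit_law (fun x => 1 + -1 * \1_(`]a + h, m]%classic) x) <= _).
  apply: mean_le => //; first by apply: bmeas_add => //; exact: bmeas_cst.
  move=> x; rewrite indicE; case: (boolP (x \in _)) => [|_]; last first.
    by rewrite mulr0 addr0; have /andP[] := ramp_range a h x.
  by rewrite inE /= in_itv /= => /andP[/ltW xa _]; rewrite ramp0 // mulr1 subrr.
rewrite mean_add //; last exact: bmeas_cst.
rewrite mean_cst mean_scale; last exact: bmeas_indic.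
by rewrite mean_law_itv //; lra.
Qed.

Lemma mean_limit_law f M : bmeas f -> (forall x, `|f x| <= M) ->
  (forall a b, ucont_on f a b) -> mean limit_law f = Lim f.
Proof.
move=> bf fM uf; apply/esym.
apply: (@fnl_eq R (fun f => has_lim f /\ bmeas f) cdf) => //.
- by move=> a h h0; split; [exact: has_lim_ramp|exact: bmeas_ramp].
- by move=> c; split; [exact: has_lim_cst|exact: bmeas_cst].
- by move=> g1 g2 [l1 b1] [l2 b2]; split; [exact: has_limD|exact: bmeas_add].
- by move=> c g [l b]; split; [exact: has_limZ|exact: bmeas_scale].
- exact: cdf_neg.
- exact: cdf_nd.
- exact: cdf_le1.
- exact: cdf_lim.
- split=> [g1 g2 [l1 _] [l2 _]|c g [l _]|c|g1 g2 [l1 _] [l2 _] le12|a h h0].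
  + exact: LimD.
  + exact: LimZ.
  + exact: Lim_cst.
  + exact: Lim_le.
  + by rewrite cdf_le // cdf_ge.
- split=> [g1 g2 [_ l1] [_ l2]|c g [_ l]|c|g1 g2 [_ l1] [_ l2] le12|a h h0].
  + exact: mean_add.
  + exact: mean_scale.
  + exact: mean_cst.
  + exact: mean_le.
  + exact: mean_law_ramp.
by split=> //; apply: (@has_lim_ucont _ M).
Qed.
End Moments.

(** * Dyadic sums as integrals and averages *)

Section Bridge.
Variable R : realType.

Lemma measurable_of_balls (O : set (measurableTypeR R)) :
  (forall x : R, O x -> exists2 d : R, 0 < d & forall y : R, `|y - x| < d -> O y) -> measurable O.
Proof.
move=> H; apply: open_measurable; rewrite openE => x /H [d d0 Hd].
apply/nbhs_ballP; exists d => //= y; rewrite /ball /= distrC; exact: Hd.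
Qed.

Lemma measurable_fun_of_cont (f : measurableTypeR R -> R) :
  (forall (x e : R), 0 < e -> exists2 d : R, 0 < d & forall y : R, `|y - x| < d -> `|f y - f x| < e) ->
  measurable_fun setT f.
Proof.
move=> H; apply: continuous_measurable_fun => x; apply/cvgrPdist_lt => e e0.
have [d d0 Hd] := H x e e0.
apply/nbhs_ballP; exists d => //= y; rewrite /ball /= distrC => xy.
by rewrite distrC; apply: Hd.
Qed.

Lemma bmeas_ge (P : probability (measurableTypeR R) R) (f : measurableTypeR R -> R) (y : R) :
  measurable_fun setT f -> measurable [set x | y <= f x]%classic.
Proof.
move=> mf; have := mf measurableT `[y, +oo[%classic (measurable_itv _).
rewrite setTI; congr (measurable _); apply/seteqP; split=> x /=;
  by rewrite in_itv /= andbT.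
Qed.

Lemma approx_mean (P : probability (measurableTypeR R) R) (g : measurableTypeR R -> R) (n : nat) :
  bmeas g -> (forall x, 0 <= g x <= n%:R) ->
  `|\sum_(1 <= j < (n * 2 ^ n).+1) 2^-1 ^+ n * fine (P [set x | j%:R / 2 ^+ n <= g x]%classic)
     - mean P g| <= 2^-1 ^+ n.
Proof.
move=> bg gn; have mA j : measurable [set x | j%:R / 2 ^+ n <= g x]%classic.
  by apply: bmeas_ge => //; case: bg.
have bA j := bmeas_scale (2^-1 ^+ n) (bmeas_indic (mA j)).
rewrite (eq_bigr (fun j => mean P (fun x => 2^-1 ^+ n *
    (\1_[set x | j%:R / 2 ^+ n <= g x]%classic : measurableTypeR R -> R) x))); last first.
  by move=> j _; rewrite mean_scale ?mean_indic //; apply: bmeas_indic.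
rewrite -mean_sum //; apply: mean_dist => //; first exact: bmeas_sum.
move=> x; have := dyadic_approx (gn x); congr (`|_ - _| <= _).
apply: eq_bigr => j _; rewrite indicE; congr (_ * (nat_of_bool _)%:R).
by apply/idP/idP; rewrite inE.
Qed.

Lemma approx_avg (ls : seq R) (g : R -> R) (n : nat) :
  (forall x, 0 <= g x <= n%:R) -> ls != [::] ->
  `|\sum_(1 <= j < (n * 2 ^ n).+1) 2^-1 ^+ n * avg (fun x => (j%:R / 2 ^+ n <= g x)%R%:R) ls
     - avg g ls| <= 2^-1 ^+ n.
Proof.
move=> gn l0; under eq_bigr do rewrite -avgZ.
rewrite -avg_sum -avgB ler_norml.
have N0 : 0 < (size ls)%:R :> R by rewrite ltr0n lt0n size_eq0.
rewrite /avg ler_pdivlMr // ler_pdivrMr //.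
have c (c : R) : c * (size ls)%:R = \sum_(l <- ls) c.
  by rewrite big_const_seq count_predT iter_addr_0 mulr_natr.
rewrite !c; apply/andP; split; apply: ler_sum => l _;
  by have := dyadic_approx (gn l); rewrite ler_norml => /andP[].
Qed.

Lemma prob_sigma_additive (P : probability (measurableTypeR R) R) (A : nat -> set (measurableTypeR R)) (e : R) :
  (forall i, measurable (A i)) -> (forall i j x, i <> j -> A i x -> A j x -> False) -> 0 < e ->
  exists N : nat, forall n, (N <= n)%N ->
    `|\sum_(0 <= i < n) fine (P (A i)) - fine (P (\bigcup_i A i)%classic)| < e.
Proof.
move=> mA tA e0.
have tI : trivIset setT A.
  apply/trivIsetP => i j _ _ /eqP ij; apply/seteqP; split=> x //= [xi xj].
  exact: tA ij xi xj.
have mU : measurable (\bigcup_i A i)%classic by exact: bigcupT_measurable.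
have := @measure_semi_sigma_additive _ _ _ P A mA tI mU.
have fP i : P (A i) \is a fin_num by apply: fin_num_measure.
have fU : P (\bigcup_i A i)%classic \is a fin_num by apply: fin_num_measure.
rewrite -[X in (_ --> X)%classic](fineK fU).
move=> /fine_cvgP [_] /cvgrPdist_lt /(_ e e0) [N _ HN].
exists N => n Nn; rewrite distrC; have := HN n Nn; congr (`|_ - _| < _).
rewrite /= -[RHS]/(fine (_%:E)); congr fine.
by rewrite -sumEFin; apply: eq_bigr => i _; rewrite fineK.
Qed.
End Bridge.

(** * Weak convergence *)

Section StdlibBridge.
Implicit Types (f g : RR -> RR) (m : Rmeasure).

Lemma continuityP f (x e : RR) : continuity f -> 0 < e ->
  exists2 d : RR, 0 < d & forall y, `|y - x| < d -> `|f y - f x| < e.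
Proof.
move=> cf e0; have [d [/RltP d0 Hd]] := cf x e (elimT RltP e0).
exists d => // y yx; have [->|yx0] := eqVneq y x; first by rewrite subrr normr0.
have := Hd y; rewrite /= !RdistE => H; apply/RltP; apply: H.
split; last exact/RltP.
by split=> // /esym /eqP; apply/negP.
Qed.

Lemma continuity_ucont f a b : continuity f -> ucont_on f a b.
Proof.
move=> cf e e0.
have := @Heine f (fun c => Rle a c /\ Rle c b) (compact_P3 a b) (fun x _ => cf x).
move=> /(_ (mkposreal e (elimT RltP e0))) [[d dp] Hd]; exists d; first exact/RltP.
move=> x y /andP[/RleP ax /RleP xb] /andP[/RleP ay /RleP yb] /RltP xy.
by apply/RltP; rewrite -RabsE; apply: Hd => //=; rewrite RabsE.
Qed.

Lemma bounded_continuous_bmeas f : bounded_continuous f -> bmeas f.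
Proof.
move=> [cf [M fM]]; split.
  by apply: measurable_fun_of_cont => x e e0; apply: continuityP.
by exists M => x; apply/RleP; rewrite -RabsE.
Qed.

Lemma Borel_measurable (A : RR -> Prop) : Borel A -> measurable (A : set (measurableTypeR RR)).
Proof.
move=> /(_ (fun A => measurable (A : set (measurableTypeR RR)))); apply.
  split; first exact: measurableT.
  split=> [B|B mB]; first exact: measurableC.
  rewrite (_ : (fun x => _) = (\bigcup_i B i)%classic); first exact: bigcupT_measurable.
  by apply/seteqP; split=> x; [case=> i; exists i|case=> i _; exists i].
move=> O oO; apply: measurable_of_balls => x /oO [[d dp] Hd]; exists d; first exact/RltP.
by move=> y /RltP xy; apply: Hd; rewrite /disc /= RabsE.
Qed.

Definition Rlaw (P : probability (measurableTypeR RR) RR) : Rmeasure :=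
  fun A => fine (P (A : set (measurableTypeR RR))).

Lemma Rlaw_prob P : is_prob_measure (Rlaw P).
Proof.
split; [|split].
- by move=> A _; apply/RleP/fine_ge0.
- by rewrite /Rlaw [P _]probability_setT.
move=> A bA dA; apply/Un_cvP => e e0.
have mA i := Borel_measurable (bA i).
have [N HN] := prob_sigma_additive P mA dA e0.
exists N => n Nn; have := HN n.+1 (leqW Nn); rewrite sum_f_R0E.
congr (`|_ - _| < _); congr fine; congr (P _).
by apply/seteqP; split=> x; [case=> i _; exists i|case=> i; exists i].
Qed.

Lemma esdE (ls : seq RR) (A : RR -> Prop) : esd ls A = avg (fun x => (asbool (A x))%:R) ls.
Proof.
rewrite /esd /avg mulrC INRE; congr (_ * _).
by rewrite bigRplusE; apply: eq_bigr => l _; rewrite indic_asbool.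
Qed.

Lemma esd_prob (ls : seq RR) : ls != [::] -> is_prob_measure (esd ls).
Proof.
move=> l0; split; [|split].
- move=> A _; apply/RleP; rewrite esdE /avg divr_ge0 //; apply: sumr_ge0 => i _; exact: ler0n.
- rewrite esdE (_ : (fun _ => _) = fun=> 1); first exact: avg_cst.
  by apply/funext => x; rewrite asboolT.
move=> A _ dA; apply/Un_cvP => e e0.
(* Each atom lies in at most one set of the family, so sets beyond some N carry no mass and the
   series is eventually constant. *)
have [N HN] : exists N : nat, forall x, x \in ls -> (exists i, A i x) -> exists2 i, (i < N)%N & A i x.
  elim: ls {l0} => [|l ls [N HN]]; first by exists 0%N.
  have [[i Ai]|no] := pselect (exists i, A i l).
    exists (maxn N i.+1) => x; rewrite inE => /orP[/eqP -> _|xl Ax].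
      by exists i => //; rewrite leq_max ltnSn orbT.
    by have [j jN Aj] := HN x xl Ax; exists j => //; rewrite leq_max jN.
  by exists N => x; rewrite inE => /orP[/eqP -> //|]; apply: HN.
exists N => n Nn; rewrite sum_f_R0E (eq_bigr _ (fun i _ => esdE ls (A i))) esdE.
rewrite -avg_sum [X in `|X|](_ : _ = 0) ?normr0 //; apply/eqP; rewrite subr_eq0; apply/eqP.
rewrite /avg; congr (_ / _); rewrite big_seq [RHS]big_seq; apply: eq_bigr => x xl.
have [ex|no] := pselect (exists i, A i x); last first.
  rewrite [in RHS]asboolF // big1 // => i _; rewrite asboolF // => Ai; apply: no; by exists i.
have [i iN Ai] := HN x xl ex; rewrite [in RHS]asboolT //.
have iI : i \in index_iota 0 n.+1 by rewrite mem_index_iota (leq_trans iN) // leqW.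
rewrite (bigD1_seq i iI (iota_uniq _ _)) /= asboolT // big1 ?addr0 // => j ji; rewrite asboolF // => Aj.
by apply: dA Aj Ai; apply/eqP.
Qed.

(** For a bounded integrand the cap in [approx_integral] is inactive from some n0 on, and the rate
    2^-n then identifies the limit. *)
Lemma nonneg_integral_val m (g : RR -> RR) (I J : RR) (n0 : nat) :
  (forall n, (n0 <= n)%N -> `|approx_integral m g n - J| <= 2^-1 ^+ n) ->
  nonneg_integral m g I -> I = J.
Proof.
move=> HJ /Un_cvP HI; apply/eqP; rewrite -subr_eq0 -normr_eq0 eq_le normr_ge0 andbT.
apply/ler_addgt0Pl => e e0; rewrite addr0.
have e2 : 0 < e / 2 by rewrite divr_gt0.
have [N HN] := HI _ e2.
pose n := maxn (maxn N n0) (Num.bound (e / 2)^-1).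
have h1 := HN n _; have h2 := HJ n _.
have {h1} h1 : `|approx_integral m g n - I| < e / 2 by apply: h1; rewrite /n; lia.
have {h2} h2 : `|approx_integral m g n - J| <= 2^-1 ^+ n by apply: h2; rewrite /n; lia.
have h3 : (2^-1 : RR) ^+ n < e / 2.
  rewrite exprVn -[ltRHS]invrK ltf_pV2 ?posrE ?exprn_gt0 ?invr_gt0 //.
  apply: lt_trans (archi_boundP _) _; first by rewrite invr_ge0 ltW.
  apply: le_lt_trans (_ : n%:R < _); first by rewrite ler_nat leq_max leqnn orbT.
  by rewrite -natrX ltr_nat ltn_expl.
apply: le_trans (ler_distD (approx_integral m g n) _ _) _.
by rewrite distrC [leRHS]splitr lerD // ltW // (le_lt_trans h2).
Qed.

Lemma dyadic_leP (j n : nat) (y : RR) :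
  Rle (Rdiv (INR j) (IZR 2 ^+ n)) y <-> j%:R * 2^-1 ^+ n <= y.
Proof. by rewrite INRE RdivE exprVn; split=> /RleP. Qed.

Lemma Rlaw_nonneg P g I : bmeas g -> (forall x, 0 <= g x) -> nonneg_integral (Rlaw P) g I ->
  I = mean P g.
Proof.
move=> bg g0; have [M gM] := bg.2.
apply: (@nonneg_integral_val _ _ _ _ (Num.bound M)) => n nM.
have M0 : 0 <= M by apply: le_trans (gM 0).
have gn x : 0 <= g x <= n%:R.
  rewrite g0 /= -[g x]ger0_norm //; apply: le_trans (gM x) _.
  by apply: le_trans (ltW (archi_boundP M0)) _; rewrite ler_nat.
have := approx_mean P bg gn; congr (`|_ - _| <= _).
rewrite /approx_integral bigRplusE; apply: eq_bigr => j _.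
rewrite RinvE RpowE -exprVn; congr (_ * fine (P _)).
apply/seteqP; split=> x /= H;
  [exact: (proj2 (dyadic_leP j n (g x)) H)|exact: (proj1 (dyadic_leP j n (g x)) H)].
Qed.

Lemma esd_nonneg ls g M I : ls != [::] -> (forall x, 0 <= g x <= M) ->
  nonneg_integral (esd ls) g I -> I = avg g ls.
Proof.
move=> l0 gM; apply: (@nonneg_integral_val _ _ _ _ (Num.bound M)) => n nM.
have M0 : 0 <= M by have /andP[] := gM 0; apply: le_trans.
have gn x : 0 <= g x <= n%:R.
  have /andP[-> gx] := gM x; apply: le_trans gx _.
  by apply: le_trans (ltW (archi_boundP M0)) _; rewrite ler_nat.
have := approx_avg gn l0; congr (`|_ - _| <= _).
rewrite /approx_integral bigRplusE; apply: eq_bigr => j _.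
rewrite RinvE RpowE -exprVn esdE; congr (_ * _); congr avg; apply/funext => x.
by congr (nat_of_bool _)%:R; apply/idP/asboolP => H; apply/dyadic_leP.
Qed.

Lemma pos_part_bounds f M x : (forall x, Rle (Rabs (f x)) M) ->
  (0 <= Rmax (f x) 0 <= M) && (0 <= Rmax (- f x) 0 <= M).
Proof.
move=> fM; have := introT RleP (fM x); rewrite RabsE ler_norml => /andP[a b].
rewrite !RmaxE; have M0 : 0 <= M by lra.
by rewrite !le_max !ge_max !lexx !orbT M0 b RoppE lerNl a.
Qed.

Lemma pos_part_sub f x : Rmax (f x) 0 - Rmax (- f x) 0 = f x.
Proof.
rewrite !RmaxE RoppE R0E !maxElt.
by case: (ltP (f x) 0) => ?; case: (ltP (- f x) 0) => ?; lra.
Qed.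

Lemma pos_part_continuous f : bounded_continuous f ->
  bounded_continuous (fun x => Rmax (f x) 0) /\ bounded_continuous (fun x => Rmax (- f x) 0).
Proof.
move=> [cf [M fM]]; have b x := pos_part_bounds x fM.
have c (s : RR -> RR) : (forall x y, `|s x - s y| <= `|f x - f y|) -> continuity s.
  move=> Hs x e /RltP e0; have [d d0 Hd] := continuityP x cf e0.
  exists d; split; first exact/RltP.
  move=> y [_]; rewrite /= !RdistE => /RltP /Hd H; apply/RltP.
  exact: le_lt_trans (Hs _ _) H.
have lip (u v : RR) : `|Num.max u 0 - Num.max v 0| <= `|u - v|.
  by rewrite 2!(maxC _ 0); apply: max_lip.
split; split.
- by apply: c => x y; rewrite !RmaxE.
- by exists M => x; apply/RleP; rewrite RabsE; have /andP[/andP[b0 b1] _] := b x; rewrite ger0_norm.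
- by apply: c => x y; rewrite !RmaxE; apply: le_trans (lip _ _) _; rewrite !RoppE -opprD normrN.
- by exists M => x; apply/RleP; rewrite RabsE; have /andP[_ /andP[b0 b1]] := b x; rewrite ger0_norm.
Qed.

Lemma Rlaw_integrates P f I : bounded_continuous f -> integrates (Rlaw P) f I -> I = mean P f.
Proof.
move=> bf [I1 [I2 [H1 [H2 ->]]]]; have [b1 b2] := pos_part_continuous bf.
have [cf [M fM]] := bf.
have m1 := bounded_continuous_bmeas b1; have m2 := bounded_continuous_bmeas b2.
rewrite (Rlaw_nonneg m1 _ H1) ?(Rlaw_nonneg m2 _ H2); last first.
- by move=> x; have /andP[/andP[]] := pos_part_bounds x fM.
- by move=> x; have /andP[_ /andP[]] := pos_part_bounds x fM.
rewrite RminusE -mulN1r -mean_scale // -mean_add //; last exact: bmeas_scale.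
by congr mean; apply/funext => x; rewrite mulN1r pos_part_sub.
Qed.

Lemma esd_integrates ls f I : ls != [::] -> bounded_continuous f -> integrates (esd ls) f I ->
  I = avg f ls.
Proof.
move=> l0 [cf [M fM]] [I1 [I2 [H1 [H2 ->]]]].
rewrite (@esd_nonneg _ _ M _ l0 _ H1) ?(@esd_nonneg _ _ M _ l0 _ H2); last first.
- by move=> x; have /andP[] := pos_part_bounds x fM.
- by move=> x; have /andP[_] := pos_part_bounds x fM.
by rewrite RminusE -avgB; congr avg; apply/funext => x; rewrite pos_part_sub.
Qed.

Variables (beta : nat -> RR) (A0 C0 : RR).
Hypothesis C0_ge1 : 1 <= C0.
Hypothesis beta_le : forall m : nat, `|beta m| <= A0 * C0 ^+ m * m`!%:R.
Hypothesis good_ex : forall (N : nat) (d : RR), 0 < d -> exists ls, good beta N d ls.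

(** A basic weak neighbourhood involves finitely many test functions, and [near_good] is stable
    under finite intersections. *)
Theorem moment_method : exists mu : Rmeasure, is_prob_measure mu /\
  forall U, weak_open U -> U mu ->
    exists (N : nat) (d : RR), 0 < d /\ forall ls, good beta N d ls -> U (esd ls).
Proof.
pose P := limit_law C0_ge1 beta_le good_ex.
exists (Rlaw P); split; first exact: Rlaw_prob.
move=> U oU Umu; have [fs [eps [/RltP e0 [bfs HU]]]] := oU _ (Rlaw_prob P) Umu.
have [N [d [d0 H]]] : near_good beta (fun ls => forall f, List.In f fs -> `|avg f ls - mean P f| < eps).
  elim: fs bfs {HU} => [|f fs IH] bfs; first by exists 0%N, 1; split.
  have bf : bounded_continuous f by apply: bfs; left.
  have [cf [M fM]] := bf.
  have fM' x : `|f x| <= M by apply/RleP; rewrite -RabsE.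
  have uf a b : ucont_on f a b := continuity_ucont a b cf.
  have hl : has_lim beta f by apply: (has_lim_ucont C0_ge1 beta_le good_ex fM').
  have mE : mean P f = Lim beta f.
    by apply: mean_limit_law fM' uf; apply: bounded_continuous_bmeas.
  have H1 : near_good beta (fun ls => `|avg f ls - mean P f| < eps).
    by rewrite mE; apply: LimP.
  have H2 := IH (fun g gfs => bfs g (or_intror gfs)).
  apply: near_goodS (near_goodI H1 H2) => ls _ _ [h1 h2] g /= [<- //|]; exact: h2.
exists N, d; split=> // ls gl; have [l0 _ _] := gl.
apply: HU; first exact: esd_prob.
move=> f ff I I' HI HI'; have bf := bfs f ff.
rewrite (Rlaw_integrates bf HI) (esd_integrates l0 bf HI') RabsE.
by apply/RltP; rewrite RminusE distrC; apply: H.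
Qed.
End StdlibBridge.

(** * Conclusion *)

Lemma moment0 (R : realFieldType) k (c : R) : moment k c 0 = 1.
Proof.
have -> : moment k c 0 = (all (mem (iota 0 k.+1)) (iota 0 k.+1))%:R by [].
by rewrite (allss (iota 0 k.+1)).
Qed.

Lemma trw0_face n (k : nat) (X : {set {set 'I_n}}) :
  0 < trace_walk k (@cobd n) 0 X -> exists2 s, s \in X & #|s| = k.+1.
Proof.
move=> t0;
  have [/existsP[s /andP[sX /eqP sk]]|no] := boolP [exists s : {set 'I_n}, (s \in X) && (#|s| == k.+1)].
  by exists s.
move: t0; rewrite /trace_walk big1 ?ltxx // => s sk.
by move/existsPn/(_ s): no; rewrite sk andbT => /negPf ->; rewrite mul0r.
Qed.

Section Conclusion.
Variables (k : nat) (c : RR) (p : forall n : nat, {set {set 'I_n}} -> RR).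
Hypothesis c_gt0 : 0 < c.
Hypothesis p_rand : forall n, is_random_subcomplex (@p n).
Hypothesis p_hom : forall n, Defs.homogeneous (@p n).
Hypothesis p_indep : forall n, spatially_independent (@p n).
Hypothesis q_infty : forall M : RR, exists n0 : nat, forall n, (n0 <= n)%N ->
  M < n%:R ^+ k.+1 * q_k (@p n) k.
Hypothesis r_lim : forall e : RR, 0 < e -> exists n0 : nat, forall n, (n0 <= n)%N ->
  `|n%:R * r_k (@p n) k - c| < e.

Let beta (m : nat) : RR := moment k c m.

Definition typical N d n (X : {set {set 'I_n}}) := dim_ge k X /\
  exists2 ls, is_spectrum (@Lup n X k) ls & good beta N d ls.

(** The trace of order 0 is the number f of k-simplices, and e <= 1/2 gives f >= a / 2. Then the
    m-th moment minus [beta m] is ((trace - a beta) - (f - a) beta) / f, of size at most 2 e (1 + B)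
    <= d / 2. [N.+1] makes order 0 available even when N = 0. *)
Lemma moments_close_typical N d n (Q : nat -> RR) (X : {set {set 'I_n}}) :
  let e := Num.min (2^-1) (d / (4 * (1 + \sum_(m < N) `|beta m|))) in
  0 < d -> 0 < mean_faces 'I_n Q k -> cplx X ->
  moments_close Q k (@cobd n) c N.+1 e X -> typical N d X.
Proof.
set B := \sum_(m < N) `|beta m|; move=> e d0; set a := mean_faces _ _ _ => a0 cX /forallP cl.
have B0 : 0 <= B by apply: sumr_ge0 => m _; apply: normr_ge0.
have B1 : 0 < 4 * (1 + B) by rewrite mulr_gt0 // ltr_pwDl.
have e2 : e <= 2^-1 by rewrite ge_min lexx.
have eB : e * (4 * (1 + B)) <= d by rewrite -ler_pdivlMr // ge_min lexx orbT.
have e0 : 0 < e by rewrite lt_min invr_gt0 ltr0n divr_gt0.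
have [ls [sp pos mom]] := @Lup_spectrum n k X cX.
have szE : (size ls)%:R = trace_walk k (@cobd n) 0 X.
  rewrite -mom -sum1_size natr_sum; apply: eq_bigr => l _; exact: expr0.
set f := trace_walk k (@cobd n) 0 X in szE.
have f_a : `|f - a| <= e * a by have := cl ord0; rewrite -/a moment0 mulr1.
have fa : a / 2 <= f.
  have : e * a <= 2^-1 * a by rewrite ler_wpM2r // ltW.
  by move: f_a; rewrite ler_distl => /andP[+ _]; lra.
have f0 : 0 < f by apply: lt_le_trans fa; rewrite divr_gt0.
split; first by have [s sX sk] := trw0_face f0; exists s; rewrite sk.
exists ls => //; split=> //.
  by apply/eqP => l0; move: f0; rewrite -szE l0 ltxx.
move=> m mN; rewrite /avg mom szE.
have Sm : `|trace_walk k (@cobd n) m X - a * beta m| <= e * a := cl (Ordinal (leqW mN)).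
have bB : `|beta m| <= B.
  rewrite /B (bigD1 (Ordinal mN)) //= lerDl; apply: sumr_ge0 => i _; exact: normr_ge0.
rewrite -[X in _ - X](mulfK (lt0r_neq0 f0)) -mulrBl normrM normfV (gtr0_norm f0) ltr_pdivrMr //.
rewrite (_ : _ - _ = (trace_walk k (@cobd n) m X - a * beta m) - (f - a) * beta m); last by ring.
apply: le_lt_trans (ler_normB _ _) _; rewrite normrM.
have h1 : `|f - a| * `|beta m| <= e * a * B by rewrite ler_pM ?normr_ge0.
have h2 : e * (4 * (1 + B)) * a <= d * a by rewrite ler_wpM2r // ltW.
have h3 : d * (a / 2) <= d * f by rewrite ler_wpM2l // ltW.
have h4 : 0 < d * a by rewrite mulr_gt0.
lra.
Qed.

Lemma Pr_and n (E D : {set {set 'I_n}} -> Prop) : Pr (@p n) (fun X => E X /\ D X) <= Pr (@p n) D.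
Proof. by apply: Pr_le => // X _ []. Qed.

(** Concentration is known relative to the presence of the empty simplex. Conditioning on [dim_ge k]
    instead loses nothing: typical complexes satisfy it, and its probability is at most
    [empty_pr]. *)
Lemma eventually_typical N d e : 0 < d -> 0 < e -> e < 1 -> exists n0 : nat, forall n, (n0 <= n)%N ->
  0 < Pr (@p n) (dim_ge k) /\
  (1 - e) * Pr (@p n) (dim_ge k) <= Pr (@p n) (fun X => typical N d X).
Proof.
move=> d0 e0 e1; pose e' : RR := Num.min (2^-1) (d / (4 * (1 + \sum_(m < N) `|beta m|))).
have e'0 : 0 < e'.
  rewrite lt_min invr_gt0 ltr0n divr_gt0 // mulr_gt0 // ltr_pwDl //.
  by apply: sumr_ge0 => m _; apply: normr_ge0.
have [n0 H0] := concentration c_gt0 p_rand p_hom p_indep q_infty r_lim N.+1 e'0 e0.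
exists n0 => n /H0[P00 a0 HE].
have W0 := cond_law_ge0 (p_rand n) P00; have WC := @cond_law_ncplx n (@p n).
have le1 : (1 - e) * empty_pr (@p n) <= Pr (@p n) (fun X => typical N d X).
  rewrite mulrC;
    apply: le_trans (_ : _ <= empty_pr (@p n) * Ex (cond_law (@p n)) (fun X => (asbool (typical N d X))%:R)) _.
    rewrite ler_wpM2l ?(ltW P00) //; apply: le_trans HE _; apply: (le_Ex W0 WC) => X cX.
    rewrite ler_nat; case: (boolP (moments_close _ _ _ _ _ _ X)) => // cl.
    by rewrite asboolT //; apply: moments_close_typical cl.
  by rewrite -Pr_cond_law //; apply: Pr_le => // X _ [].
have leD : Pr (@p n) (dim_ge k) <= empty_pr (@p n).
  by apply: Pr_le => // X sX [s [sX' _]]; apply: sX sX' (finset.sub0set _).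
have leT : Pr (@p n) (fun X => typical N d X) <= Pr (@p n) (dim_ge k).
  by apply: Pr_le => // X _ [].
split; last by apply: le_trans le1; rewrite ler_wpM2l // subr_ge0 ltW.
apply: lt_le_trans leT; apply: lt_le_trans le1; by rewrite mulr_gt0 // subr_gt0.
Qed.

(** An event of positive probability is nonempty; the spectrum of one typical complex is the list
    sought. *)
Lemma good_exists N d : 0 < d -> exists ls, good beta N d ls.
Proof.
have h0 : 0 < 2^-1 :> RR by rewrite invr_gt0 ltr0n.
have h1 : 2^-1 < 1 :> RR by rewrite invf_lt1 ?ltr1n ?ltr0n.
move=> d0; have [n0 H] := eventually_typical N d0 h0 h1.
have [D0 DT] := H n0 (leqnn _).
have T0 : 0 < Pr (@p n0) (fun X => typical N d X).
  by apply: lt_le_trans DT; rewrite mulr_gt0 // subr_gt0.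
have [[X [_ [ls _ gl]]]|no] := pselect (exists X : {set {set 'I_n0}}, typical N d X); first by exists ls.
move: T0; rewrite Pr_sum big1 ?ltxx // => X _; rewrite asboolF ?mul0r // => T; apply: no; by exists X.
Qed.

Lemma esd_concentration : exists mu : Rmeasure, is_prob_measure mu /\
  forall U : Rmeasure -> Prop, weak_open U -> U mu ->
    Un_cv (fun n => cond_Pr (@p n) (esd_in k U) (dim_ge k)) 1.
Proof.
pose A := Num.bound c.
have cA : 0 <= c <= A%:R by rewrite (ltW c_gt0) ltW // archi_boundP // ltW.
have C1 : 1 <= (k.+2 * (k.+1 + A).+1)%:R :> RR by rewrite ler1n.
have bb m : `|beta m| <= 1 * (k.+2 * (k.+1 + A).+1)%:R ^+ m * m`!%:R.
  by rewrite mul1r; apply: moment_bound.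
have [mu [pm Hmu]] := moment_method C1 bb good_exists.
exists mu; split=> // U oU Umu; have [N [d [d0 HU]]] := Hmu U oU Umu.
apply/Un_cvP => e e0; pose e1 := Num.min (e / 2) (2^-1).
have e10 : 0 < e1 by rewrite lt_min divr_gt0 // invr_gt0 ltr0n.
have e11 : e1 < 1 by rewrite gt_min; apply/orP; right; lra.
have e1e : e1 < e by rewrite gt_min; apply/orP; left; lra.
have [n0 H] := eventually_typical N d0 e10 e11; exists n0 => n /H[D0 DT].
rewrite /cond_Pr RdivE.
have le1 : Pr (@p n) (fun X => esd_in k U X /\ dim_ge k X) / Pr (@p n) (dim_ge k) <= 1.
  by rewrite ler_pdivrMr // mul1r Pr_and.
have ge1 : 1 - e1 <= Pr (@p n) (fun X => esd_in k U X /\ dim_ge k X) / Pr (@p n) (dim_ge k).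
  rewrite ler_pdivlMr //; apply: le_trans DT _; apply: Pr_le => // X _ [dX [ls sp gl]].
  by split=> //; exists ls; split=> //; apply: HU.
rewrite ltr_distl; apply/andP; split; first by apply: lt_le_trans ge1; rewrite ltrD2l ltrN2.
by apply: le_lt_trans le1 _; rewrite ltrDl.
Qed.
End Conclusion.

Local Open Scope R_scope.

Theorem theorem5p1 (k : nat) (c : R) (hc : 0 < c)
  (p : forall n : nat, {set {set 'I_n}} -> R)
  (hrand : forall n, is_random_subcomplex (p n))
  (hhom : forall n, homogeneous (p n))
  (hsi : forall n, spatially_independent (p n))
  (hq : cv_infty (fun n => INR n ^ (k + 1) * q_k (p n) k))
  (hr : Un_cv (fun n => INR n * r_k (p n) k / c) 1) :
  exists mu : Rmeasure, is_prob_measure mu /\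
    forall U : Rmeasure -> Prop, weak_open U -> U mu ->
      Un_cv (fun n => cond_Pr (p n) (esd_in k U) (dim_ge k)) 1.
Proof.
have c0 : (0 < c :> RR)%R := introT RltP hc.
apply: (@esd_concentration k c (fun n => p n)) => //.
  move=> M; have [n0 H] := hq M; exists n0 => n /ssrnat.leP /H /RltP.
  by rewrite INRE RpowE addn1.
(* An error e / c on n [r_k] / c is an error e on n [r_k]. *)
move=> e e0; have ec : (0 < e / c :> RR)%R by rewrite divr_gt0.
have [n0 H] := (Un_cvP _ _).1 hr _ ec; exists n0 => n /H.
rewrite INRE !RdivE ltr_pdivlMr // -[X in (_ * X < _)%R](gtr0_norm c0) -normrM.
by rewrite mulrBl divfK ?gt_eqF // mul1r.
Qed.
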